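(* There is a sufficiently large constant $C>0$ such that the following holds. (a) For 3-Majority started from any initial configuration with $\gamma_0\ge C\log n/\sqrt n$, the consensus time is $O(\log n/\gamma_0)$ with high probability. (b) For 2-Choices started from any initial configuration with $\gamma_0\ge C(\log n)^2/n$, the consensus time is $O(\log n/\gamma_0)$ with high probability.
   Context: **Setting.** Let $V$ be a set of $n$ vertices and $k\in\{1,\dots,n\}$. A configuration is a map $\mathsf{opn}\colon V\to[k]=\{1,\dots,k\}$. The process is synchronous: each round $t\ge1$ produces $\mathsf{opn}_t$ from $\mathsf{opn}_{t-1}$, and all vertices make their choices independently. **3-Majority.** Each vertex $v$ samples $w_1,w_2,w_3\in V$ independently and uniformly, with replacement. It sets $\mathsf{opn}_t(v)=\mathsf{opn}_{t-1}(w_1)$ if $\mathsf{opn}_{t-1}(w_1)=\mathsf{opn}_{t-1}(w_2)$, and $\mathsf{opn}_t(v)=\mathsf{opn}_{t-1}(w_3)$ otherwise. **2-Choices.** Each vertex $v$ samples $w_1,w_2\in V$ independently and uniformly, with replacement. It sets $\mathsf{opn}_t(v)=\mathsf{opn}_{t-1}(w_1)$ if $\mathsf{opn}_{t-1}(w_1)=\mathsf{opn}_{t-1}(w_2)$, and $\mathsf{opn}_t(v)=\mathsf{opn}_{t-1}(v)$ otherwise. **Basic quantities.** - $\alpha_t(i)=|\{v:\mathsf{opn}_t(v)=i\}|/n$ is the fraction of vertices holding opinion $i$. - $\gamma_t=\sum_{i\in[k]}\alpha_t(i)^2$. - The consensus time is $\tau_{\mathrm{cons}}=\inf\{t\ge0:\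 \exists i\ \forall v,\ \mathsf{opn}_t(v)=i\}$. **Conventions.** ''With high probability'' means with probability $1-O(n^{-c})$ for some constant $c>0$, as $n\to\infty$. Hidden constants are independent of $n$, $k$ and the initial configuration. *)

(* Defs.v *)
From HB Require Import structures.
From mathcomp Require Import all_boot all_order all_algebra.
From mathcomp Require Import all_classical all_reals.
From mathcomp Require Import exp.
Set Implicit Arguments. Unset Strict Implicit. Unset Printing Implicit Defensive.
Import Order.TTheory GRing.Theory Num.Theory.
Local Open Scope ring_scope.

(* Vertices V = 'I_n, opinions [k] represented by 'I_k. *)
Definition config (n k : nat) := {ffun 'I_n -> 'I_k}.

Section Defs.
Variables (R : realType) (n k : nat).

Definition alpha (c : config n k) (i : 'I_k) : R :=
  #|[set v | c v == i]|%:R / n%:R.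

Definition gamma (c : config n k) : R := \sum_(i < k) alpha c i ^+ 2.

Definition is_consensus (c : config n k) : bool :=
  [exists i : 'I_k, [forall v : 'I_n, c v == i]].

(* Local update rules: given the previous configuration, the updating vertex
   v, and the vertex samples w (uniform, independent, with replacement). *)
Definition maj3_rule (c : config n k) (v : 'I_n) (w : 'I_n * 'I_n * 'I_n) : 'I_k :=
  let: (w1, w2, w3) := w in if c w1 == c w2 then c w1 else c w3.

Definition twoch_rule (c : config n k) (v : 'I_n) (w : 'I_n * 'I_n) : 'I_k :=
  let: (w1, w2) := w in if c w1 == c w2 then c w1 else c v.

(* Synchronous transition kernel: every vertex independently draws its sample
   s uniformly from the finite sample space S and applies the rule. *)
Definition trans (S : finType) (rule : config n k -> 'I_n -> S -> 'I_k)
  (c c' : config n k) : R :=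
  \prod_(v : 'I_n) \sum_(s : S) (#|S|%:R)^-1 * (rule c v s == c' v)%:R.

Definition path_prob (S : finType) (rule : config n k -> 'I_n -> S -> 'I_k)
  (c0 : config n k) (T : nat) (p : {ffun 'I_T.+1 -> config n k}) : R :=
  (p ord0 == c0)%:R *
  \prod_(t < T) trans rule (p (inord t)) (p (inord t.+1)).

Definition prob_cons_by (S : finType) (rule : config n k -> 'I_n -> S -> 'I_k)
  (c0 : config n k) (T : nat) : R :=
  \sum_(p : {ffun 'I_T.+1 -> config n k} | [exists t, is_consensus (p t)])
     path_prob rule c0 p.

End Defs.

(* Main.v *)
Require Import Defs.
From HB Require Import structures.
From mathcomp Require Import all_boot all_order all_algebra.
From mathcomp Require Import all_classical all_reals.
From mathcomp Require Import exp sequences topology normedtype derive realfun.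
From mathcomp Require Import ring lra.
Set Implicit Arguments.
Unset Strict Implicit.
Unset Printing Implicit Defensive.
Import Order.TTheory GRing.Theory Num.Theory numFieldNormedType.Exports.
Local Open Scope ring_scope.

(* Writing x, y for the densities of two opinions i, j and g for gamma, both
   rules make every vertex v choose opinion o with probability
   alpha_o^2 + (1 - g) tau_v(o), where tau_v is the law of the fallback opinion;
   in expectation x becomes x (1 + x - g).  For each pair i <> j one follows

     x^a y^a * Y^b (1 + p Y)^(1/2),   Y = e / (e + U^2),

   where U is the difference of the two opinion counts and e is the scale of its
   variance: n for 3-Majority, the number of vertices holding i or j plus a
   constant K for 2-Choices, where factors X / (X + K) with X = n x, n y make up
   for that constant.  While i and j are nearly tied, the noise in one
   round spreads U and lowers Y; away from a tie, U^2 grows at the rate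
   (1 + x + y - g)^2, which beats the growth of x y by AM-GM.  Either way the
   pair potential contracts in expectation by exp(- const * g), and before
   consensus some pair has potential at least 1 / (1 + n).

   That gamma does not fall below gamma_0 / 2 follows from an exponential moment:
   gamma is convex, so it lies above its tangent at the mean of the next round,
   and gamma at that mean is at least its present value.  Summing the potentials
   over the at most n^2 pairs and adding a multiple of exp(- lam * gamma), which
   exceeds 1 once gamma < gamma_0 / 2, bounds the probability of no consensus. *)

(** * Expectations under product laws *)

Section ProductExpectation.
Context {R : realType} {n k : nat}.
Implicit Types (q : 'I_n -> 'I_k -> R) (f g : config n k -> R) (c : config n k).

(** The exponents leave little room. To first order in [v = x + y] and [g], and per unit of [p],
    density exponents [w] in 3-Majority contribute [w (v - 2 g)], while the square root of the bias
    factor contributes [g - a v]. The sum is [(w - a) v + (1 - 2 w) g], and since either of [v] and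
    [g] may dominate, [1 / 2 < w < a] is needed. With a bare power [Y^p], trading twice the variance
    for scale gives at most [a = 7 / 16]; the extra factor [1 + p Y] strengthens the contraction
    near a tie enough for [a = 58 / 100], and [w = 54 / 100] fits in between. A small [p] makes all
    terms of higher order in [p] negligible. The two thresholds come from the lower tail of gamma
    alone. An exponential moment with parameter of order [log n / gamma_0] grows in its exponent by
    about [(log n / gamma_0)^2 nu / n] per round, where [nu] is of order gamma for 3-Majority and
    gamma squared for 2-Choices. Keeping the total over order [log n / gamma_0] rounds below [log n]
    requires [gamma_0] of order [log n / sqrt n] and [(log n)^2 / n] respectively. *)

Definition pmf q := forall v, (forall o, 0 <= q v o) /\ \sum_o q v o = 1.

Definition expect q f : R := \sum_(c : config n k) (\prod_v q v (c v)) * f c.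

Definition upd c (v : 'I_n) (o : 'I_k) : config n k :=
  [ffun w => if w == v then o else c w].

Lemma expect_cst q (a : R) : pmf q -> expect q (fun=> a) = a.
Proof.
move=> hq; rewrite /expect -big_distrl /= -(bigA_distr_bigA q).
by rewrite big1 ?mul1r // => v _; case: (hq v).
Qed.

Lemma weight_ge0 q c : pmf q -> 0 <= \prod_v q v (c v).
Proof. by move=> hq; apply: prodr_ge0 => v _; case: (hq v). Qed.

Lemma expect_le q f g : pmf q -> (forall c, f c <= g c) ->
  expect q f <= expect q g.
Proof.
by move=> hq fg; apply: ler_sum => c _; apply: ler_wpM2l (fg c); exact: weight_ge0.
Qed.

Lemma expectD q f g : expect q (fun c => f c + g c) = expect q f + expect q g.
Proof. by rewrite /expect -big_split; apply: eq_bigr => c _; rewrite mulrDr. Qed.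

Lemma expectZ q (a : R) f : expect q (fun c => a * f c) = a * expect q f.
Proof. by rewrite /expect mulr_sumr; apply: eq_bigr => c _; rewrite mulrCA. Qed.

Lemma expect_sum q (I : finType) (P : pred I) (F : I -> config n k -> R) :
  expect q (fun c => \sum_(i | P i) F i c) = \sum_(i | P i) expect q (F i).
Proof.
rewrite /expect exchange_big; apply: eq_bigr => c _.
by rewrite mulr_sumr.
Qed.

Lemma eq_expect q f g : f =1 g -> expect q f = expect q g.
Proof. by move=> fg; apply: eq_bigr => c _; rewrite fg. Qed.

Lemma expect_ge0 q f : pmf q -> (forall c, 0 <= f c) -> 0 <= expect q f.
Proof.
by move=> hq f0; apply: sumr_ge0 => c _; apply: mulr_ge0 (f0 c); exact: weight_ge0.
Qed.

Lemma updE c v o w : upd c v o w = if w == v then o else c w.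
Proof. by rewrite ffunE. Qed.

(* Swapping the pair (c, o) with (upd c v o, c v) is an involution that
   preserves the joint weight. *)
Lemma expect_resample q v f : pmf q ->
  expect q (fun c => \sum_o q v o * f (upd c v o)) = expect q f.
Proof.
move=> hq; rewrite /expect.
pose sw (x : config n k * 'I_k) := (upd x.1 v x.2, x.1 v).
have swK : involutive sw.
  move=> [c o]; rewrite /sw /=; congr pair; last by rewrite updE eqxx.
  by apply/ffunP => w; rewrite !updE; case: eqP => // ->.
under eq_bigr do rewrite mulr_sumr.
rewrite pair_big /= (reindex_inj (inv_inj swK)) /=.
transitivity (\sum_(c : config n k) \sum_o q v o * ((\prod_w q w (c w)) * f c)); last first.
  by apply: eq_bigr => c _; rewrite -mulr_suml; case: (hq v) => _ ->; rewrite mul1r.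
rewrite pair_big /=; apply: eq_bigr => -[c o] _ /=.
have -> : upd (upd c v o) v (c v) = c.
  by apply/ffunP => w; rewrite !updE; case: eqP => // ->.
rewrite !mulrA; congr (_ * _).
rewrite (bigD1 v) //= [in RHS](bigD1 v) //= updE eqxx.
rewrite -[LHS]mulrA [_ * q v (c v)]mulrC; congr (_ * (_ * _)).
by apply: eq_bigr => w /negbTE wv; rewrite updE wv.
Qed.

Lemma expect_coord q v (h : 'I_k -> R) : pmf q ->
  expect q (fun c => h (c v)) = \sum_o q v o * h o.
Proof.
move=> hq; rewrite -(expect_resample v _ hq) -[RHS](expect_cst _ hq).
by apply: eq_expect => c; apply: eq_bigr => o _; rewrite updE eqxx.
Qed.

(** A supermartingale argument: [f j] is the bound kept once the first [j] vertices are revealed,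
    and resampling vertex [j] turns the pointwise step into a comparison of expectations. *)
Lemma expect_expose q (f : nat -> config n k -> R) : pmf q ->
  (forall v c, \sum_o q v o * f v.+1 (upd c v o) <= f v c) ->
  expect q (f n) <= expect q (f 0%N).
Proof.
move=> hq step.
suff: forall j, (j <= n)%N -> expect q (f j) <= expect q (f 0%N) by apply.
elim=> [//|j IH] jn; apply: le_trans (IH (ltnW jn)).
rewrite -(expect_resample (Ordinal jn) _ hq).
by apply: expect_le => // c; apply: (step (Ordinal jn)).
Qed.

End ProductExpectation.

(** * Elementary bounds for the logarithm and the exponential *)

Section LogExp.
Context {R : realType}.
Implicit Types (a b p q t x : R).

Lemma is_derive_ge0_le (f df : R -> R) a b : a <= b ->
  (forall x, a <= x <= b -> is_derive x 1 f (df x)) ->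
  (forall x, a <= x <= b -> 0 <= df x) -> f a <= f b.
Proof.
move=> ab hf h0.
have [x||c cab] := @MVT_segment R f df a b ab.
- by rewrite in_itv /= => /andP[/ltW ax /ltW xb]; apply: hf; rewrite ax.
- apply: derivable_within_continuous => x; rewrite in_itv /= => xab.
  by have [] := hf x xab.
- rewrite -subr_ge0 => ->; apply: mulr_ge0; last by rewrite subr_ge0.
  by apply: h0; move: cab; rewrite in_itv.
Qed.

Lemma invr_ge_lin x : 0 < x -> 2 - x <= x^-1.
Proof.
move=> x0; rewrite -[x^-1]mul1r ler_pdivlMr //.
by have := sqr_ge0 (x - 1); rewrite !expr2; lra.
Qed.

(** Comparing with the value at 1 yields a lower bound of [ln] to the right of 1 and an upper bound
    to the left. *)
Lemma ln_quad_homo a b : 0 < a -> a <= b ->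
  ln a - (a - 1) + (a - 1) ^+ 2 / 2 <= ln b - (b - 1) + (b - 1) ^+ 2 / 2.
Proof.
move=> a0 ab.
apply: (@is_derive_ge0_le (fun x => ln x - (x - 1) + (x - 1) ^+ 2 / 2)
  (fun x => x^-1 - 1 + (x - 1))) => // x /andP[ax _].
  have x0 : 0 < x by lra.
  have := is_derive1_ln x0 => H; apply: is_derive_eq.
  rewrite /GRing.scale /=.
  field; lra.
by have := invr_ge_lin (lt_le_trans a0 ax); lra.
Qed.

Lemma ln_ge_quad q : 0 <= q -> q - q ^+ 2 / 2 <= ln (1 + q).
Proof.
move=> q0; have := @ln_quad_homo 1 (1 + q) ltr01.
by rewrite ln1 lerDl => /(_ q0); lra.
Qed.

Lemma ln_le_quad t : 0 <= t -> t < 1 -> ln (1 - t) <= - t - t ^+ 2 / 2.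
Proof.
move=> t0 t1; have := @ln_quad_homo (1 - t) 1.
rewrite ln1 subr_gt0 t1 gerBl => /(_ isT t0).
by rewrite !expr2; lra.
Qed.

Lemma ln_ge_cubic q : `|q| <= 1 / 2 -> q - q ^+ 2 / 2 - `|q| ^+ 3 <= ln (1 + q).
Proof.
have [q0|q0] := ler0P q; last first.
  move=> _; have := ln_ge_quad (ltW q0).
  have : 0 <= q ^+ 3 by rewrite exprn_ge0 ?ltW.
  lra.
move=> q1.
have := @is_derive_ge0_le (fun x => (x - 1) - (x - 1) ^+ 2 / 2 + (x - 1) ^+ 3 - ln x)
  (fun x => 1 - (x - 1) + 3 * (x - 1) ^+ 2 - x^-1) (1 + q) 1.
rewrite ln1 gerDl => /(_ q0) H.
suff: q - q ^+ 2 / 2 + q ^+ 3 - ln (1 + q) <= 0.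
  by rewrite (_ : (- q) ^+ 3 = - q ^+ 3); [lra|ring].
move: H; rewrite subrr expr0n /= expr0n /= mul0r !(subr0, addr0).
rewrite [1 + q - 1]addrC addKr; apply => x /andP[ax xb].
  have x0 : 0 < x by lra.
  have := is_derive1_ln x0 => H; apply: is_derive_eq.
  rewrite /GRing.scale /=; field; lra.
have x0 : 0 < x by lra.
rewrite subr_ge0 -[x^-1]mul1r ler_pdivrMr // -subr_ge0.
pose w := x - 1; rewrite (_ : _ - 1 = w ^+ 2 * (2 + 3 * w)); last by rewrite /w; ring.
by apply: mulr_ge0; rewrite ?sqr_ge0 // /w; lra.
Qed.

Lemma ln_leB1 x : 0 < x -> ln x <= x - 1.
Proof. by move=> x0; have := @le_ln1Dx R (x - 1); rewrite subrKC; apply; lra. Qed.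

Lemma ln_le_hyp x : 1 <= x -> x * ln x <= (x ^+ 2 - 1) / 2.
Proof.
move=> x1.
have := @is_derive_ge0_le (fun x => (x ^+ 2 - 1) / 2 - x * ln x)
  (fun x => x - 1 - ln x) 1 x x1.
rewrite ln1 mulr0 expr1n subrr mul0r subr0; move=> H; rewrite -subr_ge0; apply: H => y /andP[y1 _].
  have y0 : 0 < y by lra.
  have H1 := is_derive1_ln y0; apply: is_derive_eq.
  rewrite /GRing.scale /=; field; lra.
by rewrite subr_ge0 ln_leB1 //; lra.
Qed.

Lemma expR_le_quad x : x <= 1 / 2 -> expR x <= 1 + x + 2 * x ^+ 2.
Proof.
move=> x1; have x2 : 0 < 1 - x by lra.
rewrite -[expR x]invrK -expRN; apply: (@le_trans _ _ (1 - x)^-1).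
  by rewrite lef_pV2 ?posrE ?expR_gt0 //; exact: expR_ge1Dx.
rewrite -[_^-1]mul1r ler_pdivrMr // -subr_ge0.
rewrite (_ : _ - 1 = x ^+ 2 * (1 - 2 * x)); last by ring.
by apply: mulr_ge0; rewrite ?sqr_ge0 //; lra.
Qed.

(* Weighted AM-GM: linearise expR at the weighted mean of the logarithms. *)
Lemma expR_wsum_ln (I : finType) (w t : I -> R) :
  (forall i, 0 <= w i) -> \sum_i w i <= 1 -> (forall i, 0 < t i) ->
  expR (\sum_i w i * ln (t i)) <= 1 - \sum_i w i + \sum_i w i * t i.
Proof.
move=> w0 w1 t0; set m := \sum_i _ * ln _.
have em := expR_gt0 m.
have tan x : expR m * (1 + x - m) <= expR x.
  rewrite -[x in leRHS](subrKC m) expRD ler_pM2l // -addrA.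
  exact: expR_ge1Dx.
have -> : expR m = (1 - \sum_i w i) * (expR m * (1 + 0 - m)) +
    \sum_i w i * (expR m * (1 + ln (t i) - m)).
  have -> : \sum_i w i * (expR m * (1 + ln (t i) - m)) =
      expR m * (1 - m) * \sum_i w i + expR m * m.
    by rewrite /m !mulr_sumr -big_split /=; apply: eq_bigr => i _; ring.
  by ring.
apply: lerD.
  have := tan 0; rewrite expR0 => tan0.
  by rewrite -[leRHS]mulr1 ler_wpM2l ?subr_ge0.
apply: ler_sum => i _; apply: ler_wpM2l => //.
by have := tan (ln (t i)); rewrite lnK // posrE.
Qed.
End LogExp.

(** * The potential of a bias under one round of noise *)

Section Vertex.
Context {R : realType}.
Implicit Types (a b p q t x tau lam : R).

(** Error terms carrying a factor [tau] become a fixed small fraction of the main term, which linear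
    arithmetic can then absorb. *)
Lemma tau_scale tau x y : 20 * tau <= 1 / 1000 -> 0 <= y -> x <= tau * y ->
  20 * (1000 * x) <= y.
Proof. by move=> h0 y0 xy; nra. Qed.

Lemma sqr_near1 x : - (1 / 100) <= x -> x <= 1 / 100 -> (1 - x) ^+ 2 <= 5 / 4.
Proof. by move=> h1 h2; rewrite expr2; nra. Qed.

Lemma sqrD_le x y : (x + y) ^+ 2 <= 2 * x ^+ 2 + 2 * y ^+ 2.
Proof.
by rewrite -subr_ge0 (_ : _ - _ = (x - y) ^+ 2); [exact: sqr_ge0|ring].
Qed.

Lemma sq_le_half x : x ^+ 2 <= 1 / 4 -> - (1 / 2) <= x /\ x <= 1 / 2.
Proof. by rewrite expr2 => h; split; nra. Qed.

(** Here [t] is the relative drop of the scale, [q] the relative change of [e + U^2], and [lam] the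
    weight of the factor [1 + B y]. The expansion is of first order in [t] but second in [q], since
    [q^2] has a mean of the order of [t]. The summands [1 / 1000] collect all higher terms. *)
Lemma pointwise_step p a lam t q tau : 0 < p -> p <= tau -> 20 * tau <= 1 / 1000 ->
  0 <= a -> a <= 1 -> 0 <= lam -> lam <= 1 -> 0 <= t -> t <= tau -> `|q| <= tau ->
  expR (p * ((1 - a) * ln (1 - t) - ln (1 + q))) *
    (1 + lam * ((1 - t) / (1 + q) - 1)) <=
  1 - (p * (1 - a) + lam - (p + lam) / 1000) * t - (p + lam) * q
    + ((1 / 2 + 1 / 1000) * p + (1 + 1 / 1000) * lam) * q ^+ 2.
Proof.
move=> p0 ptau htau a0 a1 l0 l1 t0 tt; rewrite ler_norml => /andP[q1 q2].
have tau0 : 0 < tau by lra.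
have Q0 := sqr_ge0 q.
have T0 := sqr_ge0 t.
(* [p * A] bounds the exponent and [D] bounds the ratio minus 1; the rest multiplies out their
   quadratic approximations. *)
pose A := - (1 - a) * t - q + (1 / 2 + tau) * q ^+ 2.
pose D := - (1 - tau) * t - q + (1 + 2 * tau) * q ^+ 2.
have Qt : q ^+ 2 <= tau * tau by rewrite expr2; nra.
have Tt : t ^+ 2 <= tau * t by rewrite expr2; nra.
have tt2 : tau * tau <= tau / 1000 by nra.
have hln1 : (1 - a) * ln (1 - t) <= - (1 - a) * t.
  rewrite mulNr -mulrN; apply: ler_wpM2l; first lra.
  by have := @ln_leB1 R (1 - t); lra.
have hln2 : - ln (1 + q) <= - q + (1 / 2 + tau) * q ^+ 2.
  have nq : `|q| <= tau by rewrite ler_norml q1.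
  have := @ln_ge_cubic R q; have : `|q| <= 1 / 2 by lra.
  move=> -> /(_ isT).
  have : `|q| ^+ 3 <= tau * q ^+ 2.
    by rewrite exprS real_normK ?num_real //; apply: ler_wpM2r.
  by lra.
have hW : p * ((1 - a) * ln (1 - t) - ln (1 + q)) <= p * A.
  by apply: ler_wpM2l; rewrite /A; lra.
have hA : A ^+ 2 <= 3 * (t ^+ 2 + q ^+ 2).
  pose z := q - (1 / 2 + tau) * q ^+ 2.
  have -> : A = - ((1 - a) * t + z) by rewrite /A /z; ring.
  have z2 : z ^+ 2 <= (5 / 4) * q ^+ 2.
    rewrite (_ : z = q * (1 - (1 / 2 + tau) * q)); last by rewrite /z; ring.
    rewrite exprMn mulrC; apply: ler_wpM2r => //; apply: sqr_near1.
      by have := ler_wpM2l (ltW tau0) q1; have := ler_wpM2l (ltW tau0) q2; lra.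
    by have := ler_wpM2l (ltW tau0) q1; have := ler_wpM2l (ltW tau0) q2; lra.
  have at2 : ((1 - a) * t) ^+ 2 <= t ^+ 2.
    by rewrite exprMn -[leRHS]mul1r; apply: ler_wpM2r; rewrite ?sqr_ge0 // expr2; nra.
  have := sqrD_le ((1 - a) * t) z.
  by rewrite sqrrN; lra.
have hD : D ^+ 2 <= 3 * (t ^+ 2 + q ^+ 2).
  pose z := q - (1 + 2 * tau) * q ^+ 2.
  have -> : D = - ((1 - tau) * t + z) by rewrite /D /z; ring.
  have z2 : z ^+ 2 <= (5 / 4) * q ^+ 2.
    rewrite (_ : z = q * (1 - (1 + 2 * tau) * q)); last by rewrite /z; ring.
    rewrite exprMn mulrC; apply: ler_wpM2r => //; apply: sqr_near1.
      by have := ler_wpM2l (ltW tau0) q1; have := ler_wpM2l (ltW tau0) q2; lra.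
    by have := ler_wpM2l (ltW tau0) q1; have := ler_wpM2l (ltW tau0) q2; lra.
  have at2 : ((1 - tau) * t) ^+ 2 <= t ^+ 2.
    by rewrite exprMn -[leRHS]mul1r; apply: ler_wpM2r; rewrite ?sqr_ge0 // expr2; nra.
  have := sqrD_le ((1 - tau) * t) z.
  by rewrite sqrrN; lra.
have TQ : t ^+ 2 + q ^+ 2 <= 1 / 1000.
  have T1 : tau * t <= tau * tau by apply: ler_wpM2l => //; exact: ltW.
  by clear -T1 Tt Qt tt2 htau tau0; lra.
have [|A1 A2] := @sq_le_half A; first by clear -hA TQ; lra.
have [|D1 D2] := @sq_le_half D; first by clear -hD TQ; lra.
have hr : (1 - t) / (1 + q) - 1 <= D.
  have q0 : 0 < 1 + q by clear -q1 htau; lra.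
  rewrite lerBlDr ler_pdivrMr // /D -subr_ge0.
  have -> : (- (1 - tau) * t - q + (1 + 2 * tau) * q ^+ 2 + 1) * (1 + q) - (1 - t) =
    t * (tau - q + tau * q) + q ^+ 2 * (2 * tau + q + 2 * tau * q) by ring.
  by apply: addr_ge0; apply: mulr_ge0 => //; clear -q1 q2 tau0 htau; nra.
have rr : 0 <= 1 + lam * ((1 - t) / (1 + q) - 1).
  have h1 : 0 <= (1 - t) / (1 + q) by clear -t0 tt q1 q2 htau; rewrite divr_ge0; lra.
  by clear -h1 l0 l1; nra.
have hE : expR (p * ((1 - a) * ln (1 - t) - ln (1 + q))) <= 1 + p * A + 2 * (p * A) ^+ 2.
  apply: le_trans (expR_le_quad _); first by rewrite ler_expR.
  by clear -A1 A2 p0 ptau htau; nra.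
apply: (@le_trans _ _ ((1 + p * A + 2 * (p * A) ^+ 2) * (1 + lam * D))).
  apply: ler_pM => //; first exact: expR_ge0.
  by rewrite lerD2l ler_wpM2l.
have X1 : 2 * (p * A) ^+ 2 * (lam * D) <= 2 * (p * A) ^+ 2.
  rewrite -[leRHS]mulr1; apply: ler_wpM2l; first by rewrite mulr_ge0 ?sqr_ge0.
  by clear -l0 l1 D1 D2; nra.
have X2 : A * D <= 3 * (t ^+ 2 + q ^+ 2).
  by clear -hA hD; have := sqr_ge0 (A - D); rewrite (_ : (A - D) ^+ 2 = A ^+ 2 + D ^+ 2 - 2 * (A * D)); [lra|ring].
have X3 : p * lam * (A * D) <= p * lam * (3 * (t ^+ 2 + q ^+ 2)).
  by apply: ler_wpM2l => //; rewrite mulr_ge0 // ltW.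
have X4 : (p * A) ^+ 2 <= p * p * (3 * (t ^+ 2 + q ^+ 2)).
  by rewrite exprMn expr2; apply: ler_wpM2l => //; rewrite mulr_ge0 // ltW.
have pQ0 : 0 <= p * q ^+ 2 by rewrite mulr_ge0 // ltW.
have lQ0 : 0 <= lam * q ^+ 2 by rewrite mulr_ge0.
have pt0 : 0 <= p * t by rewrite mulr_ge0 // ltW.
have lt0 : 0 <= lam * t by rewrite mulr_ge0.
have Y1 : 20 * (1000 * (p * p * q ^+ 2)) <= p * q ^+ 2.
  by apply: (tau_scale htau) => //; rewrite -mulrA; apply: ler_wpM2r.
have Y2 : 20 * (1000 * (p * lam * q ^+ 2)) <= lam * q ^+ 2.
  by apply: (tau_scale htau) => //; rewrite -mulrA; apply: ler_wpM2r.
have Y3 : 20 * (1000 * (tau * (p * q ^+ 2))) <= p * q ^+ 2.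
  by apply: (tau_scale htau).
have Y4 : 20 * (1000 * (tau * (lam * q ^+ 2))) <= lam * q ^+ 2.
  by apply: (tau_scale htau).
have Y5 : 20 * (1000 * (tau * (lam * t))) <= lam * t.
  by apply: (tau_scale htau).
have tle : t ^+ 2 <= t by clear -Tt t0 tau0 htau; nra.
have Y6 : 20 * (1000 * (p * lam * t ^+ 2)) <= lam * t.
  apply: (tau_scale htau) => //.
  apply: (@le_trans _ _ (p * (lam * t))); last by apply: ler_wpM2r.
  by rewrite -mulrA; apply: ler_wpM2l; [exact: ltW|apply: ler_wpM2l].
have Y7 : 20 * (1000 * (p * p * t ^+ 2)) <= p * t.
  apply: (tau_scale htau) => //.
  apply: (@le_trans _ _ (p * (p * t))); last by apply: ler_wpM2r.
  by rewrite -mulrA; apply: ler_wpM2l; [exact: ltW|apply: ler_wpM2l; [exact: ltW|]].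
have -> : (1 + p * A + 2 * (p * A) ^+ 2) * (1 + lam * D) =
  1 + p * A + lam * D + 2 * (p * A) ^+ 2 + p * lam * (A * D)
   + 2 * (p * A) ^+ 2 * (lam * D) by ring.
apply: (@le_trans _ _ (1 + p * A + lam * D + 4 * (p * p * (3 * (t ^+ 2 + q ^+ 2)))
   + p * lam * (3 * (t ^+ 2 + q ^+ 2)))).
  by clear -X1 X3 X4; lra.
by clear -Y1 Y2 Y3 Y4 Y5 Y6 Y7 pQ0 lQ0 pt0 lt0; rewrite /A /D; lra.
Qed.
End Vertex.

Definition gpot {R : realType} (p B e U : R) : R :=
  expR (p * ln (e / (e + U ^+ 2))) * (1 + B * (e / (e + U ^+ 2))).

(** The bound 2 fits the deviation from its mean of a variable with values in [[-1, 1]]. *)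
Definition centered {R : realType} {I : finType} (w eta : I -> R) : Prop :=
  [/\ forall o, 0 <= w o, \sum_o w o = 1, \sum_o w o * eta o = 0
    & forall o, `|eta o| <= 2].

Definition variance {R : realType} {I : finType} (w eta : I -> R) : R :=
  \sum_o w o * eta o ^+ 2.

Section VertexStep.
Context {R : realType} {I : finType}.
Implicit Types (w eta : I -> R) (tau c p B a e U Q : R).

Lemma eta_sqr_le4 w eta o : centered w eta -> eta o ^+ 2 <= 4.
Proof.
case=> _ _ _ /(_ o); rewrite ler_norml => /andP[h1 h2].
by rewrite expr2; clear -h1 h2; nra.
Qed.

Lemma var_ge0 w eta : centered w eta -> 0 <= variance w eta.
Proof. by case=> w0 _ _ _; apply: sumr_ge0 => o _; rewrite mulr_ge0 ?sqr_ge0. Qed.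

Lemma var_le4 w eta : centered w eta -> variance w eta <= 4.
Proof.
move=> cw; have [w0 w1 _ _] := cw.
apply: (@le_trans _ _ (4 * \sum_o w o)); last by rewrite w1 mulr1.
rewrite mulr_sumr; apply: ler_sum => o _.
by rewrite mulrC; apply: ler_wpM2r => //; exact: (eta_sqr_le4 o cw).
Qed.

(** The increment of [e + U^2] is dominated by [2 U eta], whose second moment is [4 U^2 s]. The
    remaining terms are bounded, hence a small fraction of [Q] because [Q] is at least [tau^-4]. *)
Lemma qsum_le w eta tau c Q U : let s := variance w eta in
  centered w eta -> 0 < tau -> 20 * tau <= 1 / 1000 -> 0 <= c -> c <= 3 -> 1 <= tau ^+ 4 * Q -> U ^+ 2 <= Q ->
  \sum_o w o * (2 * U * eta o + eta o ^+ 2 - c * s) ^+ 2 <=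
  s * (4 * U ^+ 2 + Q / 1000).
Proof.
move=> s cw tau0 htau c0 c3 hQ UQ.
have [w0 w1 _ _] := cw; have s0 := var_ge0 cw; have s4 := var_le4 cw.
have sE : \sum_o w o * eta o ^+ 2 = s by [].
rewrite -/s in s0 s4; clearbody s.
have ti : tau * tau^-1 = 1 by rewrite divff ?gt_eqF.
have ti0 : 0 < tau^-1 by rewrite invr_gt0.
pose D := 4 * (1 + tau) * U ^+ 2 + 8 * (1 + tau^-1).
have pt o : w o * (2 * U * eta o + eta o ^+ 2 - c * s) ^+ 2 <=
    D * (w o * eta o ^+ 2) + 72 * (1 + tau^-1) * s * w o.
  rewrite [leRHS](_ : _ = w o * (D * eta o ^+ 2 + 72 * (1 + tau^-1) * s)); last by ring.
  apply: ler_wpM2l => //.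
  set x := 2 * U * eta o; set z := eta o ^+ 2 - c * s.
  have e4 := eta_sqr_le4 o cw; have e0 := sqr_ge0 (eta o).
  have z2 : z ^+ 2 <= 8 * eta o ^+ 2 + 72 * s.
    have h1 : (eta o ^+ 2) ^+ 2 <= 4 * eta o ^+ 2.
      by rewrite [leLHS]expr2; apply: ler_wpM2r.
    have h2 : (c * s) ^+ 2 <= 36 * s.
      rewrite exprMn -[36](_ : 9 * 4 = _); last by ring.
      rewrite -mulrA; apply: ler_pM => //; rewrite ?sqr_ge0 // expr2.
        by clear -c0 c3; nra.
      by apply: ler_wpM2r.
    by have := sqrD_le (eta o ^+ 2) (- (c * s)); rewrite sqrrN -/z; clear -h1 h2; lra.
  have -> : 2 * U * eta o + eta o ^+ 2 - c * s = x + z by rewrite /x /z addrA.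
  (* Young's inequality with weight [tau], so that the main term is inflated only by [1 + tau]. *)
  have yg : (x + z) ^+ 2 <= (1 + tau) * x ^+ 2 + (1 + tau^-1) * z ^+ 2.
    rewrite -subr_ge0.
    have -> : (1 + tau) * x ^+ 2 + (1 + tau^-1) * z ^+ 2 - (x + z) ^+ 2 =
      tau^-1 * (tau * x - z) ^+ 2 + (1 - tau * tau^-1) * (tau * x ^+ 2 - 2 * x * z).
      by ring.
    by rewrite ti subrr mul0r addr0 mulr_ge0 ?sqr_ge0 // ltW.
  have i0 : 0 <= 1 + tau^-1 by rewrite addr_ge0 // ltW.
  have := ler_wpM2l i0 z2.
  have xE : x ^+ 2 = 4 * U ^+ 2 * eta o ^+ 2 by rewrite /x; ring.
  by move: yg; rewrite xE /D; clear; lra.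
apply: (@le_trans _ _ (D * s + 72 * (1 + tau^-1) * s)).
  have -> : D * s + 72 * (1 + tau^-1) * s =
    D * (\sum_o w o * eta o ^+ 2) + 72 * (1 + tau^-1) * s * \sum_o w o
    by rewrite w1 mulr1 sE.
  rewrite !mulr_sumr -big_split /=.
  by apply: ler_sum => o _; apply: pt.
rewrite [leLHS](_ : _ = s * (4 * (1 + tau) * U ^+ 2 + 80 * (1 + tau^-1))); last by rewrite /D; ring.
apply: ler_wpM2l => //.
have iQ : tau^-1 <= tau ^+ 3 * Q.
  rewrite -[tau^-1]mul1r ler_pdivrMr //.
  by rewrite (_ : _ * tau = tau ^+ 4 * Q) //; ring.
have Q0 : 0 <= Q by apply: le_trans UQ; exact: sqr_ge0.
have t3 : 1000 * (1000 * tau ^+ 3) <= 1.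
  have t2 : tau ^+ 2 <= 1 / 1000 * (1 / 1000) by rewrite expr2; clear -tau0 htau; nra.
  have := ler_wpM2l (ltW tau0) t2; rewrite exprS.
  by clear -tau0 htau; lra.
have t3Q := ler_wpM2r Q0 t3.
have tU : 20 * (1000 * (tau * U ^+ 2)) <= Q.
  by apply: (tau_scale htau Q0); apply: ler_wpM2l => //; exact: ltW.
have i1 : 1 <= tau^-1.
  by rewrite -[leRHS]mul1r ler_pdivlMr //; clear -htau tau0; lra.
by clear -iQ t3Q tU i1; lra.
Qed.

(** Revealing one vertex moves [U] by [eta] and lowers the scale from [e] to [e']. The relative
    change of [Q = e + U^2] has mean [s / e * (1 - c) * y] and second moment about
    [s / e * 4 y (1 - y)], as [U^2 / Q = 1 - y]; [pointwise_step] is averaged with these two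
    values. *)
Lemma vertex_step w eta tau c p B a e' U :
  let s := variance w eta in
  let e := e' + c * s in let y := e / (e + U ^+ 2) in
  let lam := B * y / (1 + B * y) in
  centered w eta -> 0 < tau -> 20 * tau <= 1 / 1000 -> 0 <= c -> c <= 3 ->
  0 < p -> p <= tau -> 0 <= B -> 0 <= a -> a <= 1 -> 1 <= tau ^+ 4 * e' ->
  \sum_o w o * (expR (- (p * a * ln e')) * gpot p B e' (U + eta o)) <=
  expR (- (p * a * ln e)) * gpot p B e U *
  (1 + s / e * (- (p * (1 - a) + lam - (p + lam) / 1000) * c
     - (p + lam) * (1 - c) * y
     + ((1 / 2 + 1 / 1000) * p + (1 + 1 / 1000) * lam) * y
       * (4 * (1 - y) + 1 / 1000))).
Proof.
move=> s e y lam cw tau0 htau c0 c3 p0 pt B0 a0 a1 he'.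
have [w0 w1 eta0 _] := cw; have s0 := var_ge0 cw; have s4 := var_le4 cw.
rewrite -/s in s0 s4.
have sE : \sum_o w o * eta o ^+ 2 = s by [].
have qS (Q : R) (h1 : 1 <= tau ^+ 4 * Q) (h2 : U ^+ 2 <= Q) :=
  qsum_le cw tau0 htau c0 c3 h1 h2.
rewrite -/s in qS; clearbody s.
have U0 := sqr_ge0 U.
have t4 : 0 < tau ^+ 4 by rewrite exprn_gt0.
have e'0 : 0 < e' by rewrite -(pmulr_rgt0 _ t4); apply: lt_le_trans he'.
have ee' : e' <= e by rewrite /e lerDl mulr_ge0.
have e0 : 0 < e by apply: lt_le_trans ee'.
pose Q := e + U ^+ 2.
have eQ : e <= Q by rewrite /Q lerDl.
have Q0 : 0 < Q by apply: lt_le_trans eQ.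
have hQ : 1 <= tau ^+ 4 * Q.
  by apply: (le_trans he'); rewrite ler_pM2l // (le_trans ee').
have UQ : U ^+ 2 <= Q by rewrite /Q lerDr ltW.
have y0 : 0 < y by rewrite divr_gt0.
have By0 : 0 <= B * y by rewrite mulr_ge0 // ltW.
have l0 : 0 <= lam by rewrite divr_ge0 // addr_ge0.
have l1 : lam <= 1 by rewrite ler_pdivrMr ?mul1r ?lerDr // ltr_wpDr.
pose t := c * s / e.
have cs0 : 0 <= c * s by rewrite mulr_ge0.
have cs12 : c * s <= 12 by clear -c0 c3 s0 s4; nra.
have t0 : 0 <= t by rewrite divr_ge0 // ltW.
have tau3 : 1000 * tau ^+ 2 <= 1 / 1000 by rewrite expr2; clear -tau0 htau; nra.
have tau4 : 1000 * tau ^+ 4 <= tau.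
  have h := ler_wpM2l (ltW tau0) tau3.
  have h2 : tau ^+ 4 <= tau ^+ 3 * 1.
    by rewrite exprSr ler_wpM2l ?exprn_ge0 ?ltW //; clear -tau0 htau; lra.
  by move: h; rewrite mulrCA -exprS; clear -h2 tau0; lra.
have inv_le (z : R) : 1 <= tau ^+ 4 * z -> 0 < z -> z^-1 <= tau ^+ 4.
  by move=> hz z0; rewrite -[z^-1]mul1r ler_pdivrMr.
have tt : t <= tau.
  have ei : e^-1 <= tau ^+ 4 by apply: inv_le => //; apply: (le_trans he'); rewrite ler_pM2l.
  have : t <= 12 * tau ^+ 4.
    by apply: ler_pM => //; rewrite invr_ge0 ltW.
  by clear -tau4 tau0 t4; lra.
have absU : `|U| <= tau ^+ 2 * Q.
  rewrite -(@ler_pXn2r _ 2) ?nnegrE ?normr_ge0 //; last by rewrite mulr_ge0 ?exprn_ge0 ?ltW.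
  rewrite real_normK ?num_real // exprMn -exprM.
  apply: (le_trans UQ); rewrite [Q ^+ 2]expr2 mulrA -[leLHS]mul1r.
  by rewrite ler_pM2r.
pose q o := (2 * U * eta o + eta o ^+ 2 - c * s) / Q.
have hq o : `|q o| <= tau.
  rewrite /q normrM [`|Q^-1|]gtr0_norm ?invr_gt0 // ler_pdivrMr //.
  have e4 := eta_sqr_le4 o cw; have e20 := sqr_ge0 (eta o).
  have Ue : `|U * eta o| <= 2 * (tau ^+ 2 * Q).
    by rewrite normrM mulrC; apply: ler_pM => //; case: cw.
  have t4Q : 1000 * (tau ^+ 4 * Q) <= tau * Q.
    by rewrite mulrA ler_pM2r.
  have t2Q : 1000 * (tau ^+ 2 * Q) <= tau * Q.
    rewrite mulrA ler_pM2r // expr2 mulrA.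
    by have := htau; clear -tau0; nra.
  move: Ue; rewrite !ler_norml => /andP[h1 h2].
  by apply/andP; split; clear -h1 h2 t2Q t4Q hQ e4 e20 cs0 cs12; lra.
pose K := expR (- (p * a * ln e)) * gpot p B e U.
have g0 (d x : R) : 0 < d -> 0 <= gpot p B d x.
  move=> d0; rewrite mulr_ge0 ?expR_ge0 // addr_ge0 // mulr_ge0 // divr_ge0 ?ltW //.
  by rewrite ltr_wpDr ?sqr_ge0.
have K0 : 0 <= K by rewrite mulr_ge0 ?expR_ge0 // g0.
have tE : e' = e * (1 - t) by rewrite /t mulrBr mulr1 mulrCA divff ?gt_eqF // mulr1 /e addrK.
have t1 : 0 < 1 - t by clear -tt htau tau0; lra.
have term o : expR (- (p * a * ln e')) * gpot p B e' (U + eta o) <=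
   K * (1 - (p * (1 - a) + lam - (p + lam) / 1000) * t - (p + lam) * q o
    + ((1 / 2 + 1 / 1000) * p + (1 + 1 / 1000) * lam) * q o ^+ 2).
  have q1 : 0 < 1 + q o.
    by have := hq o; rewrite ler_norml => /andP[h _]; clear -h htau tau0; lra.
  have QE : e' + (U + eta o) ^+ 2 = Q * (1 + q o).
    rewrite mulrDr mulr1 /q mulrCA divff ?gt_eqF // mulr1 /Q /e.
    by rewrite sqrrD -mulr_natr; ring.
  have yE : e' / (e' + (U + eta o) ^+ 2) = y * ((1 - t) / (1 + q o)).
    by rewrite QE {1}tE invfM mulrACA.
  have r0 : 0 < (1 - t) / (1 + q o) by rewrite divr_gt0.
  apply: (@le_trans _ _ (K * (expR (p * ((1 - a) * ln (1 - t) - ln (1 + q o))) *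
    (1 + lam * ((1 - t) / (1 + q o) - 1))))); last first.
    by apply: ler_wpM2l => //; apply: (pointwise_step p0 pt htau a0 a1 l0 l1 t0 tt (hq o)).
  rewrite le_eqVlt; apply/orP; left; apply/eqP.
  rewrite /K /gpot yE -/Q -/y (lnM y0 r0) (ln_div t1 q1) tE (lnM e0 t1).
  rewrite mulrA -expRD.
  have rE (e1 e2 e3 x1 x2 : R) : e1 * (e2 * x1) * (e3 * x2) = e1 * e2 * e3 * (x1 * x2) by ring.
  rewrite rE -!expRD.
  congr (_ * _); first by congr expR; ring.
  have By1 : 0 < 1 + B * y by clear -By0; lra.
  by rewrite /lam; field; rewrite !gt_eqF.
apply: (@le_trans _ _ (\sum_o w o * (K * (1 - (p * (1 - a) + lam - (p + lam) / 1000) * t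
   - (p + lam) * q o + ((1 / 2 + 1 / 1000) * p + (1 + 1 / 1000) * lam) * q o ^+ 2)))).
  by apply: ler_sum => o _; apply: ler_wpM2l.
pose al := p * (1 - a) + lam - (p + lam) / 1000.
pose ka := (1 / 2 + 1 / 1000) * p + (1 + 1 / 1000) * lam.
have ka0 : 0 <= ka by rewrite /ka; clear -p0 l0; lra.
have Sq : \sum_o w o * q o = s / e * ((1 - c) * y).
  have -> : \sum_o w o * q o = (2 * U * (\sum_o w o * eta o)
      + \sum_o w o * eta o ^+ 2 - c * s * \sum_o w o) / Q.
    rewrite !mulr_sumr -big_split /= -sumrB mulr_suml.
    by apply: eq_bigr => o _; rewrite /q; ring.
  rewrite eta0 w1 sE /y -/Q; field; rewrite ?gt_eqF //.
have Sq2 : \sum_o w o * q o ^+ 2 <= s / e * (y * (4 * (1 - y) + 1 / 1000)).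
  have -> : \sum_o w o * q o ^+ 2 =
     (\sum_o w o * (2 * U * eta o + eta o ^+ 2 - c * s) ^+ 2) / Q ^+ 2.
    by rewrite mulr_suml; apply: eq_bigr => o _; rewrite /q expr_div_n mulrA.
  rewrite ler_pdivrMr ?exprn_gt0 //.
  apply: le_trans (qS _ hQ UQ) _.
  rewrite le_eqVlt; apply/orP; left; apply/eqP.
  by rewrite /y -/Q (_ : U ^+ 2 = Q - e); [field; rewrite ?gt_eqF|rewrite /Q; ring].
have -> : \sum_o w o * (K * (1 - al * t - (p + lam) * q o + ka * q o ^+ 2)) =
   K * ((1 - al * t) * (\sum_o w o) - (p + lam) * (\sum_o w o * q o)
       + ka * (\sum_o w o * q o ^+ 2)).
  rewrite !mulr_sumr -sumrB -big_split /= mulr_sumr.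
  by apply: eq_bigr => o _; ring.
apply: ler_wpM2l => //; rewrite w1 Sq.
have := ler_wpM2l ka0 Sq2; rewrite /t -/al -/ka.
have -> : al * (c * s / e) = s / e * (al * c) by ring.
by clear; lra.
Qed.

End VertexStep.

(** As [p] tends to 0, [lam] is [p y] and the left side divided by [p] becomes
    [a c - c + y + (1 + c) y^2 - 4 y^3]. The margin [12 / 1000] pays for the thousandths in
    [vertex_step] ([E], at most 10) and for replacing [lam / p] by [y]. *)
Lemma drift_bound (R : realType) (p a b c y tau : R) :
  let lam := p * y / (1 + p * y) in
  0 < p -> p <= tau -> 20 * tau <= 1 / 1000 -> 0 <= c -> c <= 3 ->
  0 <= y -> y <= 1 ->
  a * c - b + 12 / 1000 <= c - y - (1 + c) * y ^+ 2 + 4 * y ^+ 3 ->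
  - (p * (1 - a) + lam - (p + lam) / 1000) * c - (p + lam) * (1 - c) * y
     + ((1 / 2 + 1 / 1000) * p + (1 + 1 / 1000) * lam) * y
       * (4 * (1 - y) + 1 / 1000) <= p * b.
Proof.
move=> lam p0 pt ht c0 c3 y0 y1 h.
pose l := y / (1 + p * y).
have py0 : 0 <= p * y by rewrite mulr_ge0 // ltW.
have i0 : 0 < 1 + p * y by clear -py0; lra.
have -> : lam = p * l by rewrite /lam /l mulrA.
have ly : l <= y by rewrite ler_pdivrMr // ler_peMr //; clear -py0; lra.
have p1 : 20 * (1000 * p) <= 1 by clear -pt ht; lra.
have yl : 20 * (1000 * (y - l)) <= 1.
  have -> : y - l = p * y * (y / (1 + p * y)) by rewrite /l; field; rewrite gt_eqF.
  rewrite -/l.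
  have l0 : 0 <= l by rewrite divr_ge0 // ltW.
  by clear -p1 p0 py0 l0 ly y0 y1; nra.
set X := - ((1 - a) + l - (1 + l) / 1000) * c - (1 + l) * (1 - c) * y
     + ((1 / 2 + 1 / 1000) + (1 + 1 / 1000) * l) * y * (4 * (1 - y) + 1 / 1000).
rewrite [leLHS](_ : _ = p * X); last by rewrite /X; ring.
apply: ler_wpM2l; first exact: ltW.
pose D := - c + c / 1000 - (1 - c) * y + (1 + 1 / 1000) * y * (4 * (1 - y) + 1 / 1000).
pose E := (1 + y) * c + (1 / 2 + y) * y + (1 + y) * y * (4 * (1 - y) + 1 / 1000).
have -> : X = a * c - (c - y - (1 + c) * y ^+ 2 + 4 * y ^+ 3) + (l - y) * D + E / 1000.
  by rewrite /X /D /E; field.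
have E1 : E <= 10.
  have e1 : (1 + y) * c <= 6 by clear -c0 c3 y0 y1; nra.
  have e2 : (1 / 2 + y) * y <= 3 / 2 by clear -y0 y1; nra.
  have e3 : y * (4 * (1 - y) + 1 / 1000) <= 1 + 1 / 1000.
    by have := sqr_ge0 (2 * y - 1); rewrite expr2; clear -y0 y1; nra.
  have e4 : (1 + y) * (y * (4 * (1 - y) + 1 / 1000)) <= 2 * (1 + 1 / 1000).
    apply: ler_pM => //; clear -y0 y1; first lra; last lra.
    by apply: mulr_ge0; lra.
  by rewrite /E; clear -e1 e2 e4; lra.
have D1 : - D <= 10.
  have d1 : (1 - c) * y <= 1 by clear -c0 c3 y0 y1; nra.
  have d2 : 0 <= y * (4 * (1 - y) + 1 / 1000) by apply: mulr_ge0; clear -y0 y1; lra.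
  by rewrite /D; clear -d1 d2 c0 c3; lra.
have lD : (l - y) * D <= 1 / 1000.
  rewrite -mulrNN opprB; apply: (@le_trans _ _ ((y - l) * 10)).
    by apply: ler_wpM2l => //; rewrite subr_ge0.
  by clear -yl; lra.
by clear -h E1 lD; lra.
Qed.

(** * Revealing the next round vertex by vertex *)

Section Exposure.
Context {R : realType} {n k : nat}.
Implicit Types (q : 'I_n -> 'I_k -> R) (zeta : 'I_k -> R) (c : config n k).

Definition mean1 q zeta (v : 'I_n) : R := \sum_o q v o * zeta o.
Definition var1 q zeta (v : 'I_n) : R :=
  variance (q v) (fun o => zeta o - mean1 q zeta v).
Definition csum zeta c : R := \sum_v zeta (c v).
(** The Doob martingale of [csum]: its conditional mean given the opinions of the first [j]
    vertices. *)
Definition partial q zeta (j : nat) c : R :=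
  \sum_(v : 'I_n) (if (v < j)%N then zeta (c v) else mean1 q zeta v).
Definition future (f : 'I_n -> R) (j : nat) : R := \sum_(v : 'I_n | (j <= v)%N) f v.

Lemma partial0 q zeta c : partial q zeta 0 c = \sum_v mean1 q zeta v.
Proof. by []. Qed.

Lemma partialn q zeta c : partial q zeta n c = csum zeta c.
Proof. by apply: eq_bigr => v _; rewrite ltn_ord. Qed.

Lemma partialS q zeta (v : 'I_n) o c :
  partial q zeta v.+1 (upd c v o) = partial q zeta v c + (zeta o - mean1 q zeta v).
Proof.
rewrite /partial (bigD1 v) //= [in RHS](bigD1 v) //= ltnSn ltnn updE eqxx.
rewrite (eq_bigr (fun w : 'I_n => if (w < v)%N then zeta (c w) else mean1 q zeta w)).
  by rewrite addrC [in RHS]addrC -addrA; congr (_ + _); rewrite subrKC.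
move=> w wv; rewrite updE (negbTE wv) ltnS leq_eqVlt.
by case: eqP => //= /val_inj wv'; rewrite wv' eqxx in wv.
Qed.

Lemma future0 f : future f 0 = \sum_v f v.
Proof. by []. Qed.

Lemma futuren f : future f n = 0.
Proof. by rewrite /future big1 // => v; rewrite leqNgt ltn_ord. Qed.

Lemma futureS f (v : 'I_n) : future f v = f v + future f v.+1.
Proof.
rewrite /future (bigD1 v) //=; congr (_ + _); apply: eq_bigl => w.
by rewrite ltn_neqAle eq_sym andbC.
Qed.

Lemma future_ge0 f j : (forall v, 0 <= f v) -> 0 <= future f j.
Proof. by move=> f0; apply: sumr_ge0. Qed.

Lemma centered_coord q zeta v : pmf q -> (forall o, `|zeta o| <= 1) ->
  centered (q v) (fun o => zeta o - mean1 q zeta v).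
Proof.
move=> hq z1; case: (hq v) => q0 q1.
have m1 : `|mean1 q zeta v| <= 1.
  apply: le_trans (ler_norm_sum _ _ _) _; rewrite -q1.
  by apply: ler_sum => o _; rewrite normrM ger0_norm // ler_piMr.
split => // [|o].
  under eq_bigr do rewrite mulrBr.
  by rewrite sumrB -mulr_suml q1 mul1r subrr.
by apply: le_trans (ler_normB _ _) _; apply: lerD.
Qed.

Lemma var1_ge0 q zeta v : pmf q -> (forall o, `|zeta o| <= 1) -> 0 <= var1 q zeta v.
Proof. by move=> hq z1; apply: var_ge0 (centered_coord v hq z1). Qed.

Section Bounds.
Variables (q : 'I_n -> 'I_k -> R) (zeta : 'I_k -> R) (tau p eps : R).
Hypothesis hq : pmf q.
Hypothesis z1 : forall o, `|zeta o| <= 1.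
Hypotheses (tau0 : 0 < tau) (htau : 20 * tau <= 1 / 1000).
Hypotheses (p0 : 0 < p) (ptau : p <= tau) (heps : 1 <= tau ^+ 4 * eps).
Let s := \sum_v var1 q zeta v.
Let U0 := \sum_v mean1 q zeta v.

Lemma eps_gt0 : 0 < eps.
Proof.
by rewrite -(pmulr_rgt0 _ (exprn_gt0 4 tau0)); apply: lt_le_trans heps.
Qed.

Lemma gpot_frac (e U : R) : 0 < e -> 0 < e / (e + U ^+ 2) <= 1.
Proof.
move=> e0; have U2 := sqr_ge0 U; have eU : 0 < e + U ^+ 2 by rewrite ltr_wpDr.
by rewrite divr_gt0 //= ler_pdivrMr // mul1r lerDl.
Qed.

Lemma gpot_ge0 (r B e U : R) : 0 <= B -> 0 < e -> 0 <= gpot r B e U.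
Proof.
move=> B0 e0; rewrite mulr_ge0 ?expR_ge0 // addr_ge0 // mulr_ge0 //.
by case/andP: (gpot_frac U e0) => /ltW.
Qed.

(* The weight [eps] is lowered by [c] times the variance of each vertex as the
   vertices are revealed one by one; [drift_bound] says that the potential
   [eps ^ (- p a) * gpot] does not then grow by more than a factor
   [1 + p b var / eps]. *)
Lemma expect_gpot_drift (a b c : R) : 0 <= c -> c <= 3 -> 0 <= a -> a <= 1 -> 0 <= b ->
  (forall y, 0 <= y -> y <= 1 ->
     a * c - b + 12 / 1000 <= c - y - (1 + c) * y ^+ 2 + 4 * y ^+ 3) ->
  expect q (fun c' => expR (- (p * a * ln eps)) * gpot p p eps (csum zeta c')) <=
  expR (p * b * s / eps) *
    (expR (- (p * a * ln (eps + c * s))) * gpot p p (eps + c * s) U0).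
Proof.
move=> c0 c3 a0 a1 b0 hpoly.
have e0 := eps_gt0.
pose F := future (var1 q zeta).
have F0 j : 0 <= F j by apply: future_ge0 => v; apply: var1_ge0.
pose f j (c' : config n k) := expR (p * b * F j / eps) *
   (expR (- (p * a * ln (eps + c * F j))) * gpot p p (eps + c * F j) (partial q zeta j c')).
have -> : expR (p * b * s / eps) *
    (expR (- (p * a * ln (eps + c * s))) * gpot p p (eps + c * s) U0) = expect q (f 0%N).
  by rewrite -[LHS](expect_cst _ hq); apply: eq_expect => c'; rewrite /f partial0 /F future0.
have -> : expect q (fun c' => expR (- (p * a * ln eps)) * gpot p p eps (csum zeta c')) =
    expect q (f n).
  apply: eq_expect => c'.
  by rewrite /f partialn /F futuren !(mulr0, mul0r) expR0 mul1r addr0.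
apply: expect_expose => // v c'; rewrite /f.
set e' := eps + c * F v.+1; set e := eps + c * F v; set U := partial q zeta v c'.
set sv := var1 q zeta v.
have sv0 : 0 <= sv by apply: var1_ge0.
have FE : F v = sv + F v.+1 by rewrite /F futureS.
have eE : e = e' + c * sv by rewrite /e /e' FE; ring.
have ee' : eps <= e' by rewrite lerDl mulr_ge0.
have ee : eps <= e by rewrite lerDl mulr_ge0.
have e0' : 0 < e by apply: lt_le_trans ee.
under eq_bigr => o _ do rewrite partialS mulrCA.
rewrite -mulr_sumr.
have he' : 1 <= tau ^+ 4 * e'.
  by apply: (le_trans heps); rewrite ler_pM2l // exprn_gt0.
have pl := ltW p0.
have := @vertex_step R _ (q v) (fun o => zeta o - mean1 q zeta v) tau c p p a e' U
  (centered_coord v hq z1) tau0 htau c0 c3 p0 ptau pl a0 a1 he'.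
cbv zeta; rewrite -/sv -[variance _ _]/sv -eE => step.
have /andP[y0 y1] := gpot_frac U e0'.
have db := drift_bound p0 ptau htau c0 c3 (ltW y0) y1 (hpoly _ (ltW y0) y1).
cbv zeta in db.
apply: (@le_trans _ _ (expR (p * b * F v.+1 / eps) *
   (expR (- (p * a * ln e)) * gpot p p e U * expR (p * b * sv / eps)))).
  apply: ler_wpM2l; first exact: expR_ge0.
  apply: (le_trans step); apply: ler_wpM2l; first by rewrite mulr_ge0 ?expR_ge0 // gpot_ge0.
  apply: le_trans (expR_ge1Dx _); rewrite lerD2l.
  apply: (@le_trans _ _ (sv / e * (p * b))).
    by apply: ler_wpM2l => //; rewrite divr_ge0 // ltW.
  rewrite (_ : p * b * sv / eps = sv / eps * (p * b)); last by ring.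
  apply: ler_wpM2r; first by rewrite mulr_ge0.
  by apply: ler_wpM2l => //; rewrite lef_pV2.
rewrite le_eqVlt; apply/orP; left; apply/eqP.
have -> : expR (p * b * F v / eps) = expR (p * b * sv / eps) * expR (p * b * F v.+1 / eps).
  by rewrite -expRD; congr expR; rewrite FE; field; rewrite gt_eqF.
by ring.
Qed.

(* Noise alone, with no compensating decrease of [eps]: the loss is carried by
   the coefficient [B], so it is negligible when [U0 ^+ 2] is large. *)
Lemma expect_gpot_noise :
  expect q (fun c' => gpot p p eps (csum zeta c')) <=
  gpot p (2 * p * expR (6 * s / eps) - p) eps U0.
Proof.
have e0 := eps_gt0; have pl := ltW p0.
pose F := future (var1 q zeta).
have F0 j : 0 <= F j by apply: future_ge0 => v; apply: var1_ge0.
(* One vertex raises the coefficient by at most [(2 p + 6 B) * var / eps]. This choice grows at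
   least that fast in the remaining variance and equals [p] when none remains. *)
pose B j := 2 * p * expR (6 * F j / eps) - p.
have B0 j : p <= B j.
  have h : 1 <= expR (6 * F j / eps).
    apply: le_trans (expR_ge1Dx _); rewrite lerDl divr_ge0 ?mulr_ge0 ?(ltW e0) //.
  by have := ler_wpM2l pl h; rewrite /B; lra.
pose f j (c' : config n k) := gpot p (B j) eps (partial q zeta j c').
have -> : gpot p (2 * p * expR (6 * s / eps) - p) eps U0 = expect q (f 0%N).
  by rewrite -[LHS](expect_cst _ hq); apply: eq_expect => c'; rewrite /f partial0 /B /F future0.
have -> : expect q (fun c' => gpot p p eps (csum zeta c')) = expect q (f n).
  apply: eq_expect => c'; rewrite /f partialn /B /F futuren !(mulr0, mul0r) expR0.
  by congr (gpot _ _ _ _); ring.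
apply: expect_expose => // v c'; rewrite /f.
set U := partial q zeta v c'; set sv := var1 q zeta v.
have sv0 : 0 <= sv by apply: var1_ge0.
have FE : F v = sv + F v.+1 by rewrite /F futureS.
have Bp : 0 <= B v.+1 by apply: le_trans (B0 _).
have BS : B v.+1 + sv / eps * (2 * p + 6 * B v.+1) <= B v.
  rewrite /B FE; set E := expR (6 * F v.+1 / eps).
  have -> : expR (6 * (sv + F v.+1) / eps) = expR (6 * (sv / eps)) * E.
    by rewrite -expRD; congr expR; ring.
  have sve : 0 <= sv / eps by rewrite divr_ge0 // ltW.
  have E0 : 0 <= 2 * p * E by rewrite !mulr_ge0 // expR_ge0.
  have := ler_wpM2r E0 (expR_ge1Dx (6 * (sv / eps))).
  have : 0 <= sv / eps * (4 * p) by apply: mulr_ge0 => //; apply: mulr_ge0.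
  by move: (sv / eps) (expR _) => x z; lra.
have := @vertex_step R _ (q v) (fun o => zeta o - mean1 q zeta v) tau 0 p (B v.+1) 0 eps U
  (centered_coord v hq z1) tau0 htau (lexx _) (ler0n _ 3) p0 ptau Bp (lexx _) ler01 heps.
cbv zeta; rewrite -/sv -[variance _ _]/sv !(mulr0, mul0r, addr0, subr0, oppr0, expR0, mul1r, mulr1, add0r).
under eq_bigr do rewrite mul1r.
move=> step; under eq_bigr => o _ do rewrite partialS -/U.
apply: (le_trans step).
have /andP[y0 y1] := gpot_frac U e0.
rewrite {}/gpot; move: (eps / (eps + U ^+ 2)) y0 y1 => y y0 y1.
rewrite -mulrA; apply: ler_wpM2l; first exact: expR_ge0.
have By0 : 0 <= B v.+1 * y by rewrite mulr_ge0 // ltW.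
apply: (@le_trans _ _ (1 + (B v.+1 + sv / eps * (2 * p + 6 * B v.+1)) * y)); last first.
  by rewrite lerD2l; apply: ler_wpM2r => //; exact: ltW.
set lam := B v.+1 * y / _.
have l0 : 0 <= lam by rewrite divr_ge0 // addr_ge0.
have lE : lam * (1 + B v.+1 * y) = B v.+1 * y.
  by rewrite /lam divfK // gt_eqF // ltr_wpDr.
rewrite mulrDr mulr1 [in leRHS]mulrDl addrA lerD2l.
have sve : 0 <= sv / eps by rewrite divr_ge0 // ltW.
rewrite mulrCA -[leRHS]mulrA; apply: ler_wpM2l => //.
have br : - ((p + lam) * y) + ((2^-1 + 1000^-1) * p + (1 + 1000^-1) * lam) * y
       * (4 * (1 - y) + 1000^-1) <= (2 * p + 4 * lam) * y.
  set A := (2^-1 + _) * p + _ * lam.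
  have A0 : 0 <= A by rewrite /A; lra.
  have Ay : 0 <= A * y by rewrite mulr_ge0 // ltW.
  have : A * y * (4 * (1 - y) + 1000^-1) <= A * y * (4 + 1000^-1).
    by apply: ler_wpM2l => //; lra.
  have py : 0 <= p * y by rewrite mulr_ge0 // ltW.
  have ly : 0 <= lam * y by rewrite mulr_ge0 // ltW.
  by rewrite /A; lra.
have b1 : 0 <= 1 + B v.+1 * y by rewrite addr_ge0.
have := ler_wpM2l b1 br.
have -> : (1 + B v.+1 * y) * ((2 * p + 4 * lam) * y) =
   2 * p * y + 2 * p * (B v.+1 * y) * y + 4 * (lam * (1 + B v.+1 * y)) * y by ring.
rewrite lE.
have p1 : p <= 1 by move: (htau) (ptau) (tau0); lra.
have By2 : B v.+1 * y * y <= B v.+1 * y by rewrite ler_piMr.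
have pB : p * (B v.+1 * y * y) <= B v.+1 * y.
  by apply: le_trans By2; rewrite ler_piMl // mulr_ge0 // ltW.
by lra.
Qed.
End Bounds.
End Exposure.

(** * Rescaling the bias *)

Section Scaling.
Context {R : realType}.
Implicit Types (p a B z mu e U : R).

(** The potential depends on [U] and [e] only through [z = U^2 / e], so the deterministic part of a
    round acts as the multiplication of [z] by some [mu]. *)
Definition gprof p B z : R := expR (- (p * ln (1 + z))) * (1 + B / (1 + z)).

Lemma gpotE p B e U : 0 < e -> gpot p B e U = gprof p B (U ^+ 2 / e).
Proof.
move=> e0; have U2 := sqr_ge0 U.
have eU : 0 < e + U ^+ 2 by rewrite ltr_wpDr.
have z0 : 0 < 1 + U ^+ 2 / e by rewrite ltr_wpDr // divr_ge0 // ltW.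
have -> : gpot p B e U = expR (p * ln (1 + U ^+ 2 / e)^-1) * (1 + B * (1 + U ^+ 2 / e)^-1).
  by rewrite /gpot (_ : (1 + _)^-1 = e / (e + U ^+ 2)) //; field; rewrite !gt_eqF.
by rewrite lnV ?posrE // mulrN.
Qed.

Lemma gprof_gt0 p B z : 0 <= B -> 0 <= z -> 0 < gprof p B z.
Proof.
move=> B0 z0; rewrite mulr_gt0 ?expR_gt0 // ltr_wpDr // divr_ge0 // addr_ge0 //.
Qed.

(** The power alone loses [r^p / mu^p] with [r <= 1]; the slack [r^p] pays for the growth of the
    factor [1 + p / (1 + z)]. *)
Lemma gprof_shrink p z mu : 0 <= p -> 0 <= z -> 0 < mu -> mu <= 1 ->
  gprof p p (mu * z) <= expR (- (p * ln mu)) * gprof p p z.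
Proof.
move=> p0 z0 m0 m1; have z1 : 0 < 1 + z by rewrite ltr_wpDr.
have mz0 : 0 <= mu * z by rewrite mulr_ge0 // ltW.
have z1' : 0 < 1 + mu * z by rewrite ltr_wpDr.
pose r := mu * (1 + z) / (1 + mu * z).
have r0 : 0 < r by rewrite divr_gt0 // mulr_gt0.
have lr : ln r <= (mu - 1) / (1 + mu * z).
  apply: le_trans (ln_leB1 r0) _; rewrite le_eqVlt; apply/orP; left; apply/eqP.
  by rewrite /r; field; rewrite gt_eqF.
have lrE : ln r = ln mu + ln (1 + z) - ln (1 + mu * z).
  by rewrite /r ln_div ?posrE ?mulr_gt0 // lnM.
have -> : expR (- (p * ln mu)) * gprof p p z =
   expR (- (p * ln (1 + mu * z))) * (expR (- (p * ln r)) * (1 + p / (1 + z))).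
  by rewrite /gprof !mulrA -!expRD lrE; congr (expR _ * _); ring.
apply: ler_wpM2l; first exact: expR_ge0.
apply: (@le_trans _ _ ((1 + p * ((1 - mu) / (1 + mu * z))) * (1 + p / (1 + z)))).
  rewrite -subr_ge0.
  have -> : (1 + p * ((1 - mu) / (1 + mu * z))) * (1 + p / (1 + z)) - (1 + p / (1 + mu * z))
    = p * (1 - mu) * (1 + p) / ((1 + mu * z) * (1 + z)).
    by field; rewrite !gt_eqF.
  by rewrite divr_ge0 ?mulr_ge0 ?subr_ge0 ?addr_ge0.
apply: ler_wpM2r; first by rewrite addr_ge0 // divr_ge0 // ltW.
apply: le_trans (expR_ge1Dx _); rewrite lerD2l -mulrN ler_wpM2l //.
by rewrite lerNr -mulNr opprB.
Qed.

Lemma expR_ln_le_lin a mu : 0 <= a -> a <= 1 -> 0 < mu -> expR (a * ln mu) <= 1 - a + a * mu.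
Proof.
move=> a0 a1 m0.
have := @expR_wsum_ln R 'I_1 (fun=> a) (fun=> mu) (fun=> a0).
by rewrite !big_ord1; apply.
Qed.

(** [z / (1 + z)] is the logarithmic slope of [1 + z] in [z]. Hence a stretch away from a tie is
    worth a power of [mu], and the farther from the tie the closer this power is to the full [p]. *)
Lemma gprof_stretch p a z mu : 0 <= p -> 0 <= a -> a <= 1 -> a * (1 + z) <= z ->
  0 <= z -> 1 <= mu -> gprof p p (mu * z) <= expR (- (p * a * ln mu)) * gprof p p z.
Proof.
move=> p0 a0 a1 az z0 m1; have m0 : 0 < mu by apply: lt_le_trans m1.
have z1 : 0 < 1 + z by rewrite ltr_wpDr.
have zz : z <= mu * z by rewrite ler_peMl.
have z1' : 0 < 1 + mu * z by apply: lt_le_trans z1 _; rewrite lerD2l.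
rewrite [leRHS]mulrA -expRD; apply: ler_pM; rewrite ?expR_ge0 //.
- by rewrite addr_ge0 // divr_ge0 // ltW.
- rewrite ler_expR -opprD lerN2 -mulrA -mulrDr; apply: ler_wpM2l => //.
  rewrite -ler_expR expRD !lnK ?posrE //.
  apply: (@le_trans _ _ ((1 - a + a * mu) * (1 + z))).
    by apply: ler_wpM2r; [exact: ltW|exact: expR_ln_le_lin].
  rewrite -subr_ge0 (_ : _ - _ = (mu - 1) * (z - a * (1 + z))); last by ring.
  by rewrite mulr_ge0 // subr_ge0.
- by rewrite lerD2l ler_wpM2l // lef_pV2 ?posrE // lerD2l.
Qed.

Lemma gprof_coef p B z : 0 <= p -> p <= B -> 0 <= z ->
  gprof p B z <= expR ((B - p) / (1 + z)) * gprof p p z.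
Proof.
move=> p0 pB z0; have z1 : 0 < 1 + z by rewrite ltr_wpDr.
rewrite mulrCA; apply: ler_wpM2l; first exact: expR_ge0.
have i0 : 0 <= (1 + z)^-1 by rewrite invr_ge0 ltW.
apply: (@le_trans _ _ ((1 + (B - p) / (1 + z)) * (1 + p / (1 + z)))); last first.
  by apply: ler_wpM2r (expR_ge1Dx _); rewrite addr_ge0 // mulr_ge0.
rewrite -subr_ge0 (_ : _ - _ = (B - p) / (1 + z) * (p / (1 + z))); last by ring.
by rewrite !mulr_ge0 // subr_ge0.
Qed.
End Scaling.

Section Slots.
Context {R : realType} {n k : nat}.

Lemma expect_slots (q : 'I_n -> 'I_k -> R) (I : finType) (w M : I -> R)
    (f : I -> config n k -> R) (F : config n k -> R) :
  pmf q -> (forall i, 0 <= w i) -> \sum_i w i <= 1 -> (forall i, 0 < M i) ->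
  (forall i, expect q (f i) <= M i) -> (forall i c, 0 <= f i c) ->
  (forall c, F c = 0 \/
     (forall i, 0 < f i c) /\ F c = expR (\sum_i w i * ln (f i c))) ->
  expect q F <= expR (\sum_i w i * ln (M i)).
Proof.
move=> hq w0 w1 M0 EM f0 hF.
set E := expR _.
have E0 : 0 <= E := expR_ge0 _.
apply: (@le_trans _ _ (expect q (fun c =>
   E * ((1 - \sum_i w i) + \sum_i w i / M i * f i c)))).
  apply: expect_le => // c; case: (hF c) => [->|[fc ->]].
    rewrite mulr_ge0 // addr_ge0 ?subr_ge0 // sumr_ge0 // => i _.
    by rewrite mulr_ge0 // divr_ge0 // ltW.
  have t0 i : 0 < f i c / M i by rewrite divr_gt0.
  have -> : expR (\sum_i w i * ln (f i c)) = E * expR (\sum_i w i * ln (f i c / M i)).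
    rewrite -expRD -big_split /=; congr expR; apply: eq_bigr => i _.
    by rewrite ln_div ?posrE //; ring.
  apply: ler_wpM2l => //.
  rewrite (_ : \sum_i w i / M i * f i c = \sum_i w i * (f i c / M i)).
    exact: expR_wsum_ln.
  by apply: eq_bigr => i _; rewrite mulrAC mulrA.
rewrite expectZ expectD expect_cst // expect_sum.
rewrite -[leRHS]mulr1; apply: ler_wpM2l => //.
rewrite -lerBrDl opprB addrCA subrr addr0.
apply: ler_sum => i _; rewrite expectZ -mulrA -[leRHS]mulr1.
by apply: ler_wpM2l => //; rewrite mulrC ler_pdivrMr ?mul1r.
Qed.
End Slots.

(** * The two one-round kernels *)

Section Kernels.
Context {R : realType} {n k : nat}.
Implicit Types (c : config n k) (o i : 'I_k) (v : 'I_n).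
Local Notation alpha := (@alpha R n k).
Local Notation gamma := (@gamma R n k).

Lemma count_alpha c o : (0 < n)%N -> \sum_v (c v == o)%:R = n%:R * alpha c o.
Proof.
move=> n0; rewrite /Defs.alpha mulrCA divff ?pnatr_eq0 -?lt0n // mulr1.
rewrite -natr_sum -sum1_card [in RHS]big_mkcond /=; congr (_%:R).
by apply: eq_bigr => v _; rewrite inE; case: eqP.
Qed.

Lemma alpha_ge0 c o : 0 <= alpha c o.
Proof. by rewrite divr_ge0. Qed.

Lemma sum_alpha c : (0 < n)%N -> \sum_o alpha c o = 1.
Proof.
move=> n0; have nn : n%:R != 0 :> R by rewrite pnatr_eq0 -lt0n.
apply: (mulfI nn); rewrite mulr_sumr mulr1.
under eq_bigr do rewrite -count_alpha //.
rewrite exchange_big /=.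
rewrite -[in RHS](card_ord n) -sumr_const; apply: eq_bigr => v _.
rewrite (bigD1 (c v)) //= eqxx big1 ?addr0 // => o oc.
by rewrite eq_sym (negbTE oc).
Qed.

Lemma alpha_le1 c o : (0 < n)%N -> alpha c o <= 1.
Proof.
move=> n0; rewrite -(sum_alpha c n0) (bigD1 o) //= lerDl.
by apply: sumr_ge0 => i _; apply: alpha_ge0.
Qed.

Lemma gamma_ge0 c : 0 <= gamma c.
Proof. by apply: sumr_ge0 => o _; apply: sqr_ge0. Qed.

Lemma gamma_le1 c : (0 < n)%N -> gamma c <= 1.
Proof.
move=> n0; rewrite -(sum_alpha c n0); apply: ler_sum => o _.
by rewrite expr2 ler_piMr ?alpha_ge0 ?alpha_le1.
Qed.

Definition kernel (tau : config n k -> 'I_n -> 'I_k -> R) c v o : R :=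
  alpha c o ^+ 2 + (1 - gamma c) * tau c v o.

Definition tau_maj c (v : 'I_n) o : R := alpha c o.
Definition tau_two c v o : R := (c v == o)%:R.

Lemma sum_eq_opinion c v (f : 'I_k -> R) : \sum_o (c v == o)%:R * f o = f (c v).
Proof.
rewrite (bigD1 (c v)) //= eqxx mul1r big1 ?addr0 // => o oc.
by rewrite eq_sym (negbTE oc) mul0r.
Qed.

Lemma count_pairs c : (0 < n)%N ->
  \sum_w1 \sum_w2 (c w1 == c w2)%:R = n%:R ^+ 2 * gamma c.
Proof.
move=> n0; rewrite /Defs.gamma mulr_sumr.
transitivity (\sum_w1 \sum_w2 \sum_o (c w1 == o)%:R * (c w2 == o)%:R : R).
  apply: eq_bigr => w1 _; apply: eq_bigr => w2 _.
  by rewrite sum_eq_opinion eq_sym.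
under eq_bigr do rewrite exchange_big /=.
rewrite exchange_big /=; apply: eq_bigr => o _.
by rewrite -exprMn -count_alpha // expr2 big_distrlr.
Qed.

Lemma trans_maj3 c c' : (0 < n)%N ->
  trans R (@maj3_rule n k) c c' = \prod_v kernel tau_maj c v (c' v).
Proof.
move=> n0; apply: eq_bigr => v _; move: (c' v) => o.
have nn : n%:R != 0 :> R by rewrite pnatr_eq0 -lt0n.
rewrite -mulr_sumr !card_prod card_ord !natrM.
have -> : \sum_s (maj3_rule c v s == o)%:R = \sum_w1 \sum_w2 \sum_w3
    ((if c w1 == c w2 then c w1 else c w3) == o)%:R :> R.
  by rewrite pair_big /= pair_big /=; apply: eq_bigr => -[[w1 w2] w3] _.
have E w1 w2 : \sum_w3 ((if c w1 == c w2 then c w1 else c w3) == o)%:R =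
    (c w1 == o)%:R * (c w2 == o)%:R * n%:R + (1 - (c w1 == c w2)%:R) * (n%:R * alpha c o) :> R.
  case: (eqVneq (c w1) (c w2)) => [->|ne].
    rewrite subrr mul0r addr0 sumr_const card_ord -mulr_natr.
    by case: eqP => _; rewrite ?mulr1 ?mulr0 ?mul0r ?mul1r ?mul0rn.
  rewrite subr0 mul1r count_alpha //.
  by case: (eqVneq (c w1) o) => [<-|_]; rewrite ?[c w2 == _]eq_sym ?(negbTE ne) !(mulr0, mul0r) add0r.
under eq_bigr do under eq_bigr do rewrite E.
under eq_bigr do rewrite big_split /=.
rewrite big_split /=.
have -> : \sum_w1 \sum_w2 (c w1 == o)%:R * (c w2 == o)%:R * n%:R = (n%:R * alpha c o) ^+ 2 * n%:R :> R.
  rewrite -count_alpha // expr2 big_distrlr mulr_suml /=.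
  by apply: eq_bigr => w1 _; rewrite mulr_suml.
have -> : \sum_w1 \sum_w2 (1 - (c w1 == c w2)%:R) * (n%:R * alpha c o) =
    (n%:R ^+ 2 - n%:R ^+ 2 * gamma c) * (n%:R * alpha c o) :> R.
  rewrite -count_pairs //.
  have -> : n%:R ^+ 2 = \sum_(w1 : 'I_n) \sum_(w2 : 'I_n) 1 :> R.
    by rewrite !sumr_const !card_ord -mulrnA -natrX expnS expn1.
  rewrite -sumrB mulr_suml; apply: eq_bigr => w1 _.
  by rewrite -sumrB mulr_suml.
by rewrite /kernel /tau_maj; field.
Qed.

Lemma trans_two c c' : (0 < n)%N ->
  trans R (@twoch_rule n k) c c' = \prod_v kernel tau_two c v (c' v).
Proof.
move=> n0; apply: eq_bigr => v _; move: (c' v) => o.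
have nn : n%:R != 0 :> R by rewrite pnatr_eq0 -lt0n.
rewrite -mulr_sumr !card_prod card_ord !natrM.
have -> : \sum_s (twoch_rule c v s == o)%:R = \sum_w1 \sum_w2
    ((if c w1 == c w2 then c w1 else c v) == o)%:R :> R.
  by rewrite pair_big /=; apply: eq_bigr => -[w1 w2] _.
have E w1 w2 : ((if c w1 == c w2 then c w1 else c v) == o)%:R =
    (c w1 == o)%:R * (c w2 == o)%:R + (1 - (c w1 == c w2)%:R) * (c v == o)%:R :> R.
  case: (eqVneq (c w1) (c w2)) => [->|ne].
    by rewrite subrr mul0r addr0; case: eqP => _; rewrite ?mulr1 ?mulr0.
  rewrite subr0 mul1r.
  by case: (eqVneq (c w1) o) => [<-|_]; rewrite ?[c w2 == _]eq_sym ?(negbTE ne) !(mulr0, mul0r) add0r.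
under eq_bigr do under eq_bigr do rewrite E.
under eq_bigr do rewrite big_split /=.
rewrite big_split /=.
have -> : \sum_w1 \sum_w2 (c w1 == o)%:R * (c w2 == o)%:R = (n%:R * alpha c o) ^+ 2 :> R.
  by rewrite -count_alpha // expr2 big_distrlr.
have -> : \sum_w1 \sum_w2 (1 - (c w1 == c w2)%:R) * (c v == o)%:R =
    (n%:R ^+ 2 - n%:R ^+ 2 * gamma c) * (c v == o)%:R :> R.
  rewrite -count_pairs //.
  have -> : n%:R ^+ 2 = \sum_(w1 : 'I_n) \sum_(w2 : 'I_n) 1 :> R.
    by rewrite !sumr_const !card_ord -mulrnA -natrX expnS expn1.
  rewrite -sumrB mulr_suml; apply: eq_bigr => w1 _.
  by rewrite -sumrB mulr_suml.
by rewrite /kernel /tau_two; field.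
Qed.

(* [tau c v] is the law of the opinion that [v] takes when its first two samples
   disagree. *)
Definition fallback (tau : config n k -> 'I_n -> 'I_k -> R) : Prop :=
  forall c, (forall v o, 0 <= tau c v o) /\ (forall v, \sum_o tau c v o = 1) /\
    (forall o, \sum_v tau c v o = n%:R * alpha c o).

Lemma fallback_maj : (0 < n)%N -> fallback tau_maj.
Proof.
move=> n0 c; split => [v o|]; first exact: alpha_ge0.
split => [v|o]; first exact: sum_alpha.
by rewrite sumr_const card_ord mulr_natl.
Qed.

Lemma fallback_two : (0 < n)%N -> fallback tau_two.
Proof.
move=> n0 c; split => [v o|]; first by rewrite /tau_two.
split => [v|o]; last exact: count_alpha.
by have := sum_eq_opinion c v (fun=> 1); under eq_bigr do rewrite mulr1.
Qed.

Lemma kernel_pmf tau c : (0 < n)%N -> fallback tau -> pmf (kernel tau c).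
Proof.
move=> n0 ft v; have [t0 [t1 _]] := ft c; split => [o|].
  by rewrite addr_ge0 ?sqr_ge0 // mulr_ge0 // subr_ge0 gamma_le1.
by rewrite big_split /= -mulr_sumr t1 mulr1 subrKC.
Qed.

Lemma sum_kernel tau c o : (0 < n)%N -> fallback tau ->
  \sum_v kernel tau c v o = n%:R * (alpha c o * (1 + alpha c o - gamma c)).
Proof.
move=> n0 ft; have [_ [_ t2]] := ft c.
rewrite /kernel big_split /= sumr_const card_ord -mulr_sumr t2 -[X in X + _]mulr_natl.
by ring.
Qed.
End Kernels.

(** * Means and variances for a pair of opinions *)

Section PairStatistics.
Context {R : realType} {n k : nat}.
Implicit Types (c : config n k) (o i j : 'I_k) (v : 'I_n).
Local Notation alpha := (@alpha R n k).
Local Notation gamma := (@gamma R n k).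
Local Notation N := (n%:R : R).

Definition bias i j o : R := (o == i)%:R - (o == j)%:R.

Lemma bias_le1 i j o : `|bias i j o| <= 1.
Proof.
rewrite /bias; case: (o == i); case: (o == j); rewrite ?subrr ?subr0 ?sub0r ?normrN ?normr0 ?normr1 //.
Qed.

Lemma bias_sqr i j o : i != j -> bias i j o ^+ 2 = (o == i)%:R + (o == j)%:R.
Proof.
move=> ij; rewrite /bias; case: (eqVneq o i) => [->|_].
  by rewrite (negbTE ij) subr0 addr0 expr1n.
by case: (o == j); rewrite ?sub0r ?add0r ?sqrrN ?expr1n ?expr0n.
Qed.

Lemma csum_bias i j c : (0 < n)%N -> csum (bias i j) c = N * (alpha c i - alpha c j).
Proof.
by move=> n0; rewrite /csum sumrB !count_alpha // mulrBr.
Qed.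

Lemma pair_alpha_le1 i j c : (0 < n)%N -> i != j -> alpha c i + alpha c j <= 1.
Proof.
move=> n0 ij; rewrite -(sum_alpha c n0) (bigD1 i) //= (bigD1 j) 1?eq_sym //=.
rewrite addrA lerDl sumr_ge0 // => o _; exact: alpha_ge0.
Qed.

Lemma pair_sqr_le_gamma i j c : i != j -> alpha c i ^+ 2 + alpha c j ^+ 2 <= gamma c.
Proof.
move=> ij; rewrite /Defs.gamma (bigD1 i) //= (bigD1 j) 1?eq_sym //=.
rewrite addrA lerDl sumr_ge0 // => o _; exact: sqr_ge0.
Qed.

Lemma sum_ind_eq (q : 'I_k -> R) i : \sum_o q o * (o == i)%:R = q i.
Proof.
rewrite (bigD1 i) //= eqxx mulr1 big1 ?addr0 // => o /negbTE ->.
by rewrite mulr0.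
Qed.

Lemma mean1_bias (q : 'I_n -> 'I_k -> R) i j v : mean1 q (bias i j) v = q v i - q v j.
Proof.
by rewrite /mean1 /bias; under eq_bigr do rewrite mulrBr; rewrite sumrB !sum_ind_eq.
Qed.

Lemma var1_bias (q : 'I_n -> 'I_k -> R) i j v : pmf q -> i != j ->
  var1 q (bias i j) v = q v i + q v j - (q v i - q v j) ^+ 2.
Proof.
move=> hq ij; rewrite /var1 /variance mean1_bias; set m := _ - _.
have [_ q1] := hq v.
have -> : \sum_o q v o * (bias i j o - m) ^+ 2 =
   \sum_o q v o * bias i j o ^+ 2 - 2 * m * \sum_o q v o * bias i j o + m ^+ 2 * \sum_o q v o.
  rewrite !mulr_sumr -sumrB -big_split /=; apply: eq_bigr => o _; ring.
have := mean1_bias q i j v; rewrite /mean1 -/m => ->.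
rewrite q1 mulr1; under eq_bigr do rewrite bias_sqr // mulrDr.
by rewrite big_split /= !sum_ind_eq; ring.
Qed.

Lemma expect_alpha tau c i : (0 < n)%N -> fallback tau ->
  expect (kernel tau c) (fun c' => alpha c' i) = alpha c i * (1 + alpha c i - gamma c).
Proof.
move=> n0 ft; have hq : pmf (kernel tau c) := kernel_pmf c n0 ft.
have nn : N != 0 by rewrite pnatr_eq0 -lt0n.
apply: (mulfI nn); rewrite -(sum_kernel c i n0 ft) -expectZ.
under eq_expect do rewrite -count_alpha //.
rewrite expect_sum; apply: eq_bigr => v _.
by rewrite (expect_coord v (fun o => (o == i)%:R) hq) sum_ind_eq.
Qed.

Lemma sum_mean_bias tau c i j : (0 < n)%N -> fallback tau ->
  \sum_v mean1 (kernel tau c) (bias i j) v =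
  N * ((alpha c i - alpha c j) * (1 + alpha c i + alpha c j - gamma c)).
Proof.
move=> n0 ft; under eq_bigr do rewrite mean1_bias.
by rewrite sumrB !sum_kernel //; ring.
Qed.

Lemma sum_var_maj c i j : (0 < n)%N -> i != j ->
  let x := alpha c i in let y := alpha c j in let g := gamma c in
  \sum_v var1 (kernel tau_maj c) (bias i j) v =
  N * (x * (1 + x - g) + y * (1 + y - g) - ((x - y) * (1 + x + y - g)) ^+ 2).
Proof.
move=> n0 ij x y g; under eq_bigr do rewrite (var1_bias _ (kernel_pmf _ n0 (fallback_maj n0))) //.
rewrite /kernel /tau_maj -/x -/y -/g sumr_const card_ord -mulr_natl.
by ring.
Qed.

Lemma sum_var_two c i j : (0 < n)%N -> i != j ->
  let x := alpha c i in let y := alpha c j in let g := gamma c in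
  \sum_v var1 (kernel tau_two c) (bias i j) v =
  N * (x ^+ 2 + y ^+ 2 + (x + y) * (g * (1 - g))
       - (x - y) ^+ 2 * (x + y) * (2 - 2 * g + (x + y))).
Proof.
move=> n0 ij x y g.
pose d := x ^+ 2 - y ^+ 2.
have E v : var1 (kernel tau_two c) (bias i j) v =
    (x ^+ 2 + y ^+ 2 - d ^+ 2) + ((1 - g) - (1 - g) ^+ 2) * ((c v == i)%:R + (c v == j)%:R)
     - 2 * d * (1 - g) * bias i j (c v).
  rewrite (var1_bias _ (kernel_pmf _ n0 (fallback_two n0))) // -bias_sqr //.
  rewrite /kernel /tau_two -/x -/y -/g.
  have := bias_sqr (c v) ij; rewrite /d /bias.
  move: ((c v == i)%:R : R) ((c v == j)%:R : R) => a b h.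
  apply/eqP; rewrite -subr_eq0; apply/eqP.
  rewrite (_ : _ - _ = (1 - g) * (a + b - (a - b) ^+ 2)); last by ring.
  by rewrite h subrr mulr0.
under eq_bigr do rewrite E.
rewrite sumrB big_split /= sumr_const card_ord -!mulr_sumr big_split /= !count_alpha //.
have -> : \sum_v bias i j (c v) = N * (x - y) by apply: csum_bias.
by rewrite -mulr_natl /d -/x -/y; ring.
Qed.

(** The probabilities that the vertices take [i] are nonnegative with sum 0, so every configuration
    of positive weight lacks [i]. *)
Lemma expect_extinct tau c i (F : config n k -> R) : (0 < n)%N -> fallback tau ->
  alpha c i = 0 -> (forall c', alpha c' i = 0 -> F c' = 0) ->
  expect (kernel tau c) F = 0.
Proof.
move=> n0 ft ai hF; have hq : pmf (kernel tau c) := kernel_pmf c n0 ft.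
have ki v : kernel tau c v i = 0.
  have := sum_kernel c i n0 ft; rewrite ai mul0r mulr0 => /eqP.
  rewrite psumr_eq0; last by move=> w _; case: (hq w).
  by move/allP => /(_ v (mem_index_enum v)) /eqP.
rewrite /expect big1 // => c' _.
have [/existsP[v /eqP cv]|nv] := boolP [exists v, c' v == i].
  by rewrite (bigD1 v) //= cv ki mul0r mul0r.
rewrite hF ?mulr0 //.
have nn : N != 0 by rewrite pnatr_eq0 -lt0n.
apply: (mulfI nn); rewrite mulr0 -count_alpha // big1 // => v _.
by move/existsPn: nv => /(_ v) /negbTE ->.
Qed.
End PairStatistics.

(** * Logarithmic inequalities for 3-Majority *)

Section MajIneq.
Context {R : realType}.
Implicit Types (x y g : R).

(** By AM-GM the product of the two growth factors is at most [(P - (x + y) / 2)^2 = (P (1 - t))^2].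
    Keeping the quadratic term in [t] is needed when the densities are not small. *)
Lemma ln_pair_le x y g (P := 1 + (x + y) - g) : 0 < x -> 0 < y -> g <= 1 ->
  exists t, [/\ 0 < t, t < 1, 2 * t * P = x + y &
    ln (1 + x - g) + ln (1 + y - g) <= 2 * (ln P - t - t ^+ 2 / 2)].
Proof.
move=> x0 y0 g1.
have P0 : 0 < P by rewrite /P; lra.
have x1 : 0 < 1 + x - g by lra.
have y1 : 0 < 1 + y - g by lra.
pose t := (x + y) / (2 * P).
have tP : 2 * t * P = x + y by rewrite /t; field; rewrite gt_eqF.
have t0 : 0 < t by rewrite divr_gt0 //; [exact: addr_gt0|exact: mulr_gt0].
have t1 : t < 1 by rewrite ltr_pdivrMr ?mulr_gt0 // mul1r /P; lra.
exists t; split => //.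
have t2 : 0 < 1 - t by lra.
have hl := ln_le_quad (ltW t0) t1.
have -> : 2 * (ln P - t - t ^+ 2 / 2) = 2 * (ln P + (- t - t ^+ 2 / 2)) by ring.
apply: (@le_trans _ _ (2 * (ln P + ln (1 - t)))); last by lra.
rewrite -!lnM ?posrE //.
have PE : P * (1 - t) = (1 + x - g + (1 + y - g)) / 2.
  have PtE : P * t = (x + y) / 2 by rewrite -tP; field.
  by rewrite mulrBr mulr1 PtE /P; field.
have s0 : 0 < (1 + x - g + (1 + y - g)) / 2 by rewrite divr_gt0 // addr_gt0.
rewrite mulr_natl -lnXn PE // ler_ln ?posrE ?exprn_gt0 //; last exact: mulr_gt0.
by have := sqr_ge0 (x - y); lra.
Qed.

(** To first order the left side is [- (4 / 100) v - (8 / 100) g]. This settles the case [P <= 1] at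
    once; for [P > 1] the second-order terms count, and everything is multiplied by [P] to use
    [ln_le_hyp]. *)
Lemma maj_ineq_shrink x y g (v := x + y) (P := 1 + v - g) :
  0 < x -> 0 < y -> v <= 1 -> x ^+ 2 + y ^+ 2 <= g -> g <= 1 ->
  54 / 100 * (ln (1 + x - g) + ln (1 + y - g)) + 42 / 100 * ln (1 + v) - ln P
    <= - (1 / 25) * g.
Proof.
move=> x0 y0 v1 Sg g1.
have [t [t0 t1 tP hA]] := ln_pair_le x0 y0 g1.
rewrite -/v -/P in tP hA.
have v0 : 0 < v by rewrite addr_gt0.
have vg : v ^+ 2 / 2 <= g by have := sqr_ge0 (x - y); rewrite /v; lra.
have P0 : 0 < P by rewrite /P; lra.
have v10 : 0 < 1 + v by lra.
have [P1|P1] := leP P 1.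
  have tv : v <= 2 * t by rewrite -tP ger_pMr // mulr_gt0.
  have h3 : ln P <= v - g.
    by apply: le_trans (ln_leB1 P0) _; rewrite /P; clear; lra.
  have h2 : ln (1 + v) <= v by apply: le_ln1Dx; apply: lt_trans v0; rewrite ltrN10.
  have h1 := sqr_ge0 t.
  have g0 : 0 <= g by have := sqr_ge0 v; clear -vg; lra.
  by clear -h1 h2 h3 hA g0 tv v0; lra.
have lnv : P * ln (1 + v) <= P * ln P + g.
  have -> : 1 + v = P * (1 + g / P) by rewrite /P; field; rewrite gt_eqF.
  have g0 : 0 <= g by have := sqr_ge0 v; lra.
  have gP : 0 <= g / P by rewrite divr_ge0 // ltW.
  have gP1 : 0 < 1 + g / P by rewrite ltr_wpDr.
  rewrite (lnM P0 gP1) mulrDr lerD2l.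
  have : ln (1 + g / P) <= g / P.
    by apply: le_ln1Dx; apply: lt_le_trans gP; rewrite ltrN10.
  by rewrite ler_pdivlMr // mulrC.
have lnP := ln_le_hyp (ltW P1).
rewrite -(ler_pM2l P0).
have hA' := ler_wpM2l (ltW P0) hA.
have P32 : P <= 3 / 2 by rewrite /P; nra.
have tP2 : v ^+ 2 / 6 <= P * t ^+ 2.
  have -> : v ^+ 2 = 4 * P * (P * t ^+ 2) by rewrite -tP; ring.
  have : 0 <= P * t ^+ 2 by rewrite mulr_ge0 ?sqr_ge0 // ltW.
  by clear -P32; nra.
(* The logarithms of [P] add up to [1 / 2 * P * ln P], and this square is what [ln_le_hyp] leaves
   beyond first order. *)
have key : 1 / 4 * (v - g) ^+ 2 <= 4 / 100 * v + 9 / 100 * v ^+ 2.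
  have vg1 : g <= v by rewrite /P in P1; lra.
  have : (v - g) ^+ 2 <= (v - v ^+ 2 / 2) ^+ 2.
    by rewrite ler_sqr ?nnegrE; lra.
  have : 0 <= v * (4 / 100 + 9 / 100 * v - 1 / 4 * v * (1 - v / 2) ^+ 2).
    apply: mulr_ge0; first exact: ltW.
    have : 0 <= v ^+ 2 * (1 - v) by rewrite mulr_ge0 ?sqr_ge0 // subr_ge0.
    have := sqr_ge0 (v - 3 / 7).
    by clear -v0; lra.
  by clear; lra.
have g2 : g * P <= 2 * g by clear -P32 vg; have := sqr_ge0 v; nra.
have PP : P ^+ 2 - 1 = 2 * (v - g) + (v - g) ^+ 2 by rewrite /P; ring.
move: (ln P) (ln (1 + v)) (ln (1 + x - g) + ln (1 + y - g)) hA' lnv lnP => lP l1 lA hA' lnv lnP.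
rewrite PP in lnP.
by clear -hA' lnv lnP tP2 key g2 tP v0; lra.
Qed.

Lemma maj_ineq_stretch x y g (v := x + y) (P := 1 + v - g) :
  0 < x -> 0 < y -> v <= 1 -> x ^+ 2 + y ^+ 2 <= g -> g <= 1 ->
  54 / 100 * (ln (1 + x - g) + ln (1 + y - g)) - 58 / 100 * ln P
    <= - (1 / 25) * g.
Proof.
move=> x0 y0 v1 Sg g1.
have h := maj_ineq_shrink x0 y0 v1 Sg g1; rewrite -/v -/P in h.
have v0 : 0 < v by rewrite addr_gt0.
have g0 : 0 <= g by have := sqr_ge0 x; have := sqr_ge0 y; lra.
have : ln P <= ln (1 + v) by rewrite ler_ln ?posrE /P; lra.
by move: (ln P) (ln _) h => lP l1 h; lra.
Qed.
End MajIneq.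

(** * Contraction for 3-Majority *)

Section MajContraction.
Context {R : realType} {n k : nat}.
Implicit Types (c : config n k) (i j : 'I_k).
Local Notation alpha := (@alpha R n k).
Local Notation gamma := (@gamma R n k).
Local Notation N := (n%:R : R).

(** The value 0 for an extinct opinion is that of a positive power of its density, which the default
    value of [ln] at 0 would not give. The exponent [54 / 100] lies between [1 / 2] and the noise
    exponent [58 / 100]. *)
Definition maj_pot (p : R) i j c : R :=
  if (0 < alpha c i) && (0 < alpha c j) then
    expR (p * (54 / 100) * (ln (alpha c i) + ln (alpha c j))
          + 1 / 2 * ln (gpot p p N (csum (bias i j) c)))
  else 0.

Lemma maj_drift_poly (y : R) : 0 <= y -> y <= 1 ->
  58 / 100 * 2 - 0 + 12 / 1000 <= 2 - y - (1 + 2) * y ^+ 2 + 4 * y ^+ 3.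
Proof.
move=> y0 y1.
(* [632 / 1000] approximates the minimiser of the cubic on the right, so the difference is nearly
   this product with a double root. *)
have : 0 <= (y - 632 / 1000) ^+ 2 * (4 * y + 2056 / 1000).
  by rewrite mulr_ge0 ?sqr_ge0 //; lra.
by lra.
Qed.

(** Trading [c = 2] times the variance [N * sg] for scale replaces [N] by [N * L], and
    [L = 1 + 2 sg] matches [P^2], the growth of the squared bias, near a tie. Then [z] is multiplied
    by [mu = P^2 / L]: for [mu <= 1] the loss is at most [mu^-p], and for [mu > 1] the bias is large
    enough for the stretch to be a gain. *)
Lemma maj_gpot_bound (p tau : R) i j c (x := alpha c i) (y := alpha c j)
    (g := gamma c) (P := 1 + (x + y) - g) (z := N * (x - y) ^+ 2) :
  (0 < n)%N -> i != j -> 0 < tau -> 20 * tau <= 1 / 1000 -> 0 < p -> p <= tau ->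
  1 <= tau ^+ 4 * N -> 16 <= N * g -> 0 < x -> 0 < y ->
  exists2 T, expect (kernel tau_maj c) (fun c' => gpot p p N (csum (bias i j) c'))
      <= expR (p * T) * gprof p p z &
    54 / 100 * (ln (1 + x - g) + ln (1 + y - g)) + 1 / 2 * T <= - (1 / 25) * g.
Proof.
move=> n0 ij t0 ht p0 pt hN Ng x0 y0.
have N0 : 0 < N by rewrite ltr0n.
have g1 : g <= 1 by apply: gamma_le1.
have v1 : x + y <= 1 by apply: pair_alpha_le1.
have Sg : x ^+ 2 + y ^+ 2 <= g by apply: pair_sqr_le_gamma.
have v0 : 0 < x + y by rewrite addr_gt0.
have P0 : 0 < P by rewrite /P; clear -g1 v0; lra.
have ft := fallback_maj (R := R) (k := k) n0.
have hq := kernel_pmf c n0 ft.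
have [a0 a1 c3] : [/\ 0 <= 58 / 100 :> R, 58 / 100 <= 1 :> R & 2 <= 3 :> R] by split; lra.
have := @expect_gpot_drift R n k (kernel tau_maj c) (bias i j) tau p N hq
  (bias_le1 i j) t0 ht p0 pt hN (58 / 100) 0 2 (ler0n _ 2) c3 a0 a1 (lexx _) maj_drift_poly.
rewrite sum_var_maj // sum_mean_bias // -/x -/y -/g.
rewrite mulr0 !mul0r expR0 mul1r expectZ.
set sg := _ - _ ^+ 2.
pose L := 1 + 2 * sg.
have -> : N + 2 * (N * sg) = N * L by rewrite /L; ring.
have -> : 1 + x + y - g = P by rewrite /P; ring.
have sgE : sg = (x + y) * (1 - g) + (x ^+ 2 + y ^+ 2) - ((x - y) * P) ^+ 2.
  by rewrite /sg /P; ring.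
have sg0 : 0 <= sg.
  have := sum_var_maj c n0 ij; cbv zeta; rewrite -/x -/y -/g -/sg => sE.
  rewrite -(pmulr_rge0 _ N0) -sE; apply: sumr_ge0 => v _.
  by apply: var1_ge0 => //; apply: bias_le1.
have L1 : 1 <= L by rewrite /L lerDl mulr_ge0.
have L0 : 0 < L by apply: lt_le_trans L1.
rewrite gpotE ?mulr_gt0 // (lnM N0 L0).
pose mu := P ^+ 2 / L.
have mu0 : 0 < mu by rewrite divr_gt0 ?exprn_gt0.
have lmu : ln mu = 2 * ln P - ln L.
  by rewrite ln_div ?posrE ?exprn_gt0 // lnXn // mulr_natl.
have -> : (N * ((x - y) * P)) ^+ 2 / (N * L) = mu * z.
  by rewrite /mu /z; field; rewrite !gt_eqF.
have z0 : 0 <= z by rewrite mulr_ge0 ?sqr_ge0 // ltW.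
rewrite (_ : - (p * (58 / 100) * (ln N + ln L)) =
  - (p * (58 / 100) * ln N) + - (p * (58 / 100) * ln L)); last by ring.
rewrite expRD -[X in _ <= X -> _]mulrA ler_pM2l ?expR_gt0 // => EG.
have pl := ltW p0.
have [m1|m1] := leP mu 1.
  exists (42 / 100 * ln L - 2 * ln P).
    apply: (le_trans EG).
    apply: (@le_trans _ _ (expR (- (p * (58 / 100) * ln L)) * (expR (- (p * ln mu)) * gprof p p z))).
      by apply: ler_wpM2l; [exact: expR_ge0|exact: gprof_shrink].
    rewrite mulrA -expRD lmu le_eqVlt; apply/orP; left; apply/eqP.
    by congr (expR _ * _); field.
  have LL : ln L <= 2 * ln (1 + (x + y)).
    have v10 : 0 < 1 + (x + y) by rewrite addr_gt0.
    rewrite mulr_natl -lnXn // ler_ln ?posrE ?exprn_gt0 //.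
    rewrite /L sgE.
    have [P1|P1] := leP 1 P.
      have : (x - y) ^+ 2 <= ((x - y) * P) ^+ 2.
        by rewrite exprMn ler_peMr ?sqr_ge0 ?exprn_ege1.
      have : 0 <= (x + y) * g by rewrite mulr_ge0 ?gamma_ge0 // ltW.
      by have := sqr_ge0 (x - y); clear; lra.
    have vg : x + y <= g by rewrite /P in P1; clear -P1; lra.
    have h1 := ler_wpM2l (ltW v0) vg.
    have h2 := sqr_ge0 ((x - y) * P).
    have h3 : 0 <= x * y by rewrite mulr_ge0 // ltW.
    have h4 : 0 <= (x + y) * g by rewrite mulr_ge0 ?gamma_ge0 // ltW.
    by clear -h1 h2 h3 h4; lra.
  have h := maj_ineq_shrink x0 y0 v1 Sg g1; rewrite -/P in h.
  by clear -h LL; lra.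
(* [L < P^2] forces [g <= 8 (x - y)^2], and [N * g] is at least 16. The value 2 suffices because
   [58 / 100 <= 2 / 3]. *)
have z2 : 2 <= z.
  have : L < P ^+ 2 by rewrite -[L]mul1r -ltr_pdivlMr.
  rewrite /L sgE => hLP.
  have P2 : P <= 2 by rewrite /P; clear -v1 g1 Sg; have := sqr_ge0 x; have := sqr_ge0 y; lra.
  have P4 : P ^+ 2 <= 4 by rewrite expr2; clear -P2 P0; nra.
  have u4 : ((x - y) * P) ^+ 2 <= 4 * (x - y) ^+ 2.
    by rewrite exprMn mulrC; apply: ler_wpM2r => //; apply: sqr_ge0.
  have ug : g <= 8 * (x - y) ^+ 2.
    have PE : P ^+ 2 = 1 + 2 * (x + y) - 2 * g + ((x + y) - g) ^+ 2 by rewrite /P; ring.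
    have gg : g ^+ 2 <= g by rewrite expr2 ler_piMr // gamma_ge0.
    by rewrite PE in hLP; have := sqr_ge0 (x - y); clear -hLP u4 gg; lra.
  have := ler_wpM2l (ltW N0) ug; rewrite /z; clear -Ng; lra.
exists (- (2 * (58 / 100)) * ln P).
  apply: (le_trans EG).
  apply: (@le_trans _ _ (expR (- (p * (58 / 100) * ln L)) *
      (expR (- (p * (58 / 100) * ln mu)) * gprof p p z))).
    apply: ler_wpM2l; first exact: expR_ge0.
    by apply: gprof_stretch => //; rewrite ?(ltW m1) //; clear -z2; lra.
  rewrite mulrA -expRD lmu le_eqVlt; apply/orP; left; apply/eqP.
  by congr (expR _ * _); field.
have h := maj_ineq_stretch x0 y0 v1 Sg g1; rewrite -/P in h.
by clear -h; lra.
Qed.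

Lemma maj_contraction (p tau : R) i j c :
  (0 < n)%N -> i != j -> 0 < tau -> 20 * tau <= 1 / 1000 -> 0 < p -> p <= tau ->
  1 <= tau ^+ 4 * N -> 16 <= N * gamma c ->
  expect (kernel tau_maj c) (maj_pot p i j) <=
  expR (- (p / 25 * gamma c)) * maj_pot p i j c.
Proof.
move=> n0 ij t0 ht p0 pt hN Ng.
have N0 : 0 < N by rewrite ltr0n.
have ft := fallback_maj (R := R) (k := k) n0.
have hq := kernel_pmf c n0 ft.
have [x0|x0] := ltP 0 (alpha c i); last first.
  rewrite (@expect_extinct R n k tau_maj c i) ?{1}/maj_pot //; last first.
  - by move=> c' ->; rewrite /maj_pot ltxx.
  - by apply/eqP; rewrite eq_le x0 alpha_ge0.
  - by rewrite /maj_pot ltNge x0 /= mulr0.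
have [y0|y0] := ltP 0 (alpha c j); last first.
  rewrite (@expect_extinct R n k tau_maj c j) ?{1}/maj_pot //; last first.
  - by move=> c' h; rewrite /maj_pot h ltxx andbF.
  - by apply/eqP; rewrite eq_le y0 alpha_ge0.
  - by rewrite /maj_pot [X in _ && X]ltNge y0 /= andbF mulr0.
have [T ET HT] := maj_gpot_bound n0 ij t0 ht p0 pt hN Ng x0 y0.
set x := alpha c i in x0 ET HT *; set y := alpha c j in y0 ET HT *.
set g := gamma c in HT *; set z := N * (x - y) ^+ 2 in ET.
have g1 : g <= 1 by apply: gamma_le1.
have z0 : 0 <= z by rewrite mulr_ge0 ?sqr_ge0 // ltW.
have G0 : 0 < gprof p p z by rewrite gprof_gt0 // ltW.
have gp0 c' : 0 < gpot p p N (csum (bias i j) c').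
  by rewrite gpotE // gprof_gt0 ?(ltW p0) // divr_ge0 ?sqr_ge0 // ltW.
have gpc : gpot p p N (csum (bias i j) c) = gprof p p z.
  rewrite gpotE // csum_bias // -/x -/y; congr (gprof _ _ _).
  by rewrite /z; field; rewrite gt_eqF.
have x1 : 0 < 1 + x - g by clear -g1 x0; lra.
have y1 : 0 < 1 + y - g by clear -g1 y0; lra.
pose w := nth (0 : R) [:: p * (54 / 100); p * (54 / 100); 1 / 2].
pose M := nth (0 : R) [:: x * (1 + x - g); y * (1 + y - g); expR (p * T) * gprof p p z].
pose f c' := nth (0 : R) [:: alpha c' i; alpha c' j; gpot p p N (csum (bias i j) c')].
apply: le_trans (@expect_slots R n k _ 'I_3 w M (fun l c' => f c' l) _ hq _ _ _ _ _ _) _.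
- by case=> [[|[|[|]]]] //= _; rewrite /w /=; clear -p0; lra.
- by rewrite !big_ord_recl big_ord0 /w /=; clear -p0 pt ht t0; lra.
- by case=> [[|[|[|]]]] //= _; rewrite /M /= mulr_gt0 ?expR_gt0.
- case=> [[|[|[|]]]] //= _; rewrite /M /f /=.
  + by rewrite expect_alpha.
  + by rewrite expect_alpha.
- by case=> [[|[|[|]]]] //= _ c'; rewrite /f /= ?alpha_ge0 // ltW.
- move=> c'; rewrite /maj_pot; case: ifP => [/andP[xx yy]|_]; [right|by left].
  split; first by case=> [[|[|[|]]]] //= _; rewrite /f /=.
  by rewrite !big_ord_recl big_ord0 /w /f /=; congr expR; ring.
rewrite /maj_pot -/x -/y x0 y0 /= gpc -expRD ler_expR.
rewrite !big_ord_recl big_ord0 /w /M /=.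
rewrite [ln (x * _)]lnM ?posrE // [ln (y * _)]lnM ?posrE //.
rewrite [ln (_ * gprof _ _ _)]lnM ?posrE ?expR_gt0 // expRK.
have := ler_wpM2l (ltW p0) HT.
move: (ln x) (ln y) (ln (1 + x - g)) (ln (1 + y - g)) (ln (gprof _ _ _)) => a b d e f'.
by clear; lra.
Qed.
End MajContraction.

(** * Contraction for 2-Choices *)

Section TwoIneq.
Context {R : realType}.
Implicit Types (x y g w kap : R).

Lemma ln_sub_le (P d : R) : 0 < P -> 0 <= d -> d < P ->
  ln (P - d) <= ln P - d / P - (d / P) ^+ 2 / 2.
Proof.
move=> P0 d0 dP.
have h0 : 0 <= d / P by rewrite divr_ge0 // ltW.
have h1 : d / P < 1 by rewrite ltr_pdivrMr // mul1r.
have h2 : 0 < 1 - d / P by rewrite subr_gt0.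
have -> : P - d = P * (1 - d / P) by field; rewrite gt_eqF.
rewrite [ln (P * _)]lnM ?posrE //.
have := ln_le_quad h0 h1.
by clear; lra.
Qed.

(* [g] is the sum of all squared densities, hence dominates [x ^+ 2 + y ^+ 2];
   [sg = (x ^+ 2 + y ^+ 2) / (x + y)] is the growth rate of [x + y]. *)
Lemma two_ineq_tie x y g kap (v := x + y) (sg := (x ^+ 2 + y ^+ 2) / v)
    (P := 1 + v - g) :
  0 < x -> 0 < y -> v <= 1 -> x ^+ 2 + y ^+ 2 <= g -> g <= 1 ->
  16 * (x - y) ^+ 2 <= v ^+ 2 -> kap = 1 \/ kap = 66 / 100 ->
  74 / 100 * (ln (1 + x - g) + ln (1 + y - g)) + 32 / 100 * (g + sg)
    + kap * (ln (1 + sg - g) - 2 * ln P) <= - (1 / 100) * (g + v).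
Proof.
move=> x0 y0 v1 Sg g1 tie hk.
have [t [t0 t1 tP hA]] := ln_pair_le x0 y0 g1.
rewrite -/v -/P in tP hA.
have v0 : 0 < v by rewrite addr_gt0.
have vg : v ^+ 2 / 2 <= g by have := sqr_ge0 (x - y); rewrite /v; clear -Sg; lra.
have g0 : 0 <= g by have := sqr_ge0 v; clear -vg; lra.
have P0 : 0 < P by rewrite /P; clear -v0 g1; lra.
have sv : sg * v = x ^+ 2 + y ^+ 2 by rewrite /sg divfK // gt_eqF.
have sg1 : 32 * sg <= 17 * v.
  rewrite /sg mulrA ler_pdivrMr //; move: tie; rewrite /v; clear; lra.
have sg0 : 0 <= sg by rewrite divr_ge0 ?addr_ge0 ?sqr_ge0 // ltW.
have d0 : 0 <= v - sg by clear -sg1 v0; lra.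
have dP : v - sg < P.
  have : 0 < sg by rewrite divr_gt0 // addr_gt0 // exprn_gt0.
  by rewrite /P; clear -g1; lra.
have hB := ln_sub_le P0 d0 dP.
have PE : P - (v - sg) = 1 + sg - g by rewrite /P; clear; lra.
rewrite PE in hB.
set d := (v - sg) / P in hB.
have dPE : d * P = v - sg by rewrite /d divfK // gt_eqF.
have d00 : 0 <= d by rewrite divr_ge0 // ltW.
have [P1|P1] := leP P 1.
  have tv : v <= 2 * t by rewrite -tP ger_pMr // mulr_gt0.
  have dv : v - sg <= d by rewrite -dPE ler_piMr.
  have h3 : ln P <= v - g.
    by apply: le_trans (ln_leB1 P0) _; rewrite /P; clear; lra.
  have h1 := sqr_ge0 t; have h2 := sqr_ge0 d.
  by case: hk => ->; clear -h1 h2 h3 hA hB g0 tv dv v0 sg1; lra.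
have lP0 : 0 <= ln P by rewrite ln_ge0 // ltW.
(* For [P > 1] the bracket multiplied by [kap] is negative, so the smaller [kap] is the worse
   case. *)
suff: 74 / 100 * (ln (1 + x - g) + ln (1 + y - g)) + 32 / 100 * (g + sg)
    + 66 / 100 * (ln (1 + sg - g) - 2 * ln P) <= - (1 / 100) * (g + v).
  case: hk => -> //; have h2 := sqr_ge0 d.
  by clear -hB lP0 d00 h2; lra.
have lnP := ln_le_hyp (ltW P1).
rewrite -(ler_pM2l P0).
have hA' := ler_wpM2l (ltW P0) hA.
have hB' := ler_wpM2l (ltW P0) hB.
have P32 : P <= 3 / 2.
  by have := sqr_ge0 (1 - v); rewrite /P; clear -vg; lra.
have sq6 (b : R) : 4 / 9 * (b * P) ^+ 2 * (3 / 2) <= P * b ^+ 2.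
  rewrite -subr_ge0 (_ : _ - _ = P * b ^+ 2 * (1 - 2 / 3 * P)); last by field.
  apply: mulr_ge0; last by clear -P32; lra.
  by apply: mulr_ge0; rewrite ?sqr_ge0 // ltW.
have tP2 : v ^+ 2 / 6 <= P * t ^+ 2.
  by apply: le_trans (sq6 t); rewrite -tP le_eqVlt; apply/orP; left; apply/eqP; field.
have dP2 : 2 / 3 * (15 / 32 * v) ^+ 2 <= P * d ^+ 2.
  apply: le_trans (sq6 d); rewrite dPE.
  have : (15 / 32 * v) ^+ 2 <= (v - sg) ^+ 2.
    have a0 : 0 <= 15 / 32 * v by clear -v0; lra.
    by rewrite ler_sqr ?nnegrE //; clear -sg1; lra.
  by clear; lra.
have PP : P ^+ 2 - 1 = 2 * (v - g) + (v - g) ^+ 2 by rewrite /P; ring.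
rewrite PP in lnP.
have vg1 : g <= v by rewrite /P in P1; clear -P1; lra.
have Psg : P * (32 * sg) <= P * (17 * v) by apply: ler_wpM2l => //; exact: ltW.
have key : - (443 / 10000) * v + 4084 / 10000 * v ^+ 2 - 67 / 100 * (v * g) + 9 / 100 * g ^+ 2
    - 485 / 1000 * g <= 0.
  have k1 : 0 <= v * (443 / 10000 - 1659 / 10000 * v + 29 / 100 * v ^+ 2).
    apply: mulr_ge0; first exact: ltW.
    by have := sqr_ge0 (v - 2 / 7); clear -v1; lra.
  have k2 : g ^+ 2 <= v * g by rewrite expr2; apply: ler_wpM2r.
  have k3 := ler_wpM2l (ltW v0) vg.
  by clear -k1 k2 k3 vg v0; lra.
have PgE : P * (g + sg) = g + v * g - g ^+ 2 + P * sg by rewrite /P; ring.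
have PvE : P * (g + v) <= 3 / 2 * (g + v).
  by apply: ler_wpM2r => //; rewrite addr_ge0 // ltW.
have PsE : P * (17 * v) = 17 * (v + v ^+ 2 - v * g) by rewrite /P; ring.
have tPv : P * t = v / 2 by rewrite -tP; field.
have PdE : P * d = v - sg by rewrite mulrC.
have v2 := sqr_ge0 v.
by clear -hA' hB' lnP tP2 dP2 key PgE PvE Psg PsE tPv PdE sg1 v0 v2; lra.
Qed.

(** No trade of variance for scale is made here: [kap = 1] belongs to a shrinking bias and [9 / 10]
    to a stretch with [z >= 9]. As [sg <= v], to first order the terms in [v] sum to at most
    [- (16 / 100) v] and the coefficient of [g] is negative. *)
Lemma two_ineq_far x y g kap (v := x + y) (sg := (x ^+ 2 + y ^+ 2) / v)
    (P := 1 + v - g) :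
  0 < x -> 0 < y -> v <= 1 -> x ^+ 2 + y ^+ 2 <= g -> g <= 1 ->
  v ^+ 2 <= 16 * (x - y) ^+ 2 -> kap = 1 \/ kap = 9 / 10 ->
  74 / 100 * (ln (1 + x - g) + ln (1 + y - g))
    + kap * (ln (1 + sg - g) - 2 * ln P) <= - (1 / 100) * (g + v).
Proof.
move=> x0 y0 v1 Sg g1 far hk.
have [t [t0 t1 tP hA]] := ln_pair_le x0 y0 g1.
rewrite -/v -/P in tP hA.
have v0 : 0 < v by rewrite addr_gt0.
have vg : v ^+ 2 / 2 <= g by have := sqr_ge0 (x - y); rewrite /v; clear -Sg; lra.
have g0 : 0 <= g by have := sqr_ge0 v; clear -vg; lra.
have P0 : 0 < P by rewrite /P; clear -v0 g1; lra.
have sgv : sg <= v.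
  rewrite /sg ler_pdivrMr //; have : 0 <= x * y by rewrite mulr_ge0 // ltW.
  by rewrite /v; clear; lra.
have sg0 : 0 < sg by rewrite divr_gt0 // addr_gt0 // exprn_gt0.
have sP : ln (1 + sg - g) <= ln P.
  by rewrite ler_ln ?posrE // /P; clear -sgv g1 sg0; lra.
have [P1|P1] := leP P 1.
  have tv : v <= 2 * t by rewrite -tP ger_pMr // mulr_gt0.
  have h3 : ln P <= v - g.
    by apply: le_trans (ln_leB1 P0) _; rewrite /P; clear; lra.
  have h1 := sqr_ge0 t.
  by case: hk => ->; clear -h1 h3 hA g0 tv v0 sP; lra.
have lP0 : 0 <= ln P by rewrite ln_ge0 // ltW.
have lPv : v - g <= 2 * ln P.
  have P2 : P <= 2 by rewrite /P; clear -v1 g0; lra.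
  have Pi0 : 0 < P^-1 by rewrite invr_gt0.
  have : ln P^-1 <= P^-1 - 1 by apply: ln_leB1.
  rewrite lnV ?posrE // => h.
  have : (v - g) / 2 <= 1 - P^-1.
    have -> : 1 - P^-1 = (v - g) / P by rewrite /P; field; rewrite gt_eqF.
    apply: ler_wpM2l; first by rewrite /P in P1; clear -P1; lra.
    by rewrite lef_pV2 ?posrE.
  by clear -h; lra.
have x1 : 0 < 1 + x - g by clear -x0 g1; lra.
have y1 : 0 < 1 + y - g by clear -y0 g1; lra.
have hl : ln (1 + x - g) + ln (1 + y - g) <= ln P - 1 / 2 * g.
  rewrite -lnM ?posrE //.
  pose D := 1 - g + x * y / P.
  have AE : (1 + x - g) * (1 + y - g) = P * D.
    by rewrite /D /P /v; field; rewrite gt_eqF.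
  have D0 : 0 < D by rewrite -(pmulr_rgt0 _ P0) -AE mulr_gt0.
  rewrite AE [ln (P * _)]lnM ?posrE // lerD2l.
  apply: le_trans (ln_leB1 D0) _; rewrite /D.
  have : x * y / P <= x * y.
    by rewrite ler_pdivrMr // ler_peMr ?mulr_ge0 ?(ltW x0) ?(ltW y0) // ltW.
  have : 2 * (x * y) <= g.
    by move: far Sg; rewrite /v; clear -g0; lra.
  by clear; lra.
by case: hk => ->; clear -hl sP lP0 lPv g0 v0; lra.
Qed.

Lemma mix_gt0 w t : 0 <= w -> w <= 1 -> -1 < t -> 0 < 1 + w * t.
Proof.
move=> w0 w1 t1; have [tn|tp] := leP t 0.
  have : 0 <= (1 - w) * (- t) by apply: mulr_ge0; clear -w1 tn; lra.
  by clear -t1; lra.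
by rewrite ltr_wpDr // mulr_ge0 // ltW.
Qed.

Lemma ln_slow_le w t : 0 <= w -> w <= 1 -> -1 < t ->
  ln (1 + t) - ln (1 + w * t) <= (1 - w) * Num.max t 0.
Proof.
move=> w0 w1 t1.
have a0 : 0 < 1 + t by lra.
have b0 := mix_gt0 w0 w1 t1.
have [tn|tp] := leP t 0.
  rewrite mulr0 subr_le0 ler_ln ?posrE // lerD2l.
  have : 0 <= (1 - w) * (- t) by apply: mulr_ge0; clear -w1 tn; lra.
  by clear; lra.
have d0 : 0 <= (1 - w) * t by rewrite mulr_ge0 ?subr_ge0 // ltW.
rewrite lerBlDr.
have h : ln (1 + (1 - w) * t) <= (1 - w) * t.
  by apply: le_ln1Dx; apply: lt_le_trans d0; rewrite ltrN10.
apply: le_trans (_ : ln (1 + (1 - w) * t) + ln (1 + w * t) <= _); last by rewrite lerD2r.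
have c0 : 0 < 1 + (1 - w) * t by rewrite ltr_wpDr.
rewrite -lnM ?posrE // ler_ln ?posrE ?mulr_gt0 //.
have : 0 <= w * (1 - w) * t ^+ 2.
  apply: mulr_ge0; last exact: sqr_ge0.
  by apply: mulr_ge0 => //; rewrite subr_ge0.
by clear; lra.
Qed.

(** The quotient [(1 + t) / (1 + w' t)] increases in [t] and, for negative [t], in [w']; the extreme
    case is [t = - h], [w' = w]. *)
Lemma ln_slow_weak w w' t h : 0 <= w' -> w' <= w -> w <= 1 -> -1 < t -> t <= - h -> 0 <= h ->
  ln (1 + t) - ln (1 + w' * t) <= ln (1 - h) - ln (1 - w * h).
Proof.
move=> w0 ww w1 t1 th h0.
have a0 : 0 < 1 + t by lra.
have b0 := mix_gt0 w0 (le_trans ww w1) t1.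
have c0 : 0 < 1 - h by lra.
have d0 : 0 < 1 - w * h.
  by rewrite -mulrN; apply: mix_gt0 => //; [exact: (le_trans w0 ww)|clear -th t1; lra].
rewrite -!ln_div ?posrE // ler_ln ?posrE ?divr_gt0 //.
rewrite ler_pdivrMr // mulrAC ler_pdivlMr //.
have h1 : w * t <= w' * t.
  have : 0 <= (w - w') * (- t) by apply: mulr_ge0; clear -ww th h0; lra.
  by clear; lra.
have h2 : 0 <= (1 - w) * (- t - h) by apply: mulr_ge0; lra.
have h3 := ler_wpM2l (ltW c0) h1.
lra.
Qed.

(* A pair that is light compared with [g]: both densities and their difference
   decay, and no noise is needed. *)
Lemma two_ineq_light x y g w wx wy rho (v := x + y) (sg := (x ^+ 2 + y ^+ 2) / v)
    (P := 1 + v - g) :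
  0 < x -> 0 < y -> v <= 1 -> g <= 1 -> 10 * v <= g ->
  0 <= w -> w <= 1 -> 0 <= wx -> wx <= w -> 0 <= wy -> wy <= w ->
  rho = 1 + w * (sg - g) ->
  P ^+ 2 <= rho /\
  74 / 100 * (ln (1 + x - g) + ln (1 + y - g))
    + 1 / 2 * ((ln (1 + x - g) - ln (1 + wx * (x - g))) +
               (ln (1 + y - g) - ln (1 + wy * (y - g))))
    + 32 / 100 * (g + sg) + (ln rho - 2 * ln P) <= - (5 / 100) * g.
Proof.
move=> x0 y0 v1 g1 vg w0 w1 wx0 wxw wy0 wyw rhoE.
have v0 : 0 < v by rewrite addr_gt0.
have sgv : sg <= v.
  rewrite /sg ler_pdivrMr //; have : 0 <= x * y by rewrite mulr_ge0 // ltW.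
  by rewrite /v; clear; lra.
have sg2 : v / 2 <= sg.
  rewrite /sg ler_pdivlMr //; have := sqr_ge0 (x - y).
  by rewrite /v; clear; lra.
pose h := g - v.
have h0 : 0 <= h by rewrite /h; clear -vg v0; lra.
have PE : P = 1 - h by rewrite /P /h; ring.
have P0 : 0 < P by rewrite /P; clear -v0 g1; lra.
have g0 : 0 < g by clear -vg v0; lra.
have r1 : P - v / 2 <= rho.
  have : w * (g - sg) <= g - sg.
    by apply: ler_piMl => //; clear -sgv vg v0; lra.
  by rewrite rhoE /P; clear -sg2; lra.
have PP : P ^+ 2 <= P - v / 2.
  rewrite -subr_ge0 (_ : _ - _ = P * h - v / 2); last by rewrite PE; ring.
  have h9 : 9 * v <= h by rewrite /h; clear -vg; lra.
  have Pv : v <= P by rewrite /P; clear -g1; lra.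
  have [hh|hh] := leP (1 / 2) h.
    have := ler_wpM2l (ltW P0) hh; clear -Pv; lra.
  have : 1 / 2 * h <= P * h by apply: ler_wpM2r => //; rewrite PE; clear -hh; lra.
  by clear -h9 v0; lra.
have rho0 : 0 < rho by apply: lt_le_trans r1; apply: lt_le_trans PP; rewrite exprn_gt0.
split; first exact: le_trans r1.
have hx := @ln_slow_weak w wx (x - g) h wx0 wxw w1.
have hy := @ln_slow_weak w wy (y - g) h wy0 wyw w1.
have {}hx : ln (1 + x - g) - ln (1 + wx * (x - g)) <= ln (1 - h) - ln (1 - w * h).
  by rewrite -[1 + x - g]addrA; apply: hx; rewrite /h /v //; clear -x0 y0 g1; lra.
have {}hy : ln (1 + y - g) - ln (1 + wy * (y - g)) <= ln (1 - h) - ln (1 - w * h).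
  by rewrite -[1 + y - g]addrA; apply: hy; rewrite /h /v //; clear -x0 y0 g1; lra.
have wh : 0 < 1 - w * h.
  have : w * h <= h by rewrite ler_piMl.
  by move: P0; rewrite PE; clear; lra.
(* This term is cancelled by the two halves of [- ln (1 - w * h)] in [hx] and [hy]: the saturation
   factors supply the decay that the constant withholds from the scale. *)
have hr : ln rho <= ln (1 - w * h).
  rewrite ler_ln ?posrE // rhoE.
  have : w * sg <= w * v by apply: ler_wpM2l.
  by rewrite /h; clear; lra.
have lx : ln (1 + x - g) <= ln (1 - h).
  by rewrite ler_ln ?posrE -?PE // /P /v; clear -x0 y0 g1; lra.
have ly : ln (1 + y - g) <= ln (1 - h).
  by rewrite ler_ln ?posrE -?PE // /P /v; clear -x0 y0 g1; lra.
have lh : ln (1 - h) <= - h.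
  by rewrite -PE; apply: le_trans (ln_leB1 P0) _; rewrite PE; clear; lra.
rewrite PE.
have hE : h = g - v by [].
by clear -hx hy hr lx ly lh sgv vg hE g0; lra.
Qed.

End TwoIneq.

Section TwoNoise.
Context {R : realType}.
(* In the tie region the variance is large enough for the noise to keep up with
   the drift of the bias: the scale is [N * v + K] before the round, and the two
   summands on the right are the mean scale after it and three variances. *)
Lemma two_tie_noise (N K x y g : R) (v := x + y) (P := 1 + v - g) :
  0 < N -> 1 <= K -> 0 < x -> 0 < y -> v <= 1 -> x ^+ 2 + y ^+ 2 <= g -> g <= 1 ->
  g <= 10 * v -> 1000 * (1000 * K) <= N * g ->
  N ^+ 2 * (x - y) ^+ 2 <= 2 * (N * v + K) ->
  (N * v + K) * P ^+ 2 <=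
  (N * v + K + N * (x ^+ 2 + y ^+ 2 - g * v)) +
   3 * (N * (x ^+ 2 + y ^+ 2 + v * (g * (1 - g)) - (x - y) ^+ 2 * v * (2 - 2 * g + v))).
Proof.
move=> N0 K1 x0 y0 v1 Sg g1 gv NK hu.
have v0 : 0 < v by rewrite addr_gt0.
have g0 : 0 <= g by have := sqr_ge0 x; have := sqr_ge0 y; clear -Sg; lra.
have vg : v ^+ 2 / 2 <= g by have := sqr_ge0 (x - y); rewrite /v; clear -Sg; lra.
pose U := (x - y) ^+ 2; have U0 : 0 <= U := sqr_ge0 _.
(* [N * (v * B)] is the leading part of the right side minus the left; the lower bound on [N * g]
   and the near tie make the negative remainder smaller. *)
pose B := 4 * g * (1 - g) + v * (2 * g - v).
have B1 : g / 10 <= B.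
  have gg : g ^+ 2 <= g by rewrite expr2 ler_piMr.
  rewrite /B; have [vg1|vg1] := leP v g.
    have h1 : v * g <= v * (2 * g - v).
      by apply: ler_wpM2l; [exact: ltW|clear -vg1 g0; lra].
    have h2 := ler_wpM2r g0 gv.
    by clear -h1 h2 gg; lra.
  have v2 : v ^+ 2 <= v by rewrite expr2 ler_piMr // ltW.
  have [gh|gh] := leP g (1 / 2).
    have h1 := ler_wpM2l g0 (ltW vg1).
    have h2 : g * g <= g / 2 by have := ler_wpM2l g0 gh; clear; lra.
    by clear -h1 h2 vg gg g0; lra.
  have h1 : 0 <= (2 * g - 1) * (v - g).
    by apply: mulr_ge0; clear -gh vg1; lra.
  by clear -h1 v2 gg gh; lra.
have NU : N * (N * U) <= 4 * (N * v).
  have KNv : K <= N * v.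
    have := ler_wpM2l (ltW N0) gv; clear -NK K1; lra.
  by move: hu; rewrite /U; clear -KNv; lra.
have {}NU : N * U <= 4 * v by rewrite -(ler_pM2l N0); move: NU; clear; lra.
have Ng : v * (1000 * 1000) <= N * (v * g).
  have := ler_wpM2l (ltW v0) NK; have := ler_wpM2l (ltW v0) K1; clear; lra.
have KP : K * (P ^+ 2 - 1) <= 3 * (K * v).
  rewrite mulrCA; apply: ler_wpM2l; first by clear -K1; lra.
  have -> : P ^+ 2 - 1 = (v - g) * (2 + (v - g)) by rewrite /P; ring.
  have [h|h] := leP v g.
    apply: (@le_trans _ _ 0); last by rewrite mulr_ge0 // ltW.
    by apply: mulr_le0_ge0; clear -h v0 g1; lra.
  rewrite mulrC; apply: ler_pM; clear -h v0 v1 g0; lra.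
have KN : 1000 * (1000 * (K * v)) <= N * (v * g).
  have := ler_wpM2l (ltW v0) NK; clear; lra.
have U9 : 3 * (N * (U * v * (2 - 2 * g + v))) <= 36 * v.
  have h : v * (2 - 2 * g + v) <= 3.
    apply: (@le_trans _ _ (1 * 3)); last by rewrite mul1r.
    by apply: ler_pM; clear -v0 v1 g0 g1; lra.
  have NU0 : 0 <= N * U by rewrite mulr_ge0 // ltW.
  have := ler_wpM2l NU0 h; clear -NU; lra.
have NB : N * (v * (g / 10)) <= N * (v * B).
  by apply: ler_wpM2l; [exact: ltW|apply: ler_wpM2l => //; exact: ltW].
have NU0 : 0 <= N * U by rewrite mulr_ge0 // ltW.
rewrite -subr_ge0.
have -> : N * v + K + N * (x ^+ 2 + y ^+ 2 - g * v) +
  3 * (N * (x ^+ 2 + y ^+ 2 + v * (g * (1 - g)) - (x - y) ^+ 2 * v * (2 - 2 * g + v))) -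
  (N * v + K) * P ^+ 2 = 2 * (N * U) - 3 * (N * (U * v * (2 - 2 * g + v))) + N * (v * B)
    - K * (P ^+ 2 - 1).
  by rewrite /U /B /P /v; field.
by clear -NU0 U9 NB KP KN Ng v0; lra.
Qed.
End TwoNoise.

(** * Replacing a random scale by its mean *)

Section ScaleNoise.
Context {R : realType}.
Implicit Types (p tau r U : R).

(* [p / r * gslope p r U] is the derivative of [gpot p p r U] in [r]. *)
Definition gslope p r U : R :=
  expR (p * ln (r / (r + U ^+ 2))) *
  ((1 + (1 + p) * (r / (r + U ^+ 2))) * (1 - r / (r + U ^+ 2))).

(** Concavity in the scale. With [m] the ratio of the new [y] to the old one, [m^p <= 1 + p (m - 1)]
    leaves a rational inequality whose two sides differ by a nonnegative multiple of the squared
    relative change [g^2]. *)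
Lemma gpot_tangent p r r' U : 0 < p -> p <= 1 -> 0 < r -> 0 < r' ->
  gpot p p r' U <= gpot p p r U + p / r * (gslope p r U * (r' - r)).
Proof.
move=> p0 p1 r0 r0'.
have /andP[y0 y1] := gpot_frac U r0.
have U2 := sqr_ge0 U.
have Q0 : 0 < r + U ^+ 2 by rewrite ltr_wpDr.
have Q0' : 0 < r' + U ^+ 2 by rewrite ltr_wpDr.
pose y := r / (r + U ^+ 2); rewrite -/y in y0 y1.
pose g := r' / r - 1.
have g1 : 0 < 1 + g by rewrite /g subrKC divr_gt0.
have yg : 0 < 1 + y * g.
  have -> : 1 + y * g = (1 - y) + y * (1 + g) by ring.
  by rewrite ltr_wpDl ?subr_ge0 // mulr_gt0.
pose m := 1 + g * (1 - y) / (1 + y * g).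
have mE : m = (1 + g) / (1 + y * g) by rewrite /m; field; rewrite gt_eqF.
have m0 : 0 < m by rewrite mE divr_gt0.
have yE : r' / (r' + U ^+ 2) = y * m.
  have e1 : y * (1 + g) = r' / (r + U ^+ 2) by rewrite /y /g; field; rewrite !gt_eqF.
  have e2 : 1 + y * g = (r' + U ^+ 2) / (r + U ^+ 2).
    by rewrite /y /g; field; rewrite !gt_eqF.
  by rewrite mE mulrA e1 e2; field; rewrite !gt_eqF.
have eE : expR (p * ln (y * m)) = expR (p * ln y) * expR (p * ln m).
  by rewrite -expRD -mulrDr lnM.
rewrite /gpot /gslope yE -/y eE.
have em : expR (p * ln m) <= 1 + p * (m - 1).
  by apply: le_trans (expR_ln_le_lin (ltW p0) p1 m0) _; rewrite le_eqVlt; apply/orP; left; apply/eqP; ring.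
have pym : 0 <= 1 + p * (y * m).
  by apply: addr_ge0 => //; apply: mulr_ge0; [exact: ltW|apply: mulr_ge0; exact: ltW].
have -> : expR (p * ln y) * (1 + p * y) +
    p / r * (expR (p * ln y) * ((1 + (1 + p) * y) * (1 - y)) * (r' - r)) =
    expR (p * ln y) * (1 + p * y + p * (1 + (1 + p) * y) * (1 - y) * g).
  by rewrite /g; field; rewrite gt_eqF.
rewrite -mulrA; apply: ler_wpM2l; first exact: expR_ge0.
apply: (@le_trans _ _ ((1 + p * (m - 1)) * (1 + p * (y * m)))); first exact: ler_wpM2r.
rewrite -subr_ge0.
have -> : 1 + p * y + p * (1 + (1 + p) * y) * (1 - y) * g - (1 + p * (m - 1)) * (1 + p * (y * m))
  = p * y * (1 - y) * g ^+ 2 / (1 + y * g) ^+ 2 *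
    ((1 + y + p * y) * (1 + y * g) - p * (1 - y)).
  by rewrite /m; field; rewrite gt_eqF.
apply: mulr_ge0.
  apply: divr_ge0; last exact: sqr_ge0.
  apply: mulr_ge0; last exact: sqr_ge0.
  by apply: mulr_ge0; rewrite ?subr_ge0 // mulr_ge0 // ltW.
rewrite subr_ge0; apply: (@le_trans _ _ (1 * (1 - y))).
  by apply: ler_wpM2r => //; rewrite subr_ge0.
apply: ler_pM => //; rewrite ?subr_ge0 //.
  by have := mulr_gt0 p0 y0; clear -y0; lra.
have : y * (1 + g) >= 0 by rewrite mulr_ge0 // ltW.
by clear; lra.
Qed.

(** Moving [U] by 2 changes [Q = r + U^2] by a relative [5 tau^2] at most, because [|U| <= tau^2 Q].
    The slope is [y^p] times a quadratic polynomial in [y], so it changes by a comparable amount. *)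
Lemma gslope_diff p tau r U U' : 0 < p -> p <= tau -> 20 * tau <= 1 / 1000 ->
  1 <= tau ^+ 4 * r -> `|U' - U| <= 2 ->
  `|gslope p r U' - gslope p r U| <= 40 * tau ^+ 2 * gpot p p r U.
Proof.
move=> p0 pt ht hr UU.
have t0 : 0 < tau by apply: lt_le_trans pt.
have t4 : 0 < tau ^+ 4 by rewrite exprn_gt0.
have r0 : 0 < r by rewrite -(pmulr_rgt0 _ t4); apply: lt_le_trans hr.
have /andP[y0 y1] := gpot_frac U r0.
have /andP[z0 z1] := gpot_frac U' r0.
have U2 := sqr_ge0 U; have U2' := sqr_ge0 U'.
pose Q := r + U ^+ 2; pose Q' := r + U' ^+ 2.
have Q0 : 0 < Q by rewrite ltr_wpDr.
have Q0' : 0 < Q' by rewrite ltr_wpDr.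
have t2 : 0 < tau ^+ 2 by rewrite exprn_gt0.
have tau2 : 1000 * (20 * tau ^+ 2) <= tau by rewrite expr2; clear -t0 ht; nra.
have hQ : 1 <= tau ^+ 4 * Q.
  by apply: (le_trans hr); rewrite ler_pM2l // lerDl.
have absU : `|U| <= tau ^+ 2 * Q.
  rewrite -(@ler_pXn2r _ 2) ?nnegrE ?normr_ge0 //; last by rewrite mulr_ge0 ?exprn_ge0 ?ltW.
  rewrite real_normK ?num_real // exprMn -exprM.
  apply: (@le_trans _ _ Q); first by rewrite lerDr ltW.
  by rewrite [Q ^+ 2]expr2 mulrA -[leLHS]mul1r ler_pM2r.
have t4t2 : 1000 * tau ^+ 4 <= tau ^+ 2.
  rewrite (_ : tau ^+ 4 = tau ^+ 2 * tau ^+ 2); last by rewrite -exprD.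
  rewrite mulrA -[leRHS]mul1r; apply: ler_wpM2r; first exact: ltW.
  by clear -tau2 ht t0; lra.
have t4Q : 1000 * (tau ^+ 4 * Q) <= tau ^+ 2 * Q by rewrite mulrA ler_pM2r.
pose d := (Q' - Q) / Q.
have hd : `|d| <= 5 * tau ^+ 2.
  rewrite /d normrM [`|Q^-1|]gtr0_norm ?invr_gt0 // ler_pdivrMr //.
  have -> : Q' - Q = (U' - U) * (2 * U + (U' - U)) by rewrite /Q' /Q; ring.
  rewrite normrM; apply: (@le_trans _ _ (2 * (2 * (tau ^+ 2 * Q) + 2))).
    apply: ler_pM => //; apply: le_trans (ler_normD _ _) _; apply: lerD => //.
    by rewrite normrM ger0_norm // ler_wpM2l.
  by clear -t4Q hQ; lra.
move: (hd); rewrite ler_norml => /andP[d1 d2].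
have d3 : 0 < 1 + d by clear -d1 d2 tau2 ht t0; lra.
have QE : Q' = Q * (1 + d) by rewrite /d; field; rewrite gt_eqF.
rewrite /gslope /gpot -/Q -/Q' in y0 y1 z0 z1 *.
set y := r / Q in y0 y1 *; set z := r / Q' in z0 z1 *.
have zE : z = y / (1 + d) by rewrite /z QE /y invfM mulrA.
have lz : ln z = ln y - ln (1 + d) by rewrite zE ln_div ?posrE.
rewrite lz mulrBr expRD; set E := expR (- (p * ln (1 + d))).
have di0 : 0 < (1 + d)^-1 by rewrite invr_gt0.
have pd : `|p * d| <= tau ^+ 2.
  rewrite normrM gtr0_norm //; apply: (@le_trans _ _ (tau * (5 * tau ^+ 2))).
    by apply: ler_pM => //; exact: ltW.
  rewrite mulrCA mulrA mulrC -[leRHS]mulr1; apply: ler_wpM2l; first exact: ltW.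
  by clear -ht t0; lra.
move: (pd); rewrite ler_norml => /andP[pd1 pd2].
have E1 : 1 - tau ^+ 2 <= E.
  apply: le_trans (expR_ge1Dx _); rewrite lerD2l lerN2.
  apply: le_trans pd2; apply: ler_wpM2l; first exact: ltW.
  by apply: le_ln1Dx; clear -d3; lra.
have p1 : p <= 1 by clear -pt ht; lra.
have E2 : E <= 1 + 2 * tau ^+ 2.
  rewrite /E -mulrN -lnV ?posrE //.
  apply: le_trans (expR_ln_le_lin (ltW p0) p1 di0) _.
  have -> : 1 - p + p * (1 + d)^-1 = 1 + (- (p * d)) * (1 + d)^-1 by field; rewrite gt_eqF.
  rewrite lerD2l; apply: (@le_trans _ _ (tau ^+ 2 * (1 + d)^-1)).
    by apply: ler_wpM2r; [exact: ltW|clear -pd1; lra].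
  rewrite mulrC; apply: ler_wpM2r; first exact: ltW.
  by rewrite -[X in X <= _]mul1r ler_pdivrMr //; clear -d1 tau2 ht t0; lra.
have yz : `|z - y| <= 6 * tau ^+ 2.
  have -> : z - y = - (d * y * (1 + d)^-1) by rewrite zE; field; rewrite gt_eqF.
  rewrite normrN [`|_ * _^-1|]normrM [`|d * y|]normrM (gtr0_norm y0) (gtr0_norm di0).
  rewrite ler_pdivrMr //.
  apply: (@le_trans _ _ (5 * tau ^+ 2 * 1)); first by apply: ler_pM => //; exact: ltW.
  have h : tau ^+ 2 * 5 <= tau ^+ 2 * (6 * (1 + d)).
    by apply: ler_wpM2l; [exact: ltW|clear -d1 tau2 ht t0; lra].
  by clear -h; lra.
have e0 := expR_ge0 (p * ln y).
set F := expR (p * ln y) in e0 *.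
pose psi (x : R) := (1 + (1 + p) * x) * (1 - x).
rewrite -/(psi z) -/(psi y) (_ : F * E * psi z - F * psi y = F * (E * (psi z - psi y) + (E - 1) * psi y)); last by ring.
rewrite normrM (ger0_norm e0).
rewrite (_ : 40 * tau ^+ 2 * (F * (1 + p * y)) = F * (40 * tau ^+ 2 * (1 + p * y))); last by ring.
apply: ler_wpM2l => //.
have psid : `|psi z - psi y| <= 18 * tau ^+ 2.
  have -> : psi z - psi y = (z - y) * (p - (1 + p) * (z + y)) by rewrite /psi; ring.
  rewrite normrM (_ : 18 * tau ^+ 2 = 6 * tau ^+ 2 * 3); last by ring.
  have p2 : p <= 1 / 2 by clear -pt ht; lra.
  apply: ler_pM => //; rewrite ler_norml; clear -p0 p2 y0 y1 z0 z1.
  have h1 : (1 + p) * (z + y) <= 3 / 2 * (z + y) by apply: ler_wpM2r; lra.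
  have h2 : 0 <= (1 + p) * (z + y) by apply: mulr_ge0; lra.
  by apply/andP; split; lra.
have psiy : `|psi y| <= 3.
  rewrite /psi normrM -[3]mulr1; apply: ler_pM => //; rewrite ler_norml.
    have h1 : (1 + p) * y <= 1 + p by rewrite ler_piMr //; clear -p0; lra.
    have h2 : 0 <= (1 + p) * y by apply: mulr_ge0; clear -p0 y0; lra.
    have p2 : p <= 1 / 1000 by clear -pt ht t0; lra.
    by apply/andP; split; clear -h1 h2 p2; lra.
  by apply/andP; split; clear -y0 y1; lra.
have E0 : 0 <= E := expR_ge0 _.
have Ea : `|E| <= 11 / 10.
  have h : tau ^+ 2 <= 1 / 100.
    have h1 : tau <= 1 / 100 by clear -ht t0; lra.
    by rewrite expr2; apply: le_trans (ler_pM (ltW t0) (ltW t0) h1 h1) _; clear; lra.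
  by move: E2 h; rewrite ger0_norm //; clear; move: E (tau ^+ 2) => a b; lra.
have Eb : `|E - 1| <= 2 * tau ^+ 2.
  by rewrite ler_norml; apply/andP; split; clear -E1 E2 t2; lra.
apply: le_trans (ler_normD _ _) _.
rewrite [`|E * _|]normrM [`|(E - 1) * _|]normrM.
have b1 := ler_pM (normr_ge0 _) (normr_ge0 _) Ea psid.
have b2 := ler_pM (normr_ge0 _) (normr_ge0 _) Eb psiy.
have py0 : 0 <= 40 * tau ^+ 2 * (p * y).
  by apply: mulr_ge0; [apply: mulr_ge0 => //; exact: ltW|exact: mulr_ge0 (ltW p0) (ltW y0)].
by clear -b1 b2 py0 t2; lra.
Qed.
End ScaleNoise.

Section Covariance.
Context {R : realType} {n k : nat}.
Implicit Types (c : config n k).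

Lemma csum_upd (zeta : 'I_k -> R) c v o :
  csum zeta (upd c v o) = csum zeta c - zeta (c v) + zeta o.
Proof.
rewrite /csum (bigD1 v) //= [in RHS](bigD1 v) //= updE eqxx addrC.
rewrite [zeta (c v) + _]addrC addrK; congr (_ + _).
by apply: eq_bigr => w /negbTE wv; rewrite updE wv.
Qed.

(* The scale [K + csum (zeta ^+ 2)] of the potential is random as well.  The
   potential is concave in the scale, so only the covariance between the scale
   and the slope costs something; vertices that take their reference value
   [ref v] do not contribute to it. *)
Lemma expect_gpot_scale (q : 'I_n -> 'I_k -> R) (zeta : 'I_k -> R) (ref : 'I_n -> R)
    (tau p K : R)
    (r := K + \sum_v \sum_o q v o * zeta o ^+ 2)
    (Pi := \sum_v \sum_o q v o * (zeta o != ref v)%:R) :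
  pmf q -> (forall o, `|zeta o| <= 1) -> (forall v, `|ref v| <= 1) ->
  0 < p -> p <= tau -> 20 * tau <= 1 / 1000 -> 1 <= tau ^+ 4 * K ->
  expect q (fun c => gpot p p (K + csum (fun o => zeta o ^+ 2) c) (csum zeta c)) <=
  (1 + p / r * (80 * tau ^+ 2 * Pi)) * expect q (fun c => gpot p p r (csum zeta c)).
Proof.
move=> hq z1 ref1 p0 pt ht hK.
have t0 : 0 < tau by apply: lt_le_trans pt.
have t4 : 0 < tau ^+ 4 by rewrite exprn_gt0.
have K0 : 0 < K by rewrite -(pmulr_rgt0 _ t4); apply: lt_le_trans hK.
have m0 v : 0 <= \sum_o q v o * zeta o ^+ 2.
  by case: (hq v) => q0 _; apply: sumr_ge0 => o _; rewrite mulr_ge0 ?sqr_ge0.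
have Kr : K <= r by rewrite lerDl sumr_ge0.
have r0 : 0 < r by apply: lt_le_trans Kr.
have hr : 1 <= tau ^+ 4 * r by apply: (le_trans hK); rewrite ler_pM2l.
have p1 : p <= 1 by clear -pt ht; lra.
have z2 o : 0 <= zeta o ^+ 2 <= 1.
  rewrite sqr_ge0 /= -[leLHS]real_normK ?num_real //.
  by rewrite expr_le1.
pose m v := \sum_o q v o * zeta o ^+ 2.
have m1 v : m v <= 1.
  case: (hq v) => q0 q1; rewrite /m -q1; apply: ler_sum => o _.
  by rewrite ler_piMr //; case/andP: (z2 o).
pose G c := gpot p p r (csum zeta c).
have G0 c : 0 <= G c by apply: gpot_ge0 => //; exact: ltW.
apply: (@le_trans _ _ (expect q (fun c => G c + p / r *
    \sum_v gslope p r (csum zeta c) * (zeta (c v) ^+ 2 - m v)))).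
  apply: expect_le => // c.
  have s0 : 0 <= csum (fun o => zeta o ^+ 2) c by apply: sumr_ge0 => v _; apply: sqr_ge0.
  have r0' : 0 < K + csum (fun o => zeta o ^+ 2) c by rewrite ltr_wpDr.
  apply: le_trans (gpot_tangent _ p0 p1 r0 r0') _.
  rewrite lerD2l -mulr_sumr sumrB /csum /r /m.
  by rewrite le_eqVlt; apply/orP; left; apply/eqP; ring.
rewrite expectD expectZ expect_sum mulrDl mul1r lerD2l -[leRHS]mulrA.
apply: ler_wpM2l; first by rewrite divr_ge0 // ltW.
rewrite /Pi [80 * tau ^+ 2 * \sum_v _]mulr_sumr mulr_suml; apply: ler_sum => v _.
rewrite -(expect_resample v _ hq) -expectZ.
apply: expect_le => // c.
case: (hq v) => q0 q1.
(* [zeta^2 - m v] has mean 0, so a constant may be subtracted from the slope. Taking its value at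
   [ref v] makes the outcomes equal to the reference vanish. *)
set U := csum zeta c; set b := gslope p r (U - zeta (c v) + ref v).
have -> : \sum_o q v o * (gslope p r (csum zeta (upd c v o)) * (zeta (upd c v o v) ^+ 2 - m v)) =
    \sum_o q v o * ((gslope p r (U - zeta (c v) + zeta o) - b) * (zeta o ^+ 2 - m v)).
  have -> : \sum_o q v o * ((gslope p r (U - zeta (c v) + zeta o) - b) * (zeta o ^+ 2 - m v)) =
    \sum_o q v o * (gslope p r (U - zeta (c v) + zeta o) * (zeta o ^+ 2 - m v))
    - b * (\sum_o q v o * zeta o ^+ 2 - m v * \sum_o q v o).
    rewrite mulrBr !mulr_sumr -!sumrB; apply: eq_bigr => o _; ring.
  rewrite q1 mulr1 /m subrr mulr0 subr0; apply: eq_bigr => o _.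
  by rewrite csum_upd updE eqxx.
rewrite [80 * tau ^+ 2 * \sum_o _]mulr_sumr mulr_suml; apply: ler_sum => o _.
rewrite (_ : 80 * tau ^+ 2 * _ * _ = q v o * (80 * tau ^+ 2 * (zeta o != ref v)%:R * G c)); last by rewrite /G; ring.
apply: ler_wpM2l => //.
have [->|ne] := eqVneq (zeta o) (ref v).
  by rewrite /b subrr mul0r mulr0 mul0r.
have tri (a d : R) : `|a| <= 1 -> `|d| <= 1 -> `|U - a + d - U| <= 2.
  move=> ha hd; rewrite (_ : _ - U = d - a); last by ring.
  by have := ler_normB d a; clear -ha hd; lra.
have da := gslope_diff p0 pt ht hr (tri _ _ (z1 (c v)) (z1 o)).
have db := gslope_diff p0 pt ht hr (tri _ _ (z1 (c v)) (ref1 v)).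
have dab : `|gslope p r (U - zeta (c v) + zeta o) - b| <= 80 * tau ^+ 2 * G c.
  rewrite (_ : _ - b = (gslope p r (U - zeta (c v) + zeta o) - gslope p r U) -
     (b - gslope p r U)); last by ring.
  by apply: le_trans (ler_normB _ _) _; move: da db; rewrite /b /G -/U; clear; lra.
apply: le_trans (ler_norm _) _; rewrite normrM mulr1.
rewrite -[leRHS]mulr1; apply: ler_pM => //.
rewrite ler_norml; have /andP[z20 z21] := z2 o; have := m0 v; have := m1 v; rewrite /m => a1 a2.
by apply/andP; split; clear -z20 z21 a1 a2; lra.
Qed.
End Covariance.

(** * How much variance to trade for scale *)

Section Profiles.
Context {R : realType} {n k : nat}.
Variables (q : 'I_n -> 'I_k -> R) (zeta : 'I_k -> R) (tau p r z mu : R).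
Hypothesis hq : pmf q.
Hypothesis z1 : forall o, `|zeta o| <= 1.
Hypotheses (tau0 : 0 < tau) (htau : 20 * tau <= 1 / 1000).
Hypotheses (p0 : 0 < p) (ptau : p <= tau) (hr : 1 <= tau ^+ 4 * r).
Hypotheses (z0 : 0 <= z) (mu0 : 0 < mu).
Let s := \sum_v var1 q zeta v.
Hypothesis UE : (\sum_v mean1 q zeta v) ^+ 2 = mu * z * r.

(** The parameter [c] adapts to [mu]: 0 for a shrinking bias; the value that makes the scale grow
    exactly by [mu], so that [z] is unchanged, as long as it is at most 3; beyond that [c = 3], the
    rest of [mu] being a stretch, profitable since [z >= 2]. *)
Lemma expect_gpot_drift_profile : (1 + 3 * (s / r) < mu -> 2 <= z) ->
  exists2 kap : R, (kap = 1 \/ kap = 66 / 100) /\ (mu <= 1 -> kap = 1) &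
  expect q (fun c => gpot p p r (csum zeta c)) <=
  expR (p * (32 / 100 * (s / r) - kap * ln mu)) * gprof p p z.
Proof.
move=> hz.
have r0 : 0 < r := eps_gt0 tau0 hr.
have s0 : 0 <= s by apply: sumr_ge0 => v _; exact: var1_ge0.
have pl := ltW p0.
set x1 := s / r.
have x10 : 0 <= x1 by rewrite divr_ge0 // ltW.
have drift c : 0 <= c -> c <= 3 ->
    expect q (fun c' => gpot p p r (csum zeta c')) <=
    expR (p * (32 / 100 * x1 - 66 / 100 * ln (1 + c * x1))) *
    gprof p p (mu / (1 + c * x1) * z).
  move=> c0 c3.
  have [a0 a1 b0] : [/\ 0 <= 66 / 100 :> R, 66 / 100 <= 1 :> R & 0 <= 32 / 100 :> R] by split; lra.
  have hpoly (y : R) : 0 <= y -> y <= 1 ->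
      66 / 100 * c - 32 / 100 + 12 / 1000 <= c - y - (1 + c) * y ^+ 2 + 4 * y ^+ 3.
    move=> y0 y1.
    (* The condition is affine in [c], so its ends 0 and 3 suffice. [384 / 1000] and [774 / 1000]
       approximate the minimisers of the two cubics. *)
    have e0 : 0 <= 308 / 1000 - y - y ^+ 2 + 4 * y ^+ 3.
      have : 0 <= (y - 384 / 1000) ^+ 2 * (4 * y + 2072 / 1000).
        by rewrite mulr_ge0 ?sqr_ge0 //; lra.
      by lra.
    have e3 : 0 <= 308 / 1000 + 102 / 100 - y - 4 * y ^+ 2 + 4 * y ^+ 3.
      have : 0 <= (y - 774 / 1000) ^+ 2 * (4 * y + 2192 / 1000).
        by rewrite mulr_ge0 ?sqr_ge0 //; lra.
      by lra.
    have h0 : 0 <= (3 - c) * (308 / 1000 - y - y ^+ 2 + 4 * y ^+ 3).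
      by apply: mulr_ge0 => //; lra.
    have h3 := mulr_ge0 c0 e3.
    by lra.
  have := @expect_gpot_drift R n k q zeta tau p r hq z1 tau0 htau p0 ptau hr
    (66 / 100) (32 / 100) c c0 c3 a0 a1 b0 hpoly.
  rewrite -/s.
  have c1 : 0 < 1 + c * x1 by rewrite ltr_wpDr // mulr_ge0.
  have -> : r + c * s = r * (1 + c * x1) by rewrite /x1; field; rewrite gt_eqF.
  rewrite gpotE ?mulr_gt0 // UE (lnM r0 c1).
  have -> : mu * z * r / (r * (1 + c * x1)) = mu / (1 + c * x1) * z.
    by field; rewrite !gt_eqF.
  rewrite (_ : - (p * (66 / 100) * (ln r + ln (1 + c * x1))) =
    - (p * (66 / 100) * ln r) + - (p * (66 / 100) * ln (1 + c * x1))); last by ring.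
  rewrite expRD expectZ; set A := expR (- (p * (66 / 100) * ln r)) => h.
  rewrite -(ler_pM2l (expR_gt0 (- (p * (66 / 100) * ln r)))) -/A.
  apply: (le_trans h); rewrite le_eqVlt; apply/orP; left; apply/eqP.
  rewrite (_ : p * (32 / 100 * x1 - _) = p * (32 / 100) * s / r + - (p * (66 / 100) * ln (1 + c * x1))).
    by rewrite expRD; ring.
  by rewrite /x1; ring.
have [m1|m1] := leP mu 1.
  exists 1; first by split=> //; left.
  apply: le_trans (drift 0 _ _) _ => //.
  rewrite mul0r addr0 ln1 mulr0 subr0 divr1.
  apply: le_trans (ler_wpM2l (expR_ge0 _) (gprof_shrink pl z0 mu0 m1)) _.
  rewrite mulrA -expRD le_eqVlt; apply/orP; left; apply/eqP.
  by congr (expR _ * _); ring.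
exists (66 / 100); first by split=> //; right.
have [m3|m3] := leP mu (1 + 3 * x1).
  have x1p : 0 < x1 by move: (m1) (m3); lra.
  have := drift ((mu - 1) / x1); rewrite divfK ?gt_eqF // subrKC divff ?gt_eqF // mul1r.
  apply; first by rewrite divr_ge0 // subr_ge0 ltW.
  by rewrite ler_pdivrMr //; move: (m3); lra.
have c1 : 0 < 1 + 3 * x1 by rewrite ltr_wpDr // mulr_ge0.
apply: le_trans (drift 3 _ _) _ => //.
have a0 : 0 <= 66 / 100 :> R by lra.
have a1 : 66 / 100 <= 1 :> R by lra.
have az : 66 / 100 * (1 + z) <= z by have := hz m3; lra.
have mm : 1 <= mu / (1 + 3 * x1) by rewrite ler_pdivlMr // mul1r ltW.
apply: le_trans (ler_wpM2l (expR_ge0 _) (gprof_stretch pl a0 a1 az z0 mm)) _.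
rewrite mulrA -expRD le_eqVlt; apply/orP; left; apply/eqP.
by congr (expR _ * _); rewrite ln_div ?posrE //; ring.
Qed.

(** For a large bias: the noise costs only the coefficient, damped by [1 / (1 + mu z)], so a stretch
    keeps nine tenths of its full value. *)
Lemma expect_gpot_noise_profile : (1 < mu -> 9 <= z) ->
  exists2 kap : R, kap = 1 \/ kap = 9 / 10 &
  expect q (fun c => gpot p p r (csum zeta c)) <=
  expR (p * (2 * (expR (6 * (s / r)) - 1) / (1 + mu * z) - kap * ln mu)) * gprof p p z.
Proof.
move=> hz.
have r0 : 0 < r := eps_gt0 tau0 hr.
have s0 : 0 <= s by apply: sumr_ge0 => v _; exact: var1_ge0.
have pl := ltW p0.
have mz : 0 <= mu * z by rewrite mulr_ge0 // ltW.
have h := @expect_gpot_noise R n k q zeta tau p r hq z1 tau0 htau p0 ptau hr.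
rewrite -/s gpotE // UE mulfK ?gt_eqF // in h.
have x10 : 0 <= 6 * s / r by rewrite divr_ge0 ?mulr_ge0 // ltW.
have e1 : 1 <= expR (6 * s / r) by apply: le_trans (expR_ge1Dx _); rewrite lerDl.
have pB : p <= 2 * p * expR (6 * s / r) - p.
  have := ler_wpM2l pl e1; lra.
have {}h := le_trans h (gprof_coef pl pB mz).
have fin kap : gprof p p (mu * z) <= expR (- (p * kap * ln mu)) * gprof p p z ->
    expect q (fun c => gpot p p r (csum zeta c)) <=
    expR (p * (2 * (expR (6 * (s / r)) - 1) / (1 + mu * z) - kap * ln mu)) * gprof p p z.
  move=> hk; apply: (le_trans h).
  apply: le_trans (ler_wpM2l (expR_ge0 _) hk) _.
  rewrite [leLHS]mulrA -expRD [6 * (s / r)]mulrA le_eqVlt; apply/orP; left; apply/eqP.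
  by congr (expR _ * _); ring.
have [m1|m1] := leP mu 1.
  by exists 1; [left|apply: fin; rewrite mulr1; exact: gprof_shrink].
exists (9 / 10); first by right.
have a0 : 0 <= 9 / 10 :> R by lra.
have a1 : 9 / 10 <= 1 :> R by lra.
have az : 9 / 10 * (1 + z) <= z by have := hz m1; lra.
by apply: fin; apply: gprof_stretch => //; exact: ltW.
Qed.
End Profiles.

Section TwoScale.
Context {R : realType} {n k : nat}.
Implicit Types (c : config n k) (o i j : 'I_k) (v : 'I_n).
Local Notation alpha := (@alpha R n k).
Local Notation gamma := (@gamma R n k).
Local Notation N := (n%:R : R).

Lemma csum_bias_sqr i j c : (0 < n)%N -> i != j ->
  csum (fun o => (bias i j o : R) ^+ 2) c = N * (alpha c i + alpha c j).
Proof.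
move=> n0 ij; rewrite mulrDr -!count_alpha // -big_split /=.
by apply: eq_bigr => v _; rewrite bias_sqr.
Qed.

Lemma sum_bias_sqr_kernel tau i j c : (0 < n)%N -> i != j -> fallback tau ->
  \sum_v \sum_o kernel tau c v o * (bias i j o : R) ^+ 2 =
  N * (alpha c i * (1 + alpha c i - gamma c) + alpha c j * (1 + alpha c j - gamma c)).
Proof.
move=> n0 ij ft; rewrite mulrDr -!(sum_kernel _ _ n0 ft) -big_split /=.
apply: eq_bigr => v _; rewrite -(sum_ind_eq _ i) -(sum_ind_eq _ j) -big_split /=.
by apply: eq_bigr => o _; rewrite bias_sqr // mulrDr.
Qed.

(* A vertex keeping its opinion does not change the scale: measured from the
   current opinions, only the switching vertices matter. *)
Lemma two_scale_changes i j c (K : R)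
    (r := K + N * (alpha c i * (1 + alpha c i - gamma c) + alpha c j * (1 + alpha c j - gamma c))) :
  (0 < n)%N -> i != j -> 0 <= K ->
  exists2 ref : 'I_n -> R, (forall v, `|ref v| <= 1) &
  \sum_v \sum_o kernel tau_two c v o * (bias i j o != ref v)%:R <=
  2 * r * (gamma c + (alpha c i + alpha c j)).
Proof.
move=> n0 ij K0.
have N0 : 0 < N by rewrite ltr0n.
have ft := fallback_two (R := R) (k := k) n0.
have hq := kernel_pmf c n0 ft.
have g0 := gamma_ge0 (R := R) c; have g1 := gamma_le1 (R := R) c n0.
have x0 := alpha_ge0 (R := R) c i; have y0 := alpha_ge0 (R := R) c j.
have sE := sum_bias_sqr_kernel c n0 ij ft.
have Sg := pair_sqr_le_gamma (R := R) c ij.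
have v1 := pair_alpha_le1 (R := R) c n0 ij.
move: (x0) (y0) (sE) (Sg) (v1); rewrite /r.
set x := alpha c i; set y := alpha c j; set g := gamma c in g0 g1 *.
move=> {}x0 {}y0 {}sE {}Sg {}v1.
set m := x * _ + y * _ in sE *.
have m0 : 0 <= m by rewrite addr_ge0 // mulr_ge0 //; clear -x0 y0 g1; lra.
have v0 : 0 <= x + y by rewrite addr_ge0.
(* For [g >= 1 / 2] the target is at least [r], and reference 0 merely counts the vertices that end
   in [i] or [j], on average [N * m <= r]. *)
have [gh|gh] := leP (1 / 2) g.
  exists (fun=> 0); first by move=> v; rewrite normr0.
  rewrite (_ : \sum_v _ = N * m); last first.
    rewrite -sE; apply: eq_bigr => v _; apply: eq_bigr => o _; congr (_ * _).
    rewrite /bias; have [oi|_] := eqVneq o i.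
      by rewrite oi (negbTE ij) subr0 oner_eq0 expr1n.
    by have [_|_] := eqVneq o j; rewrite ?sub0r ?subrr ?oppr_eq0 ?oner_eq0 ?sqrrN ?expr1n ?eqxx ?expr0n.
  have Nm := mulr_ge0 (ltW N0) m0.
  apply: (@le_trans _ _ ((K + N * m) * 1)); first by rewrite mulr1 lerDr.
  rewrite mulrAC [2 * _ * _]mulrC; apply: ler_wpM2l; first exact: addr_ge0.
  by clear -gh v0; lra.
exists (fun v => bias i j (c v)); first by move=> v; exact: bias_le1.
have key v : \sum_o kernel tau_two c v o * (bias i j o != bias i j (c v) :> R)%:R <=
    \sum_o alpha c o ^+ 2 * (bias i j o : R) ^+ 2 + g * (bias i j (c v)) ^+ 2.
  rewrite /g /Defs.gamma mulr_suml -big_split /=; apply: ler_sum => o _.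
  rewrite /kernel /tau_two; have [->|ne] := eqVneq (c v) o.
    by rewrite eqxx mulr0 addr_ge0 // mulr_ge0 // sqr_ge0.
  rewrite mulr0 addr0 -mulrDr; apply: ler_wpM2l; first exact: sqr_ge0.
  have sq01 o' : (bias i j o' != 0 :> R)%:R <= (bias i j o' : R) ^+ 2.
    rewrite /bias; have [oi|_] := eqVneq o' i.
      by rewrite oi (negbTE ij) subr0 oner_eq0 expr1n.
    by have [_|_] := eqVneq o' j; rewrite ?sub0r ?subrr ?oppr_eq0 ?oner_eq0 ?sqrrN ?expr1n ?eqxx ?expr0n.
  have [e|d] := eqVneq (bias i j o : R) (bias i j (c v)).
    by rewrite addr_ge0 // sqr_ge0.
  have [e|e] := eqVneq (bias i j o : R) 0.
    rewrite e in d; apply: le_trans (lerD (sqr_ge0 _) (sq01 _)).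
    by rewrite add0r eq_sym d.
  by have := sq01 o; rewrite e => h; rewrite -[leLHS]addr0; apply: lerD => //; exact: sqr_ge0.
apply: le_trans (ler_sum _ (fun v _ => key v)) _.
rewrite big_split /= sumr_const card_ord -mulr_sumr -[\sum_v bias _ _ _ ^+ 2]/(csum (fun o => (bias i j o : R) ^+ 2) c).
rewrite csum_bias_sqr // -/x -/y.
rewrite (_ : \sum_o _ = x ^+ 2 + y ^+ 2); last first.
  rewrite -(sum_ind_eq (fun o => alpha c o ^+ 2) i) -(sum_ind_eq (fun o => alpha c o ^+ 2) j) -big_split /=.
  by apply: eq_bigr => o _; rewrite bias_sqr // mulrDr.
rewrite -mulr_natl.
have m2 : (x + y) / 2 <= m.
  have h1 := mulr_ge0 v0 (_ : 0 <= 1 / 2 - g).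
  have := sqr_ge0 x; have := sqr_ge0 y; have := h1 ltac:(clear -gh; lra).
  by rewrite /m; clear; lra.
have h1 : 0 <= N * (m - (x + y) / 2) * (g + (x + y)).
  by rewrite mulr_ge0 ?addr_ge0 // mulr_ge0 ?subr_ge0 // ltW.
have h2 : 0 <= K * (g + (x + y)) by rewrite mulr_ge0 ?addr_ge0.
have h3 : 0 <= N * (x * y) by apply: mulr_ge0; [exact: ltW|exact: mulr_ge0].
by clear -h1 h2 h3; lra.
Qed.

(** The covariance cost [80 tau^2] per expected change, with at most [2 r (g + x + y)] changes, is a
    thousandth of the drift available. *)
Lemma expect_two_scale (p tau K : R) i j c
    (r := K + N * (alpha c i * (1 + alpha c i - gamma c) + alpha c j * (1 + alpha c j - gamma c))) :
  (0 < n)%N -> i != j -> 0 < tau -> 20 * tau <= 1 / 1000 -> 0 < p -> p <= tau ->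
  1 <= tau ^+ 4 * K ->
  expect (kernel tau_two c)
    (fun c' => gpot p p (K + csum (fun o => (bias i j o : R) ^+ 2) c') (csum (bias i j) c')) <=
  expR (p * ((gamma c + (alpha c i + alpha c j)) / 1000)) *
  expect (kernel tau_two c) (fun c' => gpot p p r (csum (bias i j) c')).
Proof.
move=> n0 ij t0 ht p0 pt hK.
have t4 : 0 < tau ^+ 4 by rewrite exprn_gt0.
have K0 : 0 < K by rewrite -(pmulr_rgt0 _ t4); apply: lt_le_trans hK.
have ft := fallback_two (R := R) (k := k) n0.
have hq := kernel_pmf c n0 ft.
have [ref ref1 hPi] := two_scale_changes c n0 ij (ltW K0).
have := expect_gpot_scale hq (bias_le1 (R := R) i j) ref1 p0 pt ht hK.
rewrite sum_bias_sqr_kernel // -/r in hPi * => h.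
apply: (le_trans h).
have g0 := gamma_ge0 (R := R) c; have g1 := gamma_le1 (R := R) c n0.
have x0 := alpha_ge0 (R := R) c i; have y0 := alpha_ge0 (R := R) c j.
have r0 : 0 < r.
  rewrite /r ltr_wpDr //; apply: mulr_ge0 => //.
  by rewrite addr_ge0 // mulr_ge0 //; move: x0 y0 g1; clear; lra.
apply: ler_wpM2r.
  by apply: expect_ge0 => // c'; apply: gpot_ge0 => //; exact: ltW.
apply: le_trans (expR_ge1Dx _) _; rewrite ler_expR.
rewrite -mulrA; apply: ler_wpM2l; first exact: ltW.
rewrite mulrC ler_pdivrMr //.
set G := gamma c + _ in hPi *.
have G0 : 0 <= G by rewrite /G !addr_ge0.
have t2 : 0 <= tau ^+ 2 by rewrite sqr_ge0.
apply: le_trans (ler_wpM2l _ hPi) _; first by rewrite mulr_ge0.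
have t3 : tau ^+ 2 * 160 <= 1 / 1000.
  have h1 : tau <= 1 / 1000 by move: ht t0; clear; lra.
  rewrite expr2; have := ler_pM (ltW t0) (ltW t0) h1 h1; clear; lra.
have := ler_wpM2r (mulr_ge0 (ltW r0) G0) t3; clear; lra.
Qed.
End TwoScale.

Section TwoEstimates.
Context {R : realType}.
Implicit Types (x y g v w t p tau K N : R).

Lemma ln_mix_le v g sg w : 0 < v -> v <= 2 * sg -> 0 <= g -> g <= 1 -> g <= 10 * v ->
  0 <= w -> w <= 1 -> ln (1 + w * (sg - g)) <= ln (1 + sg - g) + 20 * (1 - w) * g.
Proof.
move=> v0 vs g0 g1 gv w0 w1.
(* Since [sg >= v / 2 >= g / 20] and [g <= 1]; this is where 20 in the conclusion comes from. *)
have t0 : 1 / 20 <= 1 + sg - g by lra.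
have t1 : 0 < 1 + sg - g by lra.
have w2 : 0 <= 1 - w by lra.
have wg : 0 <= 20 * (1 - w) * g by apply: mulr_ge0 => //; exact: mulr_ge0.
have [h|h] := leP g sg.
  rewrite -[leLHS]addr0; apply: lerD => //.
  rewrite -addrA.
  have e : w * (sg - g) <= sg - g by rewrite ler_piMl // subr_ge0.
  have e0 : 0 <= w * (sg - g) by rewrite mulr_ge0 // subr_ge0.
  by rewrite ler_ln ?posrE ?ltr_wpDr ?subr_ge0 // lerD2l.
pose d := (1 - w) * (g - sg) / (1 + sg - g).
have d0 : 0 <= d.
  apply: divr_ge0; last exact: ltW.
  by apply: mulr_ge0 => //; rewrite subr_ge0 ltW.
have -> : 1 + w * (sg - g) = (1 + sg - g) * (1 + d) by rewrite /d; field; rewrite gt_eqF.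
have d1 : 0 < 1 + d by rewrite ltr_wpDr.
rewrite (lnM t1 d1) lerD2l.
apply: le_trans (le_ln1Dx _) _; first by apply: lt_le_trans d0; rewrite ltrN10.
rewrite /d ler_pdivrMr //.
have h1 : (1 - w) * (g - sg) <= (1 - w) * g by apply: ler_wpM2l => //; lra.
have h2 := ler_wpM2l (mulr_ge0 w2 g0) t0.
by lra.
Qed.

Lemma ln_slow_small x g N K : 0 < N -> 0 < K -> 0 < x -> 0 <= g -> g <= 1 ->
  ln (1 + x - g) - ln (1 + N * x / (N * x + K) * (x - g)) <= K / N.
Proof.
move=> N0 K0 x0 g0 g1.
have Nx : 0 < N * x by rewrite mulr_gt0.
have r0 : 0 < N * x + K by rewrite addr_gt0.
set w := _ / _.
have w0 : 0 <= w by rewrite divr_ge0 // ltW.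
have w1 : w <= 1 by rewrite ler_pdivrMr // mul1r lerDl ltW.
have t1 : -1 < x - g by lra.
rewrite -addrA; apply: le_trans (ln_slow_le w0 w1 t1) _.
apply: (@le_trans _ _ ((1 - w) * x)).
  apply: ler_wpM2l; first by rewrite subr_ge0.
  by rewrite ge_max; apply/andP; split; lra.
have -> : (1 - w) * x = K * x / (N * x + K) by rewrite /w; field; rewrite gt_eqF.
rewrite ler_pdivrMr // mulrAC ler_pdivlMr //.
have := mulr_gt0 K0 K0; lra.
Qed.

(** The range up to 12 covers six times the variance over the scale; [100^4] is a crude bound for
    [exp 12], outweighed by the size of [K] in [scale_large]. *)
Lemma expR_noise_le t : 0 <= t -> t <= 12 -> expR t - 1 <= t * 100 ^+ 4.
Proof.
move=> t0 t12.
have h1 : 1 - t <= expR (- t) by apply: expR_ge1Dx.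
have h2 : expR t <= 100 ^+ 4.
  have e2 : expR (1 / 2) <= 2 :> R by apply: le_trans (expR_le_quad _) _; lra.
  have e3 : expR 3 <= 100 :> R.
    have -> : 3 = 6 * (1 / 2) :> R by lra.
    rewrite expRM_natl.
    apply: (@le_trans _ _ (2 ^+ 6)); last by lra.
    by apply: lerXn2r => //; rewrite nnegrE ?expR_ge0.
  apply: (@le_trans _ _ (expR (4 * 3))); first by rewrite ler_expR; lra.
  by rewrite expRM_natl; apply: lerXn2r => //; rewrite nnegrE ?expR_ge0.
apply: (@le_trans _ _ (t * expR t)); last exact: ler_wpM2l.
have := ler_wpM2r (expR_ge0 t) h1; rewrite -expRD addNr expR0; lra.
Qed.

Lemma scale_large tau K : 0 < tau -> 20 * tau <= 1 / 1000 -> 1 <= tau ^+ 4 * K ->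
  1000 * (1000 * 100 ^+ 4) <= K.
Proof.
move=> t0 ht hK.
have t4 : 0 < tau ^+ 4 by rewrite exprn_gt0.
rewrite -(ler_pM2l t4); apply: le_trans hK.
have -> : tau ^+ 4 * (1000 * (1000 * 100 ^+ 4)) = (1000 * (100 * tau) ^+ 2) ^+ 2 by ring.
rewrite expr_le1 //; last by rewrite mulr_ge0 ?sqr_ge0.
have h : 100 * tau <= 1 / 100 by lra.
have h0 : 0 <= 100 * tau by rewrite mulr_ge0 // ltW.
have := ler_pM h0 h0 h h; rewrite -expr2.
move: ((100 * tau) ^+ 2) => a; lra.
Qed.
End TwoEstimates.

Section TwoContraction.
Context {R : realType} {n k : nat}.
Implicit Types (c : config n k) (i j : 'I_k).
Local Notation alpha := (@alpha R n k).
Local Notation gamma := (@gamma R n k).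
Local Notation N := (n%:R : R).

Definition two_gpot (p K : R) i j c : R :=
  gpot p p (K + csum (fun o => (bias i j o : R) ^+ 2) c) (csum (bias i j) c).

(** The squared mean bias grows by [P^2] and the mean scale by [rho], so [z] is multiplied by
    [mu = P^2 / rho]. A pair light against [g] has [mu <= 1]; a near tie trades variance for scale;
    a clear bias has [z >= 9] and needs only the noise bound. The inequality is stated for twice the
    logarithm of the potential, whence [74 / 100] and the unit coefficient of [T]. *)
Lemma two_gpot_bound (p tau K : R) i j c (x := alpha c i) (y := alpha c j)
    (g := gamma c) (r := N * (x + y) + K) (z := N ^+ 2 * (x - y) ^+ 2 / r)
    (slow := fun a => ln (1 + a - g) - ln (1 + N * a / (N * a + K) * (a - g))) :
  (0 < n)%N -> i != j -> 0 < tau -> 20 * tau <= 1 / 1000 -> 0 < p -> p <= tau ->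
  1 <= tau ^+ 4 * K -> 1000 * (1000 * K) <= N * g -> 0 < x -> 0 < y ->
  exists2 T, expect (kernel tau_two c) (two_gpot p K i j) <= expR (p * T) * gprof p p z &
    74 / 100 * (ln (1 + x - g) + ln (1 + y - g)) + 1 / 2 * (slow x + slow y) + T
      <= - (1 / 200) * g.
Proof.
move=> n0 ij t0 ht p0 pt hK Ng x0 y0.
have N0 : 0 < N by rewrite ltr0n.
have ft := fallback_two (R := R) (k := k) n0.
have hq := kernel_pmf c n0 ft.
have g0 : 0 <= g by apply: gamma_ge0.
have g1 : g <= 1 by apply: gamma_le1.
have v1 : x + y <= 1 by apply: pair_alpha_le1.
have Sg : x ^+ 2 + y ^+ 2 <= g by apply: pair_sqr_le_gamma.
have cost := expect_two_scale c n0 ij t0 ht p0 pt hK.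
have sE := sum_var_two (R := R) c n0 ij.
have UE := sum_mean_bias c i j n0 ft.
rewrite -/x -/y -/g in cost sE UE.
have Kbig := scale_large t0 ht hK.
have K1 : 1 <= K by move: Kbig; clear; lra.
have K0 : 0 < K by apply: lt_le_trans Kbig; rewrite !mulr_gt0.
have v0 : 0 < x + y by rewrite addr_gt0.
move: cost sE UE; set r0 := K + N * _; set s := \sum_v var1 _ _ _; set U := \sum_v mean1 _ _ _.
move=> cost; cbv zeta => sE UE.
pose v := x + y; pose P := 1 + v - g; pose S := x ^+ 2 + y ^+ 2; pose sg := S / v.
have SE : S = sg * v by rewrite /sg divfK // gt_eqF.
have vS : v ^+ 2 <= 2 * S by rewrite /v /S; have := sqr_ge0 (x - y); clear; lra.
have vsg : v <= 2 * sg by rewrite -(ler_pM2r v0) -mulrA -SE -expr2.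
have Sv : S <= v ^+ 2.
  by have := mulr_ge0 (ltW x0) (ltW y0); rewrite /v /S; clear; lra.
have sgv : sg <= v by rewrite -(ler_pM2r v0) -SE -expr2.
have vp : 0 < v := v0.
have sg0 : 0 <= sg by clear -vsg vp; lra.
have V0 : 0 < N * v by rewrite mulr_gt0.
have r00 : 0 < r by rewrite addr_gt0.
have r0E : r0 = r + N * (S - g * v) by rewrite /r0 /r /S /v; ring.
pose w := N * v / r.
have w0 : 0 <= w by rewrite divr_ge0 // ltW.
have w1 : w <= 1 by rewrite ler_pdivrMr // mul1r lerDl ltW.
pose rho := 1 + w * (sg - g).
have rhoE : r0 = r * rho by rewrite r0E SE /rho /w; field; rewrite gt_eqF.
have P0 : 0 < P by rewrite /P; clear -g1 v0; rewrite /v; lra.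
have r0p : 0 < r0.
  rewrite /r0 ltr_pwDl // mulr_ge0 ?(ltW N0) // addr_ge0 // mulr_ge0 ?(ltW x0) ?(ltW y0) //;
  by move: (g1) (x0) (y0); clear; lra.
have rho0 : 0 < rho by rewrite -(pmulr_rgt0 _ r00) -rhoE.
pose mu := P ^+ 2 / rho.
have mu0 : 0 < mu by rewrite divr_gt0 ?exprn_gt0.
have lmu : ln mu = 2 * ln P - ln rho.
  by rewrite ln_div ?posrE ?exprn_gt0 // lnXn // mulr_natl.
have z0 : 0 <= z.
  by apply: divr_ge0; [apply: mulr_ge0; exact: sqr_ge0|exact: ltW].
have UU : U ^+ 2 = mu * z * r0.
  by rewrite UE rhoE /mu /z /P /v; field; rewrite !gt_eqF.
have s0 : 0 <= s.
  by apply: sumr_ge0 => u _; apply: var1_ge0 => //; exact: bias_le1.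
have hr0 : 1 <= tau ^+ 4 * r0.
  apply: (le_trans hK); rewrite ler_pM2l ?exprn_gt0 // /r0 lerDl mulr_ge0 ?(ltW N0) //.
  by rewrite addr_ge0 // mulr_ge0 ?(ltW x0) ?(ltW y0) //; move: (g1) (x0) (y0); clear; lra.
have x1le : s / r0 <= g + sg.
  rewrite ler_pdivrMr //.
  apply: (@le_trans _ _ (N * (S + v * (g * (1 - g))))).
    rewrite sE; apply: ler_wpM2l; first exact: ltW.
    rewrite -/S -/v gerBl; apply: mulr_ge0; first by rewrite mulr_ge0 ?sqr_ge0 ?ltW.
    by clear -g1 v0; rewrite /v; lra.
  rewrite r0E /r SE -/v.
  have h1 : 0 <= (g + sg) * K.
    by apply: mulr_ge0; [exact: addr_ge0|exact: ltW].
  have h2 : 0 <= N * v * sg ^+ 2 by rewrite mulr_ge0 ?sqr_ge0 // ltW.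
  by clear -h1 h2; lra.
(* From here on the scale is frozen at its mean [r0], at the price of [(g + v) / 1000]. *)
suff [T0 ET HT] : exists2 T0, expect (kernel tau_two c) (fun c' => gpot p p r0 (csum (bias i j) c'))
      <= expR (p * T0) * gprof p p z &
    74 / 100 * (ln (1 + x - g) + ln (1 + y - g)) + 1 / 2 * (slow x + slow y) + T0
      <= - (1 / 200) * g - (g + v) / 1000.
  exists ((g + v) / 1000 + T0); last by move: HT; clear; lra.
  apply: (le_trans cost); rewrite mulrDr expRD -mulrA.
  by apply: ler_wpM2l => //; exact: expR_ge0.
have drift := expect_gpot_drift_profile hq (bias_le1 i j) t0 ht p0 pt hr0 z0 mu0 UU.
have noise := expect_gpot_noise_profile hq (bias_le1 i j) t0 ht p0 pt hr0 z0 mu0 UU.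
rewrite -/s in drift noise.
have frac a : 0 < a -> a <= v -> 0 <= N * a / (N * a + K) <= w.
  move=> a0 av; have Na : 0 < N * a by rewrite mulr_gt0.
  apply/andP; split; first by apply: divr_ge0; rewrite ltW // addr_gt0.
  rewrite /w /r -/v ler_pdivrMr ?addr_gt0 // mulrAC ler_pdivlMr ?addr_gt0 //.
  have : N * a * K <= N * v * K by rewrite ler_pM2r // ler_pM2l.
  by clear; lra.
have [gv|gv] := leP (10 * v) g.
  have /andP[wx0 wx1] := frac x x0 ltac:(by rewrite lerDl ltW).
  have /andP[wy0 wy1] := frac y y0 ltac:(by rewrite lerDr ltW).
  have [Pr HL] := two_ineq_light x0 y0 v1 g1 gv w0 w1 wx0 wx1 wy0 wy1 (erefl rho).
  have m1 : mu <= 1 by rewrite ler_pdivrMr // mul1r.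
  have [|kap [_ /(_ m1) ->] Ek] := drift.
    move=> h; have := lt_le_trans h m1.
    by rewrite gtrDl ltNge mulr_ge0 // divr_ge0 // ltW.
  eexists; first exact: Ek.
  rewrite lmu; move: HL x1le gv; rewrite /slow /sg /S /v; clear -g0; lra.
have Vbig : 100 * (1000 * K) <= N * v.
  have := ler_wpM2l (ltW N0) (ltW gv); move: Ng K0; clear; lra.
have KN : K / N <= g / 1000 / 1000.
  by rewrite ler_pdivrMr //; move: Ng; clear; lra.
have sx : slow x <= K / N := ln_slow_small N0 K0 x0 g0 g1.
have sy : slow y <= K / N := ln_slow_small N0 K0 y0 g0 g1.
have w1e : (1 - w) * (100 * 1000) <= 1.
  have -> : 1 - w = K / r by rewrite /w /r /v; field; rewrite gt_eqF.
  by rewrite mulrAC ler_pdivrMr // /r -/v; move: Vbig K0; clear; lra.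
have lrho : ln rho <= ln (1 + sg - g) + g / 1000.
  apply: le_trans (ln_mix_le vp vsg g0 g1 (ltW gv) w0 w1) _; rewrite lerD2l.
  by have := ler_wpM2r g0 w1e; move: g0; clear; lra.
have fin T0 kap : 0 <= kap -> kap <= 1 ->
    74 / 100 * (ln (1 + x - g) + ln (1 + y - g)) + T0 + kap * (ln (1 + sg - g) - 2 * ln P)
      <= - (1 / 100) * (g + v) ->
    74 / 100 * (ln (1 + x - g) + ln (1 + y - g)) + 1 / 2 * (slow x + slow y) + (T0 - kap * ln mu)
      <= - (1 / 200) * g - (g + v) / 1000 - (g + v) / 1000.
  move=> k0 k1; rewrite lmu.
  have h1 := ler_wpM2l k0 lrho.
  have h2 : kap * (g / 1000) <= g / 1000 by rewrite ler_piMl // divr_ge0.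
  by move: sx sy KN h1 h2 g0 vp; clear; lra.
have [tie|far] := leP (16 * (x - y) ^+ 2) (v ^+ 2).
  have [|kap [kE _] Ek] := drift.
    (* With [z < 2], [two_tie_noise] says that three variances keep up with the drift, against
       [hmu]. *)
    move=> hmu; rewrite leNgt; apply/negP => z2.
    have hN : N ^+ 2 * (x - y) ^+ 2 <= 2 * (N * (x + y) + K).
      by rewrite -/r -ler_pdivrMr // ltW.
    have := two_tie_noise N0 K1 x0 y0 v1 Sg g1 (ltW gv) Ng hN.
    rewrite -sE -/r -/v -/P -/S -r0E; apply/negP; rewrite -ltNge.
    move: hmu; rewrite /mu ltr_pdivlMr // => hmu.
    have := hmu; rewrite -(ltr_pM2l r00) => {}hmu.
    apply: le_lt_trans hmu; rewrite mulrCA -rhoE le_eqVlt; apply/orP; left; apply/eqP.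
    by field; rewrite gt_eqF.
  exists (32 / 100 * (s / r0) - kap * ln mu) => //.
  have k01 : 0 <= kap <= 1 by case: kE => ->; rewrite ?ler01 ?lexx // divr_ge0 //= ler_pdivrMr // mul1r ler_nat.
  case/andP: k01 => k0 k1.
  have H := two_ineq_tie x0 y0 v1 Sg g1 tie kE.
  rewrite -/sg -/P in H.
  have H' : 74 / 100 * (ln (1 + x - g) + ln (1 + y - g)) + 32 / 100 * (s / r0) +
      kap * (ln (1 + sg - g) - 2 * ln P) <= - (1 / 100) * (g + v).
    by move: H x1le; rewrite -/v; clear; lra.
  by have := fin _ _ k0 k1 H'; move: g0 vp; clear; lra.
(* A clear bias gives [z >= (N v)^2 / (16 r)], and [N * v] is so large against [K] that [r] is
   nearly [N * v]. *)
have z9 : 9 <= z.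
  rewrite /z -/v in r00 *; rewrite ler_pdivlMr //.
  have h1 : (N * v) ^+ 2 <= 16 * (N ^+ 2 * (x - y) ^+ 2).
    rewrite exprMn [leRHS]mulrCA; apply: ler_wpM2l; first exact: sqr_ge0.
    exact: ltW.
  have h2 : 1000 * (N * v) <= (N * v) ^+ 2.
    rewrite expr2; apply: ler_wpM2r; first exact: ltW.
    by move: Vbig K1; clear; lra.
  by rewrite /r -/v; move: Vbig K0 V0 h1 h2; clear; lra.
have [//|kap kE Ek] := noise.
set extra := 2 * _ / _ in Ek.
have ex : extra <= (g + v) / 1000.
  have G0 : 0 <= g + v by rewrite addr_ge0 // ltW.
  (* This denominator makes the noise negligible, because [K] exceeds the constant of
     [expR_noise_le] by a factor of a million. *)
  have muz : 100 * K <= mu * z.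
    have PE : 1 + x + y - g = P by rewrite /P /v; ring.
    rewrite -(ler_pM2r r0p) -UU UE PE.
    pose A := N * v * P.
    have A1 : 100 * (100 * K) <= A.
      have P1 : 1 / 10 <= P by rewrite /P; move: gv g1; clear; lra.
      apply: le_trans (ler_wpM2l (ltW V0) P1); move: Vbig; clear; lra.
    have A0 : 0 <= A by apply: le_trans A1; rewrite !mulr_ge0 // ltW.
    have r2 : r0 <= 2 * A.
      have : 0 <= N * (x * y) by apply: mulr_ge0; [exact: ltW|apply: mulr_ge0; exact: ltW].
      by move: A1 K0; rewrite /r0 /A /P /v; clear; lra.
    have AU : A ^+ 2 <= 16 * (N * ((x - y) * P)) ^+ 2.
      have -> : A ^+ 2 = v ^+ 2 * (N * P) ^+ 2 by rewrite /A; ring.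
      have -> : 16 * (N * ((x - y) * P)) ^+ 2 = 16 * (x - y) ^+ 2 * (N * P) ^+ 2 by ring.
      by apply: ler_wpM2r; [exact: sqr_ge0|exact: ltW].
    have e1 : 100 * K * r0 <= 100 * K * (2 * A) by apply: ler_wpM2l => //; rewrite mulr_ge0 // ltW.
    have e2 : 100 * (100 * K) * A <= A ^+ 2 by rewrite expr2; apply: ler_wpM2r.
    have e3 : 0 <= K * A by rewrite mulr_ge0 // ltW.
    apply: (le_trans e1).
    rewrite -(ler_pM2l (ltr0n R 16)); apply: le_trans AU; apply: le_trans e2.
    by move: e3; clear; lra.
  have x120 : 0 <= 6 * (s / r0) by rewrite mulr_ge0 // divr_ge0 // ltW.
  have x12 : 6 * (s / r0) <= 12 by move: x1le g1 sgv v1; rewrite -/v; clear; lra.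
  have nz : 0 < 1 + mu * z by rewrite ltr_wpDr // mulr_ge0 // ltW.
  rewrite /extra ler_pdivrMr //.
  have := expR_noise_le x120 x12; set e := expR _ => he.
  set Q := 100 ^+ 4 in he Kbig.
  have Q0 : 0 <= Q by rewrite exprn_ge0.
  have f1 : (s / r0) * Q <= (g + v) * Q.
    by apply: ler_wpM2r => //; apply: le_trans x1le _; rewrite lerD2l.
  have f2 : (g + v) * (1000 * (1000 * Q)) <= (g + v) * K by apply: ler_wpM2l.
  have f3 : (g + v) * (100 * K) <= (g + v) * (mu * z) by apply: ler_wpM2l.
  have f4 : 0 <= (g + v) * Q by rewrite mulr_ge0.
  by move: he f1 f2 f3 f4 G0; clear; lra.
have k01 : 0 <= kap <= 1 by case: kE => ->; rewrite ?ler01 ?lexx // divr_ge0 //= ler_pdivrMr // mul1r ler_nat.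
case/andP: k01 => k0 k1.
exists (extra - kap * ln mu) => //.
have H := two_ineq_far x0 y0 v1 Sg g1 (ltW far) kE.
rewrite -/sg -/P -/v in H.
have H' : 74 / 100 * (ln (1 + x - g) + ln (1 + y - g)) + 0 +
      kap * (ln (1 + sg - g) - 2 * ln P) <= - (1 / 100) * (g + v).
  by rewrite addr0.
by have := fin _ _ k0 k1 H'; move: ex; clear; lra.
Qed.

(** The constant [K] keeps the scale large when few vertices hold the pair, so that no single vertex
    changes the bias factor much. It also keeps the scale of a light pair from decaying along with
    the bias; the two saturation factors, of total exponent [p / 2] equal to that of the bias
    factor, compensate exactly this. *)
Definition two_pot (p K : R) i j c : R :=
  if (0 < alpha c i) && (0 < alpha c j) then
    expR (p * (37 / 100) * (ln (alpha c i) + ln (alpha c j))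
          + p / 4 * (ln (N * alpha c i / (N * alpha c i + K))
                     + ln (N * alpha c j / (N * alpha c j + K)))
          + 1 / 2 * ln (two_gpot p K i j c))
  else 0.

(** Jensen's inequality: saturation is concave in the density and lies below its tangent, of slope
    [b], at the mean [x']. *)
Lemma expect_saturation tau c i (K : R) (x := alpha c i) (x' := x * (1 + x - gamma c)) :
  (0 < n)%N -> fallback tau -> 0 < K -> 0 <= x' ->
  expect (kernel tau c) (fun c' => N * alpha c' i / (N * alpha c' i + K)) <=
  N * x' / (N * x' + K).
Proof.
move=> n0 ft K0 x0.
have N0 : 0 < N by rewrite ltr0n.
have hq := kernel_pmf c n0 ft.
have d0 (a : R) : 0 <= a -> 0 < N * a + K by move=> a0; rewrite ltr_wpDl // mulr_ge0 // ltW.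
set m := N * x' / _; pose b := K * N / (N * x' + K) ^+ 2.
apply: (@le_trans _ _ (expect (kernel tau c) (fun c' => (m - b * x') + b * alpha c' i))).
  apply: expect_le => // c'; set a := alpha c' i.
  have a0 : 0 <= a by apply: alpha_ge0.
  rewrite -subr_ge0.
  have -> : m - b * x' + b * a - N * a / (N * a + K) =
      K * (N * (a - x')) ^+ 2 / ((N * x' + K) ^+ 2 * (N * a + K)).
    by rewrite /m /b; field; rewrite !gt_eqF ?d0.
  by apply: divr_ge0; apply: mulr_ge0; rewrite ?sqr_ge0 // ltW // d0.
by rewrite expectD expect_cst // expectZ expect_alpha // subrK.
Qed.

Lemma two_contraction (p tau K : R) i j c :
  (0 < n)%N -> i != j -> 0 < tau -> 20 * tau <= 1 / 1000 -> 0 < p -> p <= tau ->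
  1 <= tau ^+ 4 * K -> 1000 * (1000 * K) <= N * gamma c ->
  expect (kernel tau_two c) (two_pot p K i j) <=
  expR (- (p / 400 * gamma c)) * two_pot p K i j c.
Proof.
move=> n0 ij t0 ht p0 pt hK Ng.
have N0 : 0 < N by rewrite ltr0n.
have ft := fallback_two (R := R) (k := k) n0.
have hq := kernel_pmf c n0 ft.
have K0 : 0 < K.
  by rewrite -(pmulr_rgt0 _ (exprn_gt0 4 t0)); apply: lt_le_trans hK.
have [x0|x0] := ltP 0 (alpha c i); last first.
  rewrite (@expect_extinct R n k tau_two c i) ?{1}/two_pot //; last first.
  - by move=> c' ->; rewrite /two_pot ltxx.
  - by apply/eqP; rewrite eq_le x0 alpha_ge0.
  - by rewrite /two_pot ltNge x0 /= mulr0.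
have [y0|y0] := ltP 0 (alpha c j); last first.
  rewrite (@expect_extinct R n k tau_two c j) ?{1}/two_pot //; last first.
  - by move=> c' h; rewrite /two_pot h ltxx andbF.
  - by apply/eqP; rewrite eq_le y0 alpha_ge0.
  - by rewrite /two_pot [X in _ && X]ltNge y0 /= andbF mulr0.
have [T ET HT] := two_gpot_bound n0 ij t0 ht p0 pt hK Ng x0 y0.
set x := alpha c i in x0 ET HT *; set y := alpha c j in y0 ET HT *.
set g := gamma c in HT *.
set r := N * (x + y) + K in ET *; set z := _ / r in ET.
have g1 : g <= 1 by apply: gamma_le1.
have r0 : 0 < r by rewrite addr_gt0 ?mulr_gt0 ?addr_gt0.
have z0 : 0 <= z.
  by apply: divr_ge0; [apply: mulr_ge0; exact: sqr_ge0|exact: ltW].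
have G0 : 0 < gprof p p z by rewrite gprof_gt0 // ltW.
have e0 c' : 0 < K + csum (fun o => (bias i j o : R) ^+ 2) c'.
  by rewrite ltr_wpDr // sumr_ge0 // => v _; exact: sqr_ge0.
have gp0 c' : 0 < two_gpot p K i j c'.
  by rewrite /two_gpot gpotE // gprof_gt0 ?(ltW p0) // divr_ge0 ?sqr_ge0 // ltW.
have gpc : two_gpot p K i j c = gprof p p z.
  rewrite /two_gpot gpotE // csum_bias // csum_bias_sqr // -/x -/y.
  by rewrite [K + _]addrC -/r exprMn.
have x1 : 0 < 1 + x - g by clear -g1 x0; lra.
have y1 : 0 < 1 + y - g by clear -g1 y0; lra.
have d0 (a : R) : 0 < a -> 0 < N * a / (N * a + K).
  by move=> a0; rewrite divr_gt0 ?addr_gt0 ?mulr_gt0.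
have x1p := mulr_gt0 x0 x1; have y1p := mulr_gt0 y0 y1.
have d0' c' l : 0 <= N * alpha c' l / (N * alpha c' l + K).
  have a0 := alpha_ge0 (R := R) c' l.
  have Na : 0 <= N * alpha c' l by rewrite mulr_ge0 // ltW.
  by rewrite divr_ge0 // addr_ge0 // ltW.
pose w := nth (0 : R) [:: p * (37 / 100); p * (37 / 100); p / 4; p / 4; 1 / 2].
pose sat (a : R) := N * a / (N * a + K).
pose M := nth (0 : R) [:: x * (1 + x - g); y * (1 + y - g);
  sat (x * (1 + x - g)); sat (y * (1 + y - g)); expR (p * T) * gprof p p z].
pose f c' := nth (0 : R) [:: alpha c' i; alpha c' j;
  sat (alpha c' i); sat (alpha c' j); two_gpot p K i j c'].
apply: le_trans (@expect_slots R n k _ 'I_5 w M (fun l c' => f c' l) _ hq _ _ _ _ _ _) _.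
- by case=> [[|[|[|[|[|]]]]]] //= _; rewrite /w /=; clear -p0; lra.
- by rewrite !big_ord_recl big_ord0 /w /=; clear -p0 pt ht t0; lra.
- by case=> [[|[|[|[|[|]]]]]] //= _; rewrite /M /= ?d0 // mulr_gt0 ?expR_gt0.
- case=> [[|[|[|[|[|]]]]]] //= _; rewrite /M /f /=.
  + by rewrite expect_alpha.
  + by rewrite expect_alpha.
  + by apply: expect_saturation => //; exact: ltW.
  + by apply: expect_saturation => //; exact: ltW.
- by case=> [[|[|[|[|[|]]]]]] //= _ c'; rewrite /f /= ?alpha_ge0 ?d0' // ltW.
- move=> c'; rewrite /two_pot; case: ifP => [/andP[xx yy]|_]; [right|by left].
  split; first by case=> [[|[|[|[|[|]]]]]] //= _; rewrite /f /= ?d0.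
  by rewrite !big_ord_recl big_ord0 /w /f /=; congr expR; rewrite /sat; ring.
rewrite /two_pot -/x -/y x0 y0 /= gpc -expRD ler_expR -!/(sat _).
rewrite !big_ord_recl big_ord0 /w /M /=.
(* The logarithmic growth of a saturation factor is the quantity called [slow] in
   [two_gpot_bound]. *)
have satE a b : 0 < a -> 0 < 1 + a - g -> b = 1 + a - g ->
   ln (sat (a * b)) = ln (sat a) + (ln (1 + a - g) - ln (1 + N * a / (N * a + K) * (a - g))).
  move=> a0 a1 ->.
  have h1 : 0 < N * a + K by rewrite addr_gt0 ?mulr_gt0.
  have h2 : 0 < N * (a * (1 + a - g)) + K by rewrite addr_gt0 ?mulr_gt0.
  have -> : 1 + N * a / (N * a + K) * (a - g) = (N * (a * (1 + a - g)) + K) / (N * a + K).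
    by field; rewrite gt_eqF.
  rewrite -ln_div ?posrE ?divr_gt0 // -lnM ?posrE ?divr_gt0 ?mulr_gt0 //.
  by congr ln; rewrite /sat; field; rewrite !gt_eqF.
rewrite (satE x _ x0 x1 erefl) (satE y _ y0 y1 erefl) [ln (x * _)]lnM ?posrE // [ln (y * _)]lnM ?posrE //.
rewrite [ln (_ * gprof _ _ _)]lnM ?posrE ?expR_gt0 // expRK.
have := ler_wpM2l (ltW p0) HT.
move: (ln x) (ln y) (ln (sat x)) (ln (sat y)) (ln (1 + x - g)) (ln (1 + y - g)) (ln (gprof _ _ _)) => a b a' b' d e f'.
move: (ln _) (ln _) => l1 l2.
by clear; lra.
Qed.
End TwoContraction.

(** * The lower tail of gamma *)

Section ExpMoment.
Context {R : realType} {n k : nat}.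

(** A Bernstein bound: the variance still to come is put into the exponent to obtain a
    supermartingale. [4 * t <= 1] keeps [- t * eta], with [|eta| <= 2], in the range of
    [expR_le_quad]. *)
Lemma expect_expR_csum (q : 'I_n -> 'I_k -> R) (zeta : 'I_k -> R) (t : R) :
  pmf q -> (forall o, `|zeta o| <= 1) -> 0 <= t -> 4 * t <= 1 ->
  expect q (fun c => expR (- (t * csum zeta c))) <=
  expR (- (t * \sum_v mean1 q zeta v) + 2 * t ^+ 2 * \sum_v var1 q zeta v).
Proof.
move=> hq z1 t0 t4.
pose f j c := expR (- (t * partial q zeta j c) + 2 * t ^+ 2 * future (var1 q zeta) j).
have f0 : expect q (f 0%N) = expR (- (t * \sum_v mean1 q zeta v) + 2 * t ^+ 2 * \sum_v var1 q zeta v).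
  rewrite -[RHS](expect_cst _ hq); apply: eq_expect => c.
  by rewrite /f partial0 future0.
rewrite -f0 (@eq_expect R n k q _ (f n)); last first.
  by move=> c; rewrite /f partialn futuren mulr0 addr0.
apply: expect_expose => // v c.
have [w0 w1 wm wb] := centered_coord v hq z1.
set eta := fun o => zeta o - mean1 q zeta v in w0 w1 wm wb.
set A := expR (- (t * partial q zeta v c) + 2 * t ^+ 2 * future (var1 q zeta) v.+1).
have fE : f v c = A * expR (2 * t ^+ 2 * var1 q zeta v).
  by rewrite /f /A futureS -expRD; congr expR; ring.
rewrite fE.
apply: (@le_trans _ _ (\sum_o q v o * (A * (1 - t * eta o + 2 * t ^+ 2 * eta o ^+ 2)))).
  apply: ler_sum => o _; apply: ler_wpM2l; first exact: w0.
  rewrite /f partialS -/(eta o).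
  have -> : - (t * (partial q zeta v c + eta o)) + 2 * t ^+ 2 * future (var1 q zeta) v.+1 =
    (- (t * partial q zeta v c) + 2 * t ^+ 2 * future (var1 q zeta) v.+1) + (- (t * eta o)) by ring.
  rewrite expRD; apply: ler_wpM2l; first exact: expR_ge0.
  apply: le_trans (expR_le_quad _) _; last by rewrite le_eqVlt; apply/orP; left; apply/eqP; ring.
  have [e1 _] : -2 <= eta o /\ eta o <= 2 by have := wb o; rewrite ler_norml => /andP[].
  by have := ler_wpM2l t0 e1; move: t4; move: (eta o) => e; clear; lra.
have -> : \sum_o q v o * (A * (1 - t * eta o + 2 * t ^+ 2 * eta o ^+ 2)) =
    A * (\sum_o q v o - t * (\sum_o q v o * eta o) + 2 * t ^+ 2 * var1 q zeta v).
  rewrite /var1 /variance !mulr_sumr -sumrB -big_split /= mulr_sumr.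
  by apply: eq_bigr => o _; rewrite /eta; ring.
rewrite w1 wm mulr0 subr0; apply: ler_wpM2l; first exact: expR_ge0.
exact: expR_ge1Dx.
Qed.
End ExpMoment.

Section Gamma.
Context {R : realType} {n k : nat}.
Implicit Types (c : config n k) (o i j : 'I_k) (v : 'I_n).
Local Notation alpha := (@alpha R n k).
Local Notation gamma := (@gamma R n k).
Local Notation N := (n%:R : R).

Definition next_mean c o : R := alpha c o * (1 + alpha c o - gamma c).

Lemma sqr_le_gamma c o : alpha c o ^+ 2 <= gamma c.
Proof. by rewrite /Defs.gamma (bigD1 o) //= lerDl sumr_ge0 // => i _; exact: sqr_ge0. Qed.

Lemma next_mean_ge0 c o : (0 < n)%N -> 0 <= next_mean c o.
Proof.
move=> n0; have g1 := gamma_le1 (R := R) c n0; have a0 := alpha_ge0 (R := R) c o.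
by apply: mulr_ge0 => //; move: g1 a0; clear; lra.
Qed.

Lemma next_mean_le1 c o : (0 < n)%N -> next_mean c o <= 1.
Proof.
move=> n0; have a0 := alpha_ge0 (R := R) c o; have a1 := alpha_le1 (R := R) c o n0.
have h := ler_wpM2l a0 (sqr_le_gamma c o).
have h2 : 0 <= (1 - alpha c o) ^+ 2 * (1 + alpha c o).
  by apply: mulr_ge0; [exact: sqr_ge0|exact: addr_ge0].
by rewrite /next_mean; move: h h2; clear; lra.
Qed.

Lemma next_mean_le c o : (0 < n)%N -> next_mean c o <= 2 * alpha c o.
Proof.
move=> n0; have a0 := alpha_ge0 (R := R) c o; have a1 := alpha_le1 (R := R) c o n0.
have g0 := gamma_ge0 (R := R) c.
rewrite /next_mean mulrC; apply: ler_wpM2r => //.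
by move: a1 g0; clear; lra.
Qed.

(** The variance of the density of an opinion drawn according to the densities, whose mean is gamma,
    is nonnegative. *)
Lemma sum_cube_ge c : (0 < n)%N -> gamma c ^+ 2 <= \sum_o alpha c o ^+ 3.
Proof.
move=> n0; rewrite -subr_ge0.
have -> : \sum_o alpha c o ^+ 3 - gamma c ^+ 2 = \sum_o alpha c o * (alpha c o - gamma c) ^+ 2.
  have gen (g : R) : \sum_o alpha c o * (alpha c o - g) ^+ 2 =
    \sum_o alpha c o ^+ 3 - 2 * g * (\sum_o alpha c o ^+ 2) + g ^+ 2 * \sum_o alpha c o.
    by rewrite !mulr_sumr -sumrB -big_split; apply: eq_bigr => o _ /=; ring.
  by rewrite gen sum_alpha // -/(gamma c); ring.
by apply: sumr_ge0 => o _; apply: mulr_ge0; [exact: alpha_ge0|exact: sqr_ge0].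
Qed.

(** After expansion the loss [- 2 gamma^2] is covered by twice the sum of cubes, and a sum of
    squares remains. *)
Lemma next_mean_sqr_ge c : (0 < n)%N -> gamma c <= \sum_o next_mean c o ^+ 2.
Proof.
move=> n0.
have -> : \sum_o next_mean c o ^+ 2 = (1 - 2 * gamma c) * gamma c + 2 * \sum_o alpha c o ^+ 3
    + \sum_o alpha c o ^+ 2 * (alpha c o - gamma c) ^+ 2.
  have gen (g : R) : \sum_o (alpha c o * (1 + alpha c o - g)) ^+ 2 =
    (1 - 2 * g) * (\sum_o alpha c o ^+ 2) + 2 * \sum_o alpha c o ^+ 3
      + \sum_o alpha c o ^+ 2 * (alpha c o - g) ^+ 2.
    by rewrite !mulr_sumr -!big_split; apply: eq_bigr => o _ /=; ring.
  exact: gen.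
have h1 := sum_cube_ge c n0.
have : 0 <= \sum_o alpha c o ^+ 2 * (alpha c o - gamma c) ^+ 2.
  by apply: sumr_ge0 => o _; apply: mulr_ge0; exact: sqr_ge0.
by move: h1; clear; move: (gamma c) => g; lra.
Qed.

Lemma csum_alpha c (f : 'I_k -> R) : (0 < n)%N -> csum f c = N * \sum_o alpha c o * f o.
Proof.
move=> n0; rewrite /csum mulr_sumr.
rewrite (eq_bigr (fun v => \sum_o (c v == o)%:R * f o)); last by move=> v _; rewrite sum_eq_opinion.
rewrite exchange_big /=; apply: eq_bigr => o _.
by rewrite -mulr_suml count_alpha // mulrA.
Qed.

Lemma sum_kernel_mean tau c (f : 'I_k -> R) : (0 < n)%N -> fallback tau ->
  \sum_v mean1 (kernel tau c) f v = N * \sum_o next_mean c o * f o.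
Proof.
move=> n0 ft; rewrite /mean1 exchange_big mulr_sumr; apply: eq_bigr => o _ /=.
by rewrite -mulr_suml sum_kernel // -mulrA.
Qed.

(* [gamma] is convex, so it lies above its tangent at the mean of the next
   round, where it is at least its present value. *)
Lemma expect_expR_gamma tau c (lam nu : R) : (0 < n)%N -> fallback tau ->
  0 <= lam -> 8 * lam <= N ->
  \sum_v var1 (kernel tau c) (next_mean c) v <= N * nu ->
  expect (kernel tau c) (fun c' => expR (- (lam * gamma c'))) <=
  expR (- (lam * gamma c) + 8 * lam ^+ 2 * nu / N).
Proof.
move=> n0 ft l0 l8 hv.
have N0 : 0 < N by rewrite ltr0n.
have hq := kernel_pmf c n0 ft.
have pi1 o : `|next_mean c o| <= 1.
  by rewrite ger0_norm ?next_mean_le1 ?next_mean_ge0.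
pose t := 2 * lam / N.
have t0 : 0 <= t by rewrite /t divr_ge0 ?mulr_ge0 // ltW.
have t4 : 4 * t <= 1 by rewrite /t mulrA ler_pdivrMr //; move: l8; clear; lra.
set m := \sum_o next_mean c o ^+ 2.
have hm : gamma c <= m := next_mean_sqr_ge c n0.
apply: (@le_trans _ _ (expect (kernel tau c) (fun c' => expR (lam * m) * expR (- (t * csum (next_mean c) c'))))).
  apply: expect_le => // c'; rewrite -expRD ler_expR csum_alpha //.
  have -> : lam * m + - (t * (N * \sum_o alpha c' o * next_mean c o)) =
     - (lam * (2 * (\sum_o alpha c' o * next_mean c o) - m)).
    by rewrite /t; field; rewrite gt_eqF.
  rewrite lerN2; apply: ler_wpM2l => //.
  have : 0 <= \sum_o (alpha c' o - next_mean c o) ^+ 2 by apply: sumr_ge0 => o _; exact: sqr_ge0.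
  have -> : \sum_o (alpha c' o - next_mean c o) ^+ 2 =
     gamma c' - 2 * (\sum_o alpha c' o * next_mean c o) + m.
    rewrite /Defs.gamma /m mulr_sumr -sumrB -big_split /=.
    by apply: eq_bigr => o _; ring.
  by clear; lra.
rewrite expectZ.
apply: le_trans (ler_wpM2l (expR_ge0 _) (expect_expR_csum hq pi1 t0 t4)) _.
rewrite -expRD ler_expR sum_kernel_mean // -/m.
have -> : t * (N * \sum_o next_mean c o * next_mean c o) = 2 * lam * m.
  by rewrite /t /m; under eq_bigr do rewrite -expr2; field; rewrite gt_eqF.
have h1 : 2 * t ^+ 2 * (\sum_v var1 (kernel tau c) (next_mean c) v) <= 2 * t ^+ 2 * (N * nu).
  by apply: ler_wpM2l => //; rewrite mulr_ge0 ?sqr_ge0.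
have h2 : 2 * t ^+ 2 * (N * nu) = 8 * lam ^+ 2 * nu / N.
  by rewrite /t; field; rewrite gt_eqF.
have := ler_wpM2l l0 hm; rewrite h2 in h1; move: h1; clear; lra.
Qed.

Lemma variance_le_about (q : 'I_n -> 'I_k -> R) (zeta : 'I_k -> R) v (b : R) :
  pmf q -> var1 q zeta v <= \sum_o q v o * (zeta o - b) ^+ 2.
Proof.
move=> hq; have [_ q1] := hq v; set m := mean1 q zeta v.
have -> : \sum_o q v o * (zeta o - b) ^+ 2 = var1 q zeta v + (m - b) ^+ 2.
  have e : \sum_o q v o * (zeta o - b) ^+ 2 =
    var1 q zeta v + 2 * (m - b) * (\sum_o q v o * zeta o - m * \sum_o q v o) + (m - b) ^+ 2 * \sum_o q v o.
    rewrite /var1 /variance -/m mulrBr !mulr_sumr -sumrB -!big_split /=.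
    by apply: eq_bigr => o _; ring.
  by rewrite e q1 -/(mean1 q zeta v) -/m; ring.
by rewrite lerDl sqr_ge0.
Qed.

Lemma sum_cube_le c : (0 < n)%N -> \sum_o alpha c o ^+ 3 <= gamma c.
Proof.
move=> n0; apply: ler_sum => o _; rewrite exprS ler_piMl ?sqr_ge0 //.
exact: alpha_le1.
Qed.

Lemma next_mean_sqr_le c o : (0 < n)%N -> next_mean c o ^+ 2 <= 4 * alpha c o ^+ 2.
Proof.
move=> n0; have := next_mean_le c o n0; have := next_mean_ge0 c o n0 => a b.
by have := ler_pM a a b b; rewrite -!expr2 exprMn; clear; lra.
Qed.

Lemma var_next_maj c : (0 < n)%N ->
  \sum_v var1 (kernel tau_maj c) (next_mean c) v <= N * (8 * gamma c).
Proof.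
move=> n0.
have ft := fallback_maj (R := R) (k := k) n0.
have hq := kernel_pmf c n0 ft.
have N0 : 0 < N by rewrite ltr0n.
apply: (@le_trans _ _ (\sum_v mean1 (kernel tau_maj c) (fun o => next_mean c o ^+ 2) v)).
  apply: ler_sum => v _; apply: le_trans (variance_le_about _ _ 0 hq) _.
  by apply: ler_sum => o _; rewrite subr0.
rewrite sum_kernel_mean //; apply: ler_wpM2l; first exact: ltW.
apply: (@le_trans _ _ (8 * \sum_o alpha c o ^+ 3)); last first.
  by apply: ler_wpM2l => //; exact: sum_cube_le.
rewrite mulr_sumr; apply: ler_sum => o _.
have a := next_mean_le c o n0; have b := next_mean_sqr_le c o n0.
have := ler_pM (next_mean_ge0 c o n0) (sqr_ge0 _) a b; clear; lra.
Qed.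

(** Centred at the value of its present opinion, a vertex that keeps it contributes nothing.
    Switching to [o] has probability [alpha o ^+ 2], which gives gamma squared where 3-Majority has
    only gamma; hence the weaker threshold for 2-Choices. *)
Lemma var_next_two c : (0 < n)%N ->
  \sum_v var1 (kernel tau_two c) (next_mean c) v <= N * (16 * gamma c ^+ 2).
Proof.
move=> n0.
have ft := fallback_two (R := R) (k := k) n0.
have hq := kernel_pmf c n0 ft.
have N0 : 0 < N by rewrite ltr0n.
have g0 := gamma_ge0 (R := R) c.
apply: (@le_trans _ _ (\sum_v (8 * gamma c ^+ 2 + 8 * gamma c * alpha c (c v) ^+ 2))).
  apply: ler_sum => v _; apply: le_trans (variance_le_about _ _ (next_mean c (c v)) hq) _.
  rewrite [X in _ <= X + _](_ : _ = \sum_o alpha c o ^+ 2 * (8 * gamma c)); last first.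
    by rewrite -mulr_suml -/(gamma c); ring.
  rewrite (_ : 8 * gamma c * _ = \sum_o alpha c o ^+ 2 * (8 * alpha c (c v) ^+ 2)); last first.
    by rewrite -mulr_suml -/(gamma c); ring.
  rewrite -big_split /=; apply: ler_sum => o _; rewrite /kernel /tau_two.
  have [->|ne] := eqVneq (c v) o.
    rewrite subrr expr0n mulr0 -mulrDr; apply: mulr_ge0; first exact: sqr_ge0.
    by apply: addr_ge0; rewrite mulr_ge0 ?sqr_ge0.
  rewrite mulr0 addr0 -mulrDr; apply: ler_wpM2l; first exact: sqr_ge0.
  have a := next_mean_sqr_le c o n0; have b := next_mean_sqr_le c (c v) n0.
  have d := sqr_le_gamma c o; have e := sqr_ge0 (next_mean c o + next_mean c (c v)).
  by move: a b d e; clear; lra.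
rewrite big_split /= sumr_const card_ord -mulr_natl -mulr_sumr.
rewrite [\sum_v alpha c (c v) ^+ 2](csum_alpha c (fun o => alpha c o ^+ 2) n0).
have -> : \sum_o alpha c o * alpha c o ^+ 2 = \sum_o alpha c o ^+ 3.
  by apply: eq_bigr => o _; rewrite -exprS.
have h := sum_cube_le c n0.
have := ler_wpM2l (mulr_ge0 (ltW N0) g0) h; clear; lra.
Qed.
End Gamma.

(** * The probability of avoiding consensus *)

Section Paths.
Context {R : realType} {X : finType}.
Variables (P : X -> X -> R) (a : X -> R).

Definition path_weight T c0 (p : {ffun 'I_T.+1 -> X}) : R :=
  (p ord0 == c0)%:R * \prod_(t < T) P (p (inord t)) (p (inord t.+1)).

(** For [a] the indicator of a set and [P] stochastic, the probability that the states at times 0 to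
    [T] all lie in the set, by first-step decomposition. *)
Fixpoint avoid T c : R :=
  a c * (if T is T'.+1 then \sum_c' P c c' * avoid T' c' else 1).

Definition path_cons T (xp : X * {ffun 'I_T.+1 -> X}) : {ffun 'I_T.+2 -> X} :=
  [ffun t => if unlift ord0 t is Some s then xp.2 s else xp.1].

Lemma path_cons0 T x (p : {ffun 'I_T.+1 -> X}) : path_cons (x, p) ord0 = x.
Proof. by rewrite ffunE unlift_none. Qed.

Lemma path_consS T x (p : {ffun 'I_T.+1 -> X}) t : path_cons (x, p) (lift ord0 t) = p t.
Proof. by rewrite ffunE liftK. Qed.

Lemma path_cons_bij T : bijective (@path_cons T).
Proof.
exists (fun p : {ffun 'I_T.+2 -> X} => (p ord0, [ffun t => p (lift ord0 t)])).
  case=> x p; rewrite path_cons0; congr (_, _).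
  by apply/ffunP => t; rewrite ffunE path_consS.
move=> p; apply/ffunP => t; rewrite ffunE.
by case: unliftP => [s|] -> //=; rewrite ffunE.
Qed.

Lemma inord_lift T t : (t <= T)%N -> inord t.+1 = lift ord0 (inord t : 'I_T.+1).
Proof. by move=> tT; apply: val_inj; rewrite /= inordK // /bump /= inordK. Qed.

Lemma sum_paths T c0 : \sum_(p : {ffun 'I_T.+1 -> X}) path_weight c0 p * \prod_t a (p t) = avoid T c0.
Proof.
elim: T c0 => [|T IH] c0.
  rewrite (reindex (fun x : X => [ffun=> x] : {ffun 'I_1 -> X})) /=; last first.
    exists (fun p : {ffun 'I_1 -> X} => p ord0) => [x|p] _; first by rewrite ffunE.
    by apply/ffunP => t; rewrite ffunE (ord1 t).
  rewrite (bigD1 c0) //= [X in _ + X]big1 ?addr0.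
    by rewrite /path_weight big_ord0 big_ord1 !ffunE eqxx !mulr1 mul1r.
  by move=> x /negbTE xc; rewrite /path_weight ffunE xc !mul0r.
rewrite (reindex (@path_cons T)) /=; last exact/onW_bij/path_cons_bij.
rewrite -(pair_bigA _ (fun x p => path_weight c0 (path_cons (x, p)) * \prod_t a (path_cons (x, p) t))) /=.
rewrite (bigD1 c0) //= [X in _ + X]big1 ?addr0; last first.
  by move=> x /negbTE xc; apply: big1 => p _; rewrite /path_weight path_cons0 xc !mul0r.
rewrite mulr_sumr.
under [RHS]eq_bigr do rewrite -IH mulr_sumr mulr_sumr.
rewrite exchange_big /=; apply: eq_bigr => p _.
rewrite (bigD1 (p ord0)) //= [X in _ = _ + X]big1 ?addr0; last first.
  move=> x xp; rewrite /path_weight eq_sym (negbTE xp) !mul0r !mulr0.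
  by [].
rewrite /path_weight path_cons0 !eqxx !mul1r big_ord_recl [\prod_(t < T.+2) _]big_ord_recl path_cons0.
have -> : inord 0 = ord0 :> 'I_T.+2 by apply: val_inj; rewrite /= inordK.
rewrite path_cons0 (inord_lift (leq0n T)) path_consS.
have -> : inord 0 = ord0 :> 'I_T.+1 by apply: val_inj; rewrite /= inordK.
under [\prod_(i < T) P (path_cons _ _) _]eq_bigr => t _.
  rewrite /= (inord_lift (ltnW (ltn_ord t))) (inord_lift (ltn_ord t)) !path_consS; over.
under [\prod_(i < T.+1) a (path_cons _ _)]eq_bigr do rewrite path_consS.
by rewrite mulrACA [_ * a c0]mulrC -!mulrA; congr (_ * _); rewrite mulrCA.
Qed.
End Paths.

Section Avoid.
Context {R : realType} {X : finType}.
Variables (P : X -> X -> R) (a : X -> R).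
Hypothesis P0 : forall c c', 0 <= P c c'.
Hypothesis P1 : forall c, \sum_c' P c c' = 1.
Hypothesis a01 : forall c, 0 <= a c <= 1.

Lemma avoid_ge0 T c : 0 <= avoid P a T c.
Proof.
elim: T c => [|T IH] c /=; have /andP[a0 _] := a01 c; first by rewrite mulr1.
by rewrite mulr_ge0 // sumr_ge0 // => c' _; rewrite mulr_ge0.
Qed.

Lemma avoid_antitone T c : avoid P a T.+1 c <= avoid P a T c.
Proof.
elim: T c => [|T IH] c; have /andP[a0 _] := a01 c; last first.
  by apply: ler_wpM2l => //; apply: ler_sum => c' _; apply: ler_wpM2l => //; exact: IH.
rewrite /=; apply: ler_wpM2l => //.
rewrite -[leRHS](P1 c); apply: ler_sum => c' _.
by rewrite mulr1 ler_piMr //; case/andP: (a01 c').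
Qed.

Lemma avoid_le T T' c : (T <= T')%N -> avoid P a T' c <= avoid P a T c.
Proof.
move=> TT; rewrite -(subnK TT); elim: (T' - T)%N => [|d IH] //.
by rewrite addSn; apply: le_trans IH; exact: avoid_antitone.
Qed.

Lemma avoid_le1 T c : avoid P a T c <= 1.
Proof.
apply: le_trans (avoid_le _ (leq0n T)) _ => /=; rewrite mulr1.
by case/andP: (a01 c).
Qed.
End Avoid.

Section Consensus.
Context {R : realType} {n k : nat}.

Lemma prob_cons_byE (S : finType) (rule : config n k -> 'I_n -> S -> 'I_k) T c0 :
  (forall c, \sum_c' trans R rule c c' = 1) ->
  prob_cons_by R rule c0 T =
  1 - avoid (trans R rule) (fun c => (~~ is_consensus c)%:R) T c0.
Proof.
move=> row1; rewrite /prob_cons_by -sum_paths.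
(* Constant weight 1 in [sum_paths] yields the total mass of the paths. *)
have tot : \sum_(p : {ffun 'I_T.+1 -> config n k}) path_prob R rule c0 p = 1.
  have := sum_paths (trans R rule) (fun=> 1) T c0.
  rewrite (eq_bigr (path_weight (trans R rule) c0)); last by move=> p _; rewrite big1_eq mulr1.
  have av t c : avoid (trans R rule) (fun=> 1) t c = 1.
    elim: t c => [|t IH] c /=; first by rewrite mulr1.
    by rewrite mul1r; under eq_bigr do rewrite IH mulr1.
  by rewrite av.
apply/esym/eqP; rewrite subr_eq; apply/eqP; rewrite -[LHS]tot.
rewrite [LHS](bigID (fun p : {ffun 'I_T.+1 -> config n k} => [exists t, is_consensus (p t)])) /=.
congr (_ + _).
rewrite [RHS](bigID (fun p : {ffun 'I_T.+1 -> config n k} => [exists t, is_consensus (p t)])) /=.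
rewrite [X in _ = X + _]big1 ?add0r; last first.
  by move=> p /existsP[t pt]; rewrite (bigD1 t) //= pt mul0r mulr0.
apply: eq_bigr => p np; rewrite big1 ?mulr1 // => t _.
by move: np; rewrite negb_exists => /forallP/(_ t) ->.
Qed.
End Consensus.

Section ChainBound.
Context {R : realType} {n k : nat}.
Implicit Types (c : config n k) (i j : 'I_k).
Local Notation alpha := (@alpha R n k).
Local Notation gamma := (@gamma R n k).
Local Notation N := (n%:R : R).
Local Notation nc := (fun c => (~~ is_consensus c)%:R : R).

(* While [gamma] stays above [h] the potential [Phi] contracts; the term in
   [expR (- (lam * gamma))] exceeds 1 as soon as [gamma] falls below [h]. *)
Lemma avoid_bound (P : config n k -> config n k -> R) tau (Phi : config n k -> R)
    (h lam kap eps eta M : R) :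
  (0 < n)%N -> fallback tau ->
  (forall c c', P c c' = \prod_v kernel tau c v (c' v)) ->
  (forall c, 0 <= Phi c) -> (forall c, ~~ is_consensus c -> 1 <= M * Phi c) ->
  0 <= M -> 0 <= lam -> 0 <= eps -> 0 <= eta ->
  (forall c, h <= gamma c -> expect (kernel tau c) Phi <= expR (- kap) * Phi c) ->
  (forall c, h <= gamma c -> expect (kernel tau c) (fun c' => expR (- (lam * gamma c'))) <=
     expR eps * expR (- (lam * gamma c)) + eta) ->
  forall T c, avoid P nc T c <= expR (- (kap * T%:R)) * (M * Phi c) +
    expR (lam * h) * (expR (eps * T%:R) * (expR (- (lam * gamma c)) + T%:R * eta)).
Proof.
move=> n0 ft PE Phi0 PhiM M0 lam0 eps0 eta0 HPhi Hgam.
have hq c := kernel_pmf c n0 ft.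
have P0 c c' : 0 <= P c c' by rewrite PE; exact: weight_ge0.
have P1 c : \sum_c' P c c' = 1.
  rewrite -(expect_cst 1 (hq c)) /expect; apply: eq_bigr => c' _.
  by rewrite PE mulr1.
have a01 c : 0 <= nc c <= 1 by case: (is_consensus c); rewrite ?lexx ?ler01.
have W0 T c : 0 <= expR (lam * h) * (expR (eps * T%:R) * (expR (- (lam * gamma c)) + T%:R * eta)).
  by apply: mulr_ge0; rewrite ?expR_ge0 // mulr_ge0 ?expR_ge0 // addr_ge0 ?expR_ge0 // mulr_ge0.
have F0 T c : 0 <= expR (- (kap * T%:R)) * (M * Phi c).
  by rewrite mulr_ge0 ?expR_ge0 // mulr_ge0.
elim=> [|T IH] c.
  rewrite -[leLHS]addr0; apply: lerD => //=; rewrite mulr0 oppr0 expR0 mul1r mulr1.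
  by case E: (is_consensus c) => /=; [rewrite mulr_ge0|rewrite PhiM ?E].
have [hc|hc] := leP h (gamma c); last first.
  apply: le_trans (avoid_le1 P0 P1 a01 T.+1 c) _.
  rewrite -[leLHS]add0r; apply: lerD => //.
  have e1 : 1 <= expR (eps * T.+1%:R).
    by apply: le_trans (expR_ge1Dx _); rewrite lerDl mulr_ge0.
  have e2 : 1 <= expR (lam * h) * expR (- (lam * gamma c)).
    rewrite -expRD; apply: le_trans (expR_ge1Dx _); rewrite lerDl subr_ge0.
    by apply: ler_wpM2l => //; exact: ltW.
  rewrite mulrCA; apply: le_trans (_ : 1 * (expR (lam * h) * expR (- (lam * gamma c))) <= _).
    by rewrite mul1r.
  apply: ler_pM => //; first by rewrite mulr_ge0 ?expR_ge0.
  by apply: ler_wpM2l; rewrite ?expR_ge0 // lerDl mulr_ge0.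
have TS : T.+1%:R = T%:R + 1 :> R by rewrite -[T.+1]addn1 natrD.
rewrite /=; apply: le_trans (_ : \sum_c' P c c' * avoid P nc T c' <= _).
  rewrite ler_piMl //; last by case/andP: (a01 c).
  by apply: sumr_ge0 => c' _; rewrite mulr_ge0 // avoid_ge0.
have -> : \sum_c' P c c' * avoid P nc T c' = expect (kernel tau c) (avoid P nc T).
  by apply: eq_bigr => c' _; rewrite PE.
apply: le_trans (expect_le (hq c) IH) _.
rewrite expectD !expectZ expectD expect_cst //.
apply: lerD.
  have := HPhi c hc; rewrite TS mulrDr mulr1 opprD expRD => h1.
  rewrite -mulrA; apply: ler_wpM2l; first exact: expR_ge0.
  by rewrite mulrCA; apply: ler_wpM2l.
apply: ler_wpM2l; first exact: expR_ge0.
rewrite TS [eps * (_ + 1)]mulrDr mulr1 expRD -[leRHS]mulrA.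
apply: ler_wpM2l; first exact: expR_ge0.
apply: le_trans (lerD (Hgam c hc) (lexx _)) _.
have e1 : 1 <= expR eps by apply: le_trans (expR_ge1Dx _); rewrite lerDl.
have := ler_wpM2r (mulr_ge0 (ler0n R T.+1) eta0) e1.
by rewrite TS; clear; lra.
Qed.

Lemma nonconsensus_pair c : (0 < n)%N -> ~~ is_consensus c ->
  exists i j, [/\ i != j, N^-1 <= alpha c i & N^-1 <= alpha c j].
Proof.
move=> n0; rewrite negb_exists => /forallP nc.
have pos v : N^-1 <= alpha c (c v).
  rewrite /Defs.alpha -[leLHS]mul1r ler_wpM2r ?invr_ge0 // ler1n card_gt0.
  by apply/set0Pn; exists v; rewrite inE.
have := nc (c (Ordinal n0)); rewrite negb_forall => /existsP[v vn].
by exists (c (Ordinal n0)), (c v); split; rewrite // eq_sym.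
Qed.

Lemma gpot_le2 (p e U : R) : 0 < p -> p <= 1 -> 0 < e -> gpot p p e U <= 2.
Proof.
move=> p0 p1 e0; have /andP[y0 y1] := gpot_frac U e0.
rewrite /gpot -[2]mul1r; apply: ler_pM; rewrite ?expR_ge0 //.
- by rewrite addr_ge0 // mulr_ge0 // ltW.
- by rewrite -expR0 ler_expR mulr_ge0_le0 ?ln_le0 // ltW.
- by have := ler_pM (ltW p0) (ltW y0) p1 y1; rewrite mulr1; clear; lra.
Qed.

Lemma ln_gpot_ge (p e U : R) : (0 < n)%N -> 0 < p -> 1 <= e -> `|U| <= N ->
  - (2 * p * ln (1 + N)) <= ln (gpot p p e U).
Proof.
move=> n0 p0 e1 UN.
have e0 : 0 < e by apply: lt_le_trans e1.
have N0 : 0 < N by rewrite ltr0n.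
have N1 : 0 < 1 + N by rewrite addr_gt0.
have /andP[y0 y1] := gpot_frac U e0.
have h : ((1 + N) ^+ 2)^-1 <= e / (e + U ^+ 2).
  have U2 : U ^+ 2 <= N ^+ 2.
    by rewrite -real_normK ?num_real // lerXn2r // nnegrE ltW.
  have d0 : 0 < e + U ^+ 2 by rewrite ltr_wpDr ?sqr_ge0.
  rewrite -[leLHS]mul1r ler_pdivrMr ?exprn_gt0 // mulrAC ler_pdivlMr // mul1r.
  have h1 := ler_wpM2l (ltW N0) e1.
  have h2 := ler_wpM2r (sqr_ge0 N) e1.
  have h3 := mulr_ge0 (ltW e0) (ltW N0).
  by move: h1 h2 U2 h3; clear; lra.
rewrite /gpot lnM ?posrE ?expR_gt0 //; last first.
  by rewrite ltr_pwDl // mulr_ge0 // ltW.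
rewrite expRK; apply: le_trans (_ : p * ln (e / (e + U ^+ 2)) <= _); last first.
  by rewrite lerDl ln_ge0 // lerDl mulr_ge0 // ltW.
rewrite mulrAC mulrC -mulrN; apply: ler_wpM2l; first exact: ltW.
have := h; rewrite -ler_ln ?posrE ?invr_gt0 ?exprn_gt0 // lnV ?posrE ?exprn_gt0 // lnXn //.
by rewrite mulr_natl.
Qed.

Lemma ln_alpha_ge c i : (0 < n)%N -> N^-1 <= alpha c i -> - ln (1 + N) <= ln (alpha c i).
Proof.
move=> n0 h; have N0 : 0 < N by rewrite ltr0n.
have a0 : 0 < alpha c i by apply: lt_le_trans h; rewrite invr_gt0.
rewrite -lnV ?posrE ?addr_gt0 // ler_ln ?posrE ?invr_gt0 ?addr_gt0 //.
by apply: le_trans h; rewrite lef_pV2 ?posrE ?addr_gt0 // lerDr.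
Qed.

Lemma ln_alpha_le0 c i : (0 < n)%N -> ln (alpha c i) <= 0.
Proof. by move=> n0; apply: ln_le0; exact: alpha_le1. Qed.

Lemma csum_bias_le i j c : `|csum (bias i j) c| <= N :> R.
Proof.
apply: le_trans (ler_norm_sum _ _ _) _.
apply: le_trans (ler_sum _ (fun v _ => bias_le1 i j (c v))) _.
by rewrite sumr_const card_ord.
Qed.

Lemma maj_pot_ge0 (p : R) i j c : 0 <= maj_pot p i j c.
Proof. by rewrite /maj_pot; case: ifP; rewrite ?expR_ge0. Qed.

Lemma maj_pot_le2 (p : R) i j c : (0 < n)%N -> 0 < p -> p <= 1 -> maj_pot p i j c <= 2.
Proof.
move=> n0 p0 p1; rewrite /maj_pot; case: ifP => // _.
have N0 : 0 < N by rewrite ltr0n.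
set G := gpot _ _ _ _.
have G0 : 0 < G by rewrite /G gpotE // gprof_gt0 ?(ltW p0) // divr_ge0 ?sqr_ge0 // ltW.
have G2 : G <= 2 by exact: gpot_le2.
rewrite -[leRHS]lnK ?posrE // ler_expR.
have h1 : ln G <= ln 2 by rewrite ler_ln ?posrE.
have h2 : 0 <= ln 2 :> R by rewrite ln_ge0 // ler1n.
have x0 := ln_alpha_le0 c i n0; have y0 := ln_alpha_le0 c j n0.
have := mulr_ge0_le0 (ltW p0) x0; have := mulr_ge0_le0 (ltW p0) y0.
by move: h1 h2; clear; lra.
Qed.

(** Every factor is at least a power of [1 / (1 + N)] with exponent proportional to [p];
    [p <= 1 / 10] keeps the total exponent below 1. *)
Lemma maj_pot_ge (p : R) i j c : (0 < n)%N -> 0 < p -> p <= 1 / 10 ->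
  N^-1 <= alpha c i -> N^-1 <= alpha c j -> 1 <= (1 + N) * maj_pot p i j c.
Proof.
move=> n0 p0 p1 xi xj.
have N0 : 0 < N by rewrite ltr0n.
have N1 : 0 < 1 + N by rewrite addr_gt0.
have Ni : 0 < N^-1 by rewrite invr_gt0.
rewrite /maj_pot !(lt_le_trans Ni) //= -[1 + N]lnK ?posrE // -expRD.
apply: le_trans (expR_ge1Dx _); rewrite lerDl.
have := ln_alpha_ge n0 xi; have := ln_alpha_ge n0 xj.
have N1' : 1 <= N by rewrite ler1n.
have := ln_gpot_ge n0 p0 N1' (csum_bias_le i j c).
have l0 : 0 <= ln (1 + N) by rewrite ln_ge0 // lerDl ltW.
move: (ln (1 + N)) l0 (ln (alpha c i)) (ln (alpha c j)) (ln (gpot _ _ _ _)) => l l0 a b g hg hb ha.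
have := ler_wpM2l (ltW p0) ha; have := ler_wpM2l (ltW p0) hb.
have := ler_wpM2r l0 p1; move: hg; clear -l0; lra.
Qed.

Lemma two_pot_ge0 (p K : R) i j c : 0 <= two_pot p K i j c.
Proof. by rewrite /two_pot; case: ifP; rewrite ?expR_ge0. Qed.

Lemma two_pot_le2 (p K : R) i j c : (0 < n)%N -> 0 < p -> p <= 1 -> 0 < K ->
  two_pot p K i j c <= 2.
Proof.
move=> n0 p0 p1 K0; rewrite /two_pot; case: ifP => // /andP[xp yp].
have N0 : 0 < N by rewrite ltr0n.
have e0 : 0 < K + csum (fun o => (bias i j o : R) ^+ 2) c.
  by rewrite ltr_wpDr // sumr_ge0 // => v _; exact: sqr_ge0.
have hsat (l : 'I_k) : 0 < alpha c l -> ln (N * alpha c l / (N * alpha c l + K)) <= 0.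
  move=> a0; have d0 : 0 < N * alpha c l + K := addr_gt0 (mulr_gt0 N0 a0) K0.
  by apply: ln_le0; rewrite ler_pdivrMr // mul1r lerDl ltW.
have := hsat _ xp; have := hsat _ yp.
set sx := ln (N * alpha c i / _); set sy := ln (N * alpha c j / _) => sy0 sx0.
set G := two_gpot _ _ _ _ _.
have G0 : 0 < G by rewrite /G /two_gpot gpotE // gprof_gt0 ?(ltW p0) // divr_ge0 ?sqr_ge0 // ltW.
have G2 : G <= 2 by exact: gpot_le2.
rewrite -[leRHS]lnK ?posrE // ler_expR.
have h1 : ln G <= ln 2 by rewrite ler_ln ?posrE.
have h2 : 0 <= ln 2 :> R by rewrite ln_ge0 // ler1n.
have x0 := ln_alpha_le0 c i n0; have y0 := ln_alpha_le0 c j n0.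
have := mulr_ge0_le0 (ltW p0) x0; have := mulr_ge0_le0 (ltW p0) y0.
have := mulr_ge0_le0 (ltW p0) sx0; have := mulr_ge0_le0 (ltW p0) sy0.
by move: h1 h2; clear; lra.
Qed.

Lemma two_pot_ge (p K : R) i j c : (0 < n)%N -> 0 < p -> p <= 1 / 10 ->
  1 <= K -> K <= N ->
  N^-1 <= alpha c i -> N^-1 <= alpha c j -> 1 <= (1 + N) * two_pot p K i j c.
Proof.
move=> n0 p0 p1 K1 KN xi xj.
have N0 : 0 < N by rewrite ltr0n.
have N1 : 0 < 1 + N by rewrite addr_gt0.
have Ni : 0 < N^-1 by rewrite invr_gt0.
have K0 : 0 < K by apply: lt_le_trans K1.
have hsat (l : 'I_k) : N^-1 <= alpha c l -> - ln (1 + N) <= ln (N * alpha c l / (N * alpha c l + K)).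
  move=> al; have a1 : 1 <= N * alpha c l by rewrite mulrC -ler_pdivrMr // mul1r.
  have a0 : 0 < N * alpha c l by apply: lt_le_trans a1.
  have d0 : 0 < N * alpha c l + K by rewrite addr_gt0.
  rewrite -lnV ?posrE // ler_ln ?posrE ?invr_gt0 ?divr_gt0 //.
  rewrite -[leLHS]mul1r ler_pdivrMr // mulrAC ler_pdivlMr // mul1r.
  have := ler_wpM2r (ltW N0) a1; move: KN; clear; lra.
rewrite /two_pot !(lt_le_trans Ni) //= -[1 + N]lnK ?posrE // -expRD.
apply: le_trans (expR_ge1Dx _); rewrite lerDl.
have sx := hsat _ xi; have sy := hsat _ xj.
have := ln_alpha_ge n0 xi; have := ln_alpha_ge n0 xj.
have e1 : 1 <= K + csum (fun o => (bias i j o : R) ^+ 2) c.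
  by rewrite -[leLHS]addr0 lerD // sumr_ge0 // => v _; exact: sqr_ge0.
have := ln_gpot_ge n0 p0 e1 (csum_bias_le i j c).
rewrite -/(two_gpot p K i j c).
have l0 : 0 <= ln (1 + N) by rewrite ln_ge0 // lerDl ltW.
move: (ln (1 + N)) l0 sx sy (ln (alpha c i)) (ln (alpha c j)) (ln (two_gpot _ _ _ _ _)) => l l0.
move: (ln _) (ln _) => s1 s2 h1 h2 a b g hg hb ha.
have := ler_wpM2l (ltW p0) ha; have := ler_wpM2l (ltW p0) hb.
have := ler_wpM2l (ltW p0) h1; have := ler_wpM2l (ltW p0) h2.
have := ler_wpM2r l0 p1; move: hg; clear -l0; lra.
Qed.
End ChainBound.

(** * Choosing the parameters of the tail bound *)

Section Tail.
Context {R : realType} {n k : nat}.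
Implicit Types (c : config n k) (i j : 'I_k).
Local Notation alpha := (@alpha R n k).
Local Notation gamma := (@gamma R n k).
Local Notation N := (n%:R : R).
Local Notation nc := (fun c => (~~ is_consensus c)%:R : R).

(** The rule enters only through its contracting pair potentials and its variance bound [nu]. The
    condition [2 * a * eps <= L] limits the growth of the exponential moment over all rounds to a
    factor [N]. *)
Lemma consensus_tail (P : config n k -> config n k -> R) tau
    (F : 'I_k -> 'I_k -> config n k -> R) (nu : R -> R) (p eps : R) T c0
    (L := ln N) (g0 := gamma c0) (a := 4 * 1000 / p * L / g0) :
  (0 < n)%N -> (k <= n)%N -> fallback tau ->
  (forall c c', P c c' = \prod_v kernel tau c v (c' v)) ->
  1 <= L -> 0 < p -> p <= 1 -> 0 <= eps -> 3 * (1000 * L) <= N * g0 ->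
  (forall i j c, 0 <= F i j c) -> (forall i j c, F i j c <= 2) ->
  (forall i j c, N^-1 <= alpha c i -> N^-1 <= alpha c j -> 1 <= (1 + N) * F i j c) ->
  (forall i j c, i != j -> g0 / 2 <= gamma c ->
     expect (kernel tau c) (F i j) <= expR (- (p / 400 * gamma c)) * F i j c) ->
  (forall c, \sum_v var1 (kernel tau c) (next_mean c) v <= N * nu (gamma c)) ->
  (forall c, nu (gamma c) <= 16 * gamma c) ->
  (forall c, gamma c <= 2 * g0 -> 8 * (4 * L / g0) ^+ 2 * nu (gamma c) / N <= eps) ->
  2 * a * eps <= L -> 2 * a <= N -> a <= T%:R ->
  avoid P nc T c0 <= 6 / N.
Proof.
move=> n0 kn ft PE L1 p0 p1 eps0 LN F0 F2 F1 Fc Hv nu16 Hnu aeps aN aT.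
have N0 : 0 < N by rewrite ltr0n.
have N1 : 1 <= N by rewrite ler1n.
have hq c := kernel_pmf c n0 ft.
have gc1 c : gamma c <= 1 := gamma_le1 c n0.
have L0 : 0 < L by apply: lt_le_trans L1.
have g00 : 0 < g0.
  by rewrite -(pmulr_rgt0 _ N0); apply: lt_le_trans LN; rewrite !mulr_gt0.
have LE : expR L = N by rewrite lnK // posrE.
have P0 c c' : 0 <= P c c' by rewrite PE; exact: weight_ge0.
have P1 c : \sum_c' P c c' = 1.
  rewrite -(expect_cst 1 (hq c)) /expect; apply: eq_bigr => c' _.
  by rewrite PE mulr1.
have a01 c : 0 <= nc c <= 1 by case: (is_consensus c); rewrite ?lexx ?ler01.
have a1 : 1 <= a.
  rewrite /a ler_pdivlMr // mul1r; apply: (le_trans (gc1 c0)).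
  apply: le_trans L1 _; rewrite ler_peMl ?(ltW L0) // ler_pdivlMr // mul1r.
  by apply: (le_trans p1); rewrite mulr_ege1 ?ler1n.
(* Avoidance is antitone in time, so it is bounded at the first time past [a]; a longer horizon
   would spoil the factor [expR (eps * T)]. *)
have [T0 [T0T aT0 T0a]] : exists T0, [/\ (T0 <= T)%N, a <= T0%:R & T0%:R <= 2 * a].
  have ex : exists m : nat, a <= m%:R by exists T.
  have [m am mmin] := ex_minnP ex; exists m; split=> //; first exact: mmin.
  case: m am mmin => [|m] am mmin; first by rewrite mulr_ge0 // (le_trans ler01).
  have : m%:R < a by rewrite ltNge; apply/negP => /mmin; rewrite ltnn.
  by rewrite -[m.+1]addn1 natrD; move: a1; clear; lra.
apply: le_trans (avoid_le P0 P1 a01 c0 T0T) _.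
(* The moment then starts at [N^-4], against [N^2] from the level [g0 / 2] and a growth of at most
   [N], which leaves [1 / N]. *)
pose lam := 4 * L / g0.
have lam0 : 0 <= lam by rewrite divr_ge0 ?mulr_ge0 // ltW.
pose Phi c := \sum_i \sum_(j | j != i) F i j c.
(* Half of [p / 400 * g0], as gamma may drop to [g0 / 2]. Over [a] rounds it gives [N^-5], against
   [1 + N] and at most [2 N^2] for the initial [Phi]. *)
pose kap := p / 800 * g0.
have Phi0 c : 0 <= Phi c by apply: sumr_ge0 => i _; apply: sumr_ge0.
have PhiM c : ~~ is_consensus c -> 1 <= (1 + N) * Phi c.
  move=> /(nonconsensus_pair (R := R) n0)[i [j [ij xi xj]]].
  apply: (le_trans (F1 i j c xi xj)).
  apply: ler_wpM2l; first by rewrite addr_ge0 // ltW.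
  rewrite /Phi (bigD1 i) //= (bigD1 j) 1?eq_sym //= -addrA lerDl.
  apply: addr_ge0; first by apply: sumr_ge0.
  by apply: sumr_ge0 => l _; apply: sumr_ge0.
have HPhi c : g0 / 2 <= gamma c -> expect (kernel tau c) Phi <= expR (- kap) * Phi c.
  move=> hc; rewrite /Phi expect_sum mulr_sumr; apply: ler_sum => i _.
  rewrite expect_sum mulr_sumr; apply: ler_sum => j ji.
  apply: le_trans (Fc i j c _ hc) _; first by rewrite eq_sym.
  apply: ler_wpM2r => //; rewrite ler_expR lerN2 /kap.
  by have := ler_wpM2l (ltW p0) hc; clear; lra.
have Hgam c : g0 / 2 <= gamma c ->
    expect (kernel tau c) (fun c' => expR (- (lam * gamma c'))) <=
    expR eps * expR (- (lam * gamma c)) + expR (- (6 * L)).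
  move=> hc.
  have lN : 512 * lam <= N by rewrite /lam mulrA ler_pdivrMr //; move: LN L0; clear; lra.
  have l8 : 8 * lam <= N by move: lN lam0; clear; lra.
  apply: le_trans (expect_expR_gamma n0 ft lam0 l8 (Hv c)) _.
  have [gs|gl] := leP (gamma c) (2 * g0).
    rewrite -[leLHS]addr0; apply: lerD; last exact: expR_ge0.
    by rewrite -expRD ler_expR addrC lerD2r; exact: Hnu.
  rewrite -[leLHS]add0r; apply: lerD; first by rewrite mulr_ge0 ?expR_ge0.
  rewrite ler_expR.
  (* Above [2 * g0] even the crude [nu <= 16 gamma] costs at most a quarter of the exponent, and the
     rest is at least [3 / 4 * 8 L = 6 L], the exponent of the additive error. *)
  have h1 : 8 * lam ^+ 2 * nu (gamma c) / N <= lam * gamma c / 4.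
    rewrite ler_pdivrMr //.
    have e1 : 8 * lam ^+ 2 * nu (gamma c) <= 8 * lam ^+ 2 * (16 * gamma c).
      by apply: ler_wpM2l => //; rewrite mulr_ge0 ?sqr_ge0.
    have e2 : 0 <= lam * gamma c by rewrite mulr_ge0 // gamma_ge0.
    have := ler_wpM2l e2 lN; move: e1; clear; lra.
  have h2 : lam * (2 * g0) <= lam * gamma c by apply: ler_wpM2l => //; exact: ltW.
  have h3 : lam * (2 * g0) = 8 * L by rewrite /lam; field; rewrite gt_eqF.
  by move: h1 h2; rewrite h3; clear; lra.
have M0 : 0 <= 1 + N by rewrite addr_ge0 // ltW.
apply: le_trans (avoid_bound n0 ft PE Phi0 PhiM M0 lam0 eps0 (expR_ge0 _) HPhi Hgam T0 c0) _.
have pw m : expR (- (m%:R * L)) = (N ^+ m)^-1 by rewrite expRN expRM_natl LE.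
have t1 : expR (- (kap * T0%:R)) <= (N ^+ 5)^-1.
  rewrite -pw ler_expR lerN2.
  apply: le_trans (ler_wpM2l _ aT0); last by rewrite /kap mulr_ge0 ?divr_ge0 // ltW.
  by rewrite /kap /a le_eqVlt; apply/orP; left; apply/eqP; field; rewrite !gt_eqF.
have t2 : Phi c0 <= 2 * N ^+ 2.
  have kN : k%:R <= N by rewrite ler_nat.
  apply: (@le_trans _ _ (\sum_(i < k) \sum_(j < k) 2)).
    apply: ler_sum => i _; rewrite big_mkcond; apply: ler_sum => j _.
    by case: ifP.
  rewrite !sumr_const !card_ord -(mulr_natr _ k) -(mulr_natr 2 k) -mulrA expr2; apply: ler_wpM2l => //.
  by apply: ler_pM.
have t3 : expR (lam * (g0 / 2)) = N ^+ 2.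
  rewrite (_ : lam * (g0 / 2) = 2 * L) ?expRM_natl ?LE //.
  by rewrite /lam; field; rewrite gt_eqF.
have t4 : expR (eps * T0%:R) <= N.
  rewrite -LE ler_expR; apply: le_trans (ler_wpM2l eps0 T0a) _.
  by rewrite mulrC.
have t5 : expR (- (lam * gamma c0)) = (N ^+ 4)^-1.
  by rewrite -pw; congr (expR (- _)); rewrite /lam -/g0 divfK // gt_eqF.
have t6 : T0%:R <= N := le_trans T0a aN.
rewrite t3 t5 pw.
have b1 : expR (- (kap * T0%:R)) * ((1 + N) * Phi c0) <= 4 / N.
  apply: (@le_trans _ _ ((N ^+ 5)^-1 * ((2 * N) * (2 * N ^+ 2)))).
    apply: ler_pM => //; rewrite ?expR_ge0 ?mulr_ge0 //.
    by apply: ler_pM => //; move: N1; clear; lra.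
  have -> : (N ^+ 5)^-1 * (2 * N * (2 * N ^+ 2)) = 4 / N * N^-1.
    by field; rewrite gt_eqF.
  by rewrite ler_piMr ?divr_ge0 ?invf_le1 // ltW.
have b2 : N ^+ 2 * (expR (eps * T0%:R) * ((N ^+ 4)^-1 + T0%:R / N ^+ 6)) <= 2 / N.
  apply: (@le_trans _ _ (N ^+ 2 * (N * ((N ^+ 4)^-1 + N / N ^+ 6)))).
    apply: ler_wpM2l; first by rewrite exprn_ge0 // ltW.
    have i4 : 0 <= (N ^+ 4)^-1 by rewrite invr_ge0 exprn_ge0 // ltW.
    have i6 : 0 <= (N ^+ 6)^-1 by rewrite invr_ge0 exprn_ge0 // ltW.
    apply: ler_pM; rewrite ?expR_ge0 //; first by rewrite addr_ge0 // mulr_ge0.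
    by rewrite lerD2l ler_wpM2r.
  have -> : N ^+ 2 * (N * ((N ^+ 4)^-1 + N / N ^+ 6)) = N^-1 + N^-1 * N^-1.
    by field; rewrite gt_eqF.
  have Ni : 0 <= N^-1 by rewrite invr_ge0 ltW.
  have Ni1 : N^-1 <= 1 by rewrite invf_le1.
  by have := ler_wpM2l Ni Ni1; rewrite mulr1; clear; lra.
by move: b1 b2; clear; lra.
Qed.
End Tail.

Section Rules.
Context {R : realType} {n k : nat}.
Implicit Types (c : config n k).
Local Notation gamma := (@gamma R n k).
Local Notation N := (n%:R : R).
Local Notation L := (ln N).

Lemma prob_cons_ge (S : finType) (rule : config n k -> 'I_n -> S -> 'I_k) tau T c0 (b : R) :
  (0 < n)%N -> fallback tau ->
  (forall c c', trans R rule c c' = \prod_v kernel tau c v (c' v)) ->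
  avoid (trans R rule) (fun c => (~~ is_consensus c)%:R) T c0 <= b ->
  1 - b <= prob_cons_by R rule c0 T.
Proof.
move=> n0 ft PE hb; rewrite prob_cons_byE; first by rewrite lerD2l lerN2.
move=> c; rewrite -(expect_cst 1 (kernel_pmf c n0 ft)) /expect.
by apply: eq_bigr => c' _; rewrite PE mulr1.
Qed.

Lemma maj_tail (tau C : R) T c0 : (k <= n)%N -> (0 < n)%N ->
  0 < tau -> 20 * tau <= 1 / 1000 ->
  3 * 1000 <= C -> 64 * 64 * (4 * 1000 / tau) <= C -> (tau ^+ 4)^-1 <= C ->
  1 <= L -> C * L / Num.sqrt N <= gamma c0 -> 4 * 1000 / tau * L / gamma c0 <= T%:R ->
  1 - 6 / N <= prob_cons_by R (@maj3_rule n k) c0 T.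
Proof.
move=> kn n0 t0 ht C3 CC1 CK L1 hg aT.
have ft := fallback_maj (R := R) (k := k) n0.
have PE c c' := trans_maj3 (R := R) c c' n0.
apply: (prob_cons_ge n0 ft PE).
have N0 : 0 < N by rewrite ltr0n.
have L0 : 0 < L by apply: lt_le_trans L1.
set g := gamma c0 in hg aT *; have g1 : g <= 1 by apply: gamma_le1.
pose s := Num.sqrt N.
have s0 : 0 < s by rewrite sqrtr_gt0.
have sN : N = s ^+ 2 by rewrite sqr_sqrtr // ltW.
rewrite ler_pdivrMr // in hg.
have C0 : 0 <= C by move: C3; clear; lra.
have CL : C <= C * L by rewrite ler_peMr.
have Cs : C * L <= s by apply: (le_trans hg); rewrite -[leRHS]mul1r ler_wpM2r // ltW.
have s1 : 1 <= s by move: C3 CL Cs; clear; lra.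
have Ng : C * L <= N * g.
  have -> : N * g = s * (g * s) by rewrite sN; ring.
  apply: (le_trans hg).
  by rewrite ler_peMl // mulr_ge0 ?gamma_ge0 // ltW.
have g0 : 0 < g.
  rewrite -(pmulr_rgt0 _ N0); apply: lt_le_trans Ng; rewrite mulr_gt0 //.
  by move: C3; clear; lra.
have C1C : 4 * 1000 / tau <= C.
  have : 0 <= 4 * 1000 / tau by rewrite divr_ge0 ?mulr_ge0 // ltW.
  by move: CC1; clear; lra.
have t4 : 0 < tau ^+ 4 by rewrite exprn_gt0.
have hN : 1 <= tau ^+ 4 * N.
  rewrite -ler_pdivrMl // mulr1; apply: (le_trans CK).
  apply: (le_trans CL); apply: (le_trans Cs); rewrite sN expr2.
  by rewrite ler_peMl // ltW.
have LN : 3 * (1000 * L) <= N * g.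
  apply: le_trans Ng; have := ler_wpM2r (ltW L0) C3; clear; lra.
have t1 : tau <= 1 / 10 by move: ht t0; clear; lra.
have t1' : tau <= 1 by move: t1; clear; lra.
pose eps := 128 * (4 * L / g) ^+ 2 * g / N.
apply: (@consensus_tail R n k _ _ (maj_pot tau) (fun g => 8 * g) tau eps T c0 n0 kn ft PE) => //.
- by rewrite divr_ge0 ?(ltW N0) // mulr_ge0 ?(ltW g0) // mulr_ge0 // sqr_ge0.
- by move=> i j c; exact: maj_pot_ge0.
- by move=> i j c; exact: maj_pot_le2.
- by move=> i j c; exact: maj_pot_ge.
- move=> i j c ij hc.
  have h16 : 16 <= N * gamma c.
    by have := ler_wpM2l (ltW N0) hc; move: LN L1; rewrite -/g; clear; lra.
  apply: le_trans (maj_contraction n0 ij t0 ht t0 (lexx _) hN h16) _.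
  apply: ler_wpM2r; first exact: maj_pot_ge0.
  rewrite ler_expR lerN2; apply: ler_wpM2r; first exact: gamma_ge0.
  by move: t0; clear; lra.
- by move=> c; exact: var_next_maj.
- by move=> c; apply: ler_wpM2r; [exact: gamma_ge0|rewrite ler_nat].
- move=> c; rewrite -/g => hc; rewrite /eps; apply: ler_wpM2r; first by rewrite invr_ge0 ltW.
  by have := ler_wpM2l (sqr_ge0 (4 * L / g)) hc; clear; lra.
(* The place where the threshold is needed: [a * eps] is of order [L^3 / (g^2 N)], so [g] must be of
   order at least [L / sqrt N]. *)
- rewrite -/g.
  have -> : 2 * (4 * 1000 / tau * L / g) * eps =
    64 * 64 * (4 * 1000 / tau) * L ^+ 2 * L / (g ^+ 2 * N).
    by rewrite /eps; field; rewrite !gt_eqF.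
  have gN : 0 < g ^+ 2 * N by rewrite mulr_gt0 ?exprn_gt0.
  rewrite ler_pdivrMr // mulrC; apply: ler_wpM2l; first exact: ltW.
  apply: (@le_trans _ _ ((C * L) ^+ 2)).
    rewrite exprMn; apply: ler_wpM2r; first exact: sqr_ge0.
    apply: (le_trans CC1); rewrite expr2 ler_peMr //.
    by move: C3; clear; lra.
  have -> : g ^+ 2 * N = (g * s) ^+ 2 by rewrite sN; ring.
  apply: lerXn2r => //; rewrite nnegrE.
    by rewrite mulr_ge0 // ltW.
  by rewrite mulr_ge0 // ltW.
- rewrite -/g mulrA ler_pdivrMr //; apply: le_trans Ng.
  rewrite mulrA; apply: ler_wpM2r; first exact: ltW.
  have : 0 <= 4 * 1000 / tau by rewrite divr_ge0 ?mulr_ge0 // ltW.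
  by move: CC1; clear; lra.
Qed.

Lemma two_tail (tau C : R) T c0 : (k <= n)%N -> (0 < n)%N ->
  0 < tau -> 20 * tau <= 1 / 1000 ->
  3 * 1000 <= C -> 128 * 128 * (4 * 1000 / tau) <= C ->
  2 * (1000 * (1000 * (tau ^+ 4)^-1)) <= C ->
  1 <= L -> C * L ^+ 2 / N <= gamma c0 -> 4 * 1000 / tau * L / gamma c0 <= T%:R ->
  1 - 6 / N <= prob_cons_by R (@twoch_rule n k) c0 T.
Proof.
move=> kn n0 t0 ht C3 CC1 CK L1 hg aT.
have ft := fallback_two (R := R) (k := k) n0.
have PE c c' := trans_two (R := R) c c' n0.
apply: (prob_cons_ge n0 ft PE).
have N0 : 0 < N by rewrite ltr0n.
have L0 : 0 < L by apply: lt_le_trans L1.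
set g := gamma c0 in hg aT *; have g1 : g <= 1 by apply: gamma_le1.
rewrite ler_pdivrMr // [g * _]mulrC in hg.
have C0 : 0 <= C by move: C3; clear; lra.
have L2 : L <= L ^+ 2 by rewrite expr2 ler_peMr // ltW.
have Ng : C * L <= N * g by apply: le_trans hg; apply: ler_wpM2l.
have CL : C <= C * L by rewrite ler_peMr.
have g0 : 0 < g.
  rewrite -(pmulr_rgt0 _ N0); apply: lt_le_trans Ng; rewrite mulr_gt0 //.
  by move: C3; clear; lra.
have t4 : 0 < tau ^+ 4 by rewrite exprn_gt0.
pose K := (tau ^+ 4)^-1; rewrite -/K in CK.
have hK : 1 <= tau ^+ 4 * K by rewrite divff ?gt_eqF.
have t1 : tau <= 1 / 10 by move: ht t0; clear; lra.
have t1' : tau <= 1 by move: t1; clear; lra.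
have K1 : 1 <= K by rewrite invf_ge1 // exprn_ile1 // ltW.
have K0 : 0 < K by apply: lt_le_trans K1.
have KN : K <= N.
  have : N * g <= N by rewrite ler_piMr // ltW.
  by move: CK CL Ng K0; clear; lra.
have LN : 3 * (1000 * L) <= N * g.
  apply: le_trans Ng; have := ler_wpM2r (ltW L0) C3; clear; lra.
pose eps := 512 * (4 * L / g) ^+ 2 * g ^+ 2 / N.
apply: (@consensus_tail R n k _ _ (two_pot tau K) (fun g => 16 * g ^+ 2) tau eps T c0 n0 kn ft PE) => //.
- by rewrite divr_ge0 ?(ltW N0) // mulr_ge0 ?sqr_ge0 // mulr_ge0 // sqr_ge0.
- by move=> i j c; exact: two_pot_ge0.
- by move=> i j c; exact: two_pot_le2.
- by move=> i j c; exact: two_pot_ge.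
- move=> i j c ij hc.
  have hNg : 1000 * (1000 * K) <= N * gamma c.
    have := ler_wpM2l (ltW N0) hc; rewrite -/g; move: CK CL Ng; clear; lra.
  exact: (two_contraction n0 ij t0 ht t0 (lexx _) hK hNg).
- by move=> c; exact: var_next_two.
- move=> c; apply: ler_wpM2l => //; rewrite expr2 ler_piMr ?gamma_ge0 //.
  exact: gamma_le1.
- move=> c; rewrite -/g => hc; rewrite /eps; apply: ler_wpM2r; first by rewrite invr_ge0 ltW.
  have c0' := gamma_ge0 (R := R) c.
  have := ler_pM c0' c0' hc hc; rewrite -!expr2 => h.
  by have := ler_wpM2l (sqr_ge0 (4 * L / g)) h; clear; lra.
(* Here [a * eps] is only of order [L^3 / (g N)], and [g] of order [L^2 / N] suffices. *)
- rewrite -/g.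
  have -> : 2 * (4 * 1000 / tau * L / g) * eps =
    128 * 128 * (4 * 1000 / tau) * L ^+ 2 * L / (g * N).
    by rewrite /eps; field; rewrite !gt_eqF.
  have gN : 0 < g * N by rewrite mulr_gt0.
  rewrite ler_pdivrMr // mulrC; apply: ler_wpM2l; first exact: ltW.
  rewrite [g * N]mulrC; apply: le_trans hg.
  by apply: ler_wpM2r; first exact: sqr_ge0.
- rewrite -/g mulrA ler_pdivrMr //; apply: le_trans Ng.
  rewrite mulrA; apply: ler_wpM2r; first exact: ltW.
  have : 0 <= 4 * 1000 / tau by rewrite divr_ge0 ?mulr_ge0 // ltW.
  by move: CC1; clear; lra.
Qed.
End Rules.

Lemma ln_nat_ge1 (R : realType) n : (4 <= n)%N -> 1 <= ln (n%:R : R).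
Proof.
move=> n4; have N0 : 0 < (n%:R : R) by rewrite ltr0n (leq_trans _ n4).
rewrite -[leLHS]expRK ler_ln ?posrE ?expR_gt0 //.
have e2 : expR (1 / 2) <= 2 :> R by apply: le_trans (expR_le_quad _) _; clear; lra.
rewrite [X in expR X](_ : 1 = 2 * (1 / 2)); last by lra.
rewrite expRM_natl; apply: le_trans (lerXn2r 2 _ _ e2) _; rewrite ?nnegrE ?expR_ge0 //.
by apply: (@le_trans _ _ 4); [lra|rewrite ler_nat].
Qed.

Theorem theorem2p1 (R : realType) :
  exists C : R, 0 < C /\
  (* (a) 3-Majority *)
  (exists (C1 c D : R) (n0 : nat), 0 < C1 /\ 0 < c /\ 0 < D /\
     forall (n k : nat), (n0 <= n)%N -> (0 < k)%N -> (k <= n)%N ->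
     forall c0 : config n k,
       C * ln (n%:R : R) / Num.sqrt (n%:R) <= gamma R c0 ->
       forall T : nat, C1 * ln (n%:R : R) / gamma R c0 <= T%:R ->
       1 - D * (n%:R : R) `^ (- c) <= prob_cons_by R (@maj3_rule n k) c0 T) /\
  (* (b) 2-Choices *)
  (exists (C1 c D : R) (n0 : nat), 0 < C1 /\ 0 < c /\ 0 < D /\
     forall (n k : nat), (n0 <= n)%N -> (0 < k)%N -> (k <= n)%N ->
     forall c0 : config n k,
       C * (ln (n%:R : R)) ^+ 2 / n%:R <= gamma R c0 ->
       forall T : nat, C1 * ln (n%:R : R) / gamma R c0 <= T%:R ->
       1 - D * (n%:R : R) `^ (- c) <= prob_cons_by R (@twoch_rule n k) c0 T).
Proof.
(* The largest value that [20 * tau <= 1 / 1000] allows. It also serves as the exponent [p], and [K]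
   is its inverse fourth power. *)
pose tau : R := 1 / (20 * 1000).
have t0 : 0 < tau by rewrite divr_gt0 ?mulr_gt0.
have ht : 20 * tau <= 1 / 1000 by rewrite /tau; lra.
pose C1 := 4 * 1000 / tau; pose K := (tau ^+ 4)^-1.
have C10 : 0 < C1 by apply: divr_gt0 => //; exact: mulr_gt0.
have K0 : 0 < K by rewrite invr_gt0 exprn_gt0.
pose C := 3 * 1000 + 128 * 128 * C1 + 2 * (1000 * (1000 * K)).
have CC1 : 128 * 128 * C1 <= C by move: K0; rewrite /C; clear; lra.
have CK : 2 * (1000 * (1000 * K)) <= C by move: C10; rewrite /C; clear; lra.
have C3 : 3 * 1000 <= C by move: C10 K0; rewrite /C; clear; lra.
exists C; split; first by move: C3; clear; lra.
have inv1 n : (4 <= n)%N -> (n%:R : R) `^ (- 1) = n%:R^-1.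
  by move=> n4; rewrite powRN powRr1.
split; exists C1, 1, 6, 4%N; do 3!split=> //; move=> n k n4 k0 kn c0 hg T hT.
  have n0 : (0 < n)%N by apply: leq_trans n4.
  rewrite inv1 //; apply: (@maj_tail R n k tau C) => //.
  - by move: CC1 C10; rewrite -/C1; clear; lra.
  - by rewrite -/K; move: CK K0; clear; lra.
  - exact: ln_nat_ge1.
have n0 : (0 < n)%N by apply: leq_trans n4.
rewrite inv1 //; apply: (@two_tail R n k tau C) => //.
exact: ln_nat_ge1.
Qed.
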